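(* Let $(M,\sigma)$ be a compact connected $7$-manifold with a nearly parallel $\mathrm{G}_2$-structure, normalized so that $\tau_0=4$, i.e. $d\sigma=4*\sigma$, and assume that the induced metric $g$ does not have constant curvature. Let $$D_1=\{f_1\in\Omega^1(M)\mid \nabla f_1=-\tfrac14\tau_0\,f_1\lrcorner\sigma\}.$$ Then: (1) $(M,\sigma)$ is of type 1 if and only if $\dim D_1=0$; (2) $(M,\sigma)$ is of type 2 if and only if $\dim D_1=1$; (3) $(M,\sigma)$ is of type 3 if and only if $\dim D_1=2$.
   Context: On $\mathbb{R}^7$ with standard basis let $\sigma_0=e^{123}+e^{145}+e^{246}+e^{347}-e^{167}+e^{257}-e^{356}$. A $\mathrm{G}_2$-structure on a $7$-manifold $M$ is a $3$-form $\sigma$ which at each point equals $\sigma_0$ in a suitable coframe; declaring such coframes oriented and orthonormal gives a metric $g$, an orientation and a Hodge star $*$ (equivalently $-6g(X,Y)*1=(X\lrcorner\sigma)\wedge(Y\lrcorner\sigma)\wedge\sigma$). It is nearly parallel if $d\sigma=\tau_0*\sigma$ for a constant $\tau_0\neq 0$. $\nabla$ is the Levi-Civita connection, and $\nabla f_1=-\frac14\tau_0 f_1\lrcorner\sigma$ means $(\nabla_Xf_1)(Y)=-\frac14\tau_0\,\sigma(f_1^\sharp,X,Y)$. A $\mathrm{G}_2$-structure determines a canonical spin structure (via the lift of $\mathrm{G}_2\subset\mathrm{SO}(7)$ to $\mathrm{Spin}(7)$), and a nearly parallel one determines, up to a constant factor, a nonzero real Killing spinor for it, i.e. a spinor $\psi$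 with $\nabla_X\psi=\lambda X\cdot\psi$ for all $X$, with a real constant $\lambda\ne0$. ''The space of real Killing spinors'' means the space of all Killing spinors with this constant $\lambda$, for the spin structure determined by $\sigma$, in the complex spinor bundle (complex dimension) or equivalently in the real spinor bundle (real dimension). Types (for compact nearly parallel $\mathrm{G}_2$-manifolds not of constant curvature; these are all the possibilities): $(M,\sigma)$ is of type $k$, $k\in\{1,2,3\}$, if the space of real Killing spinors is $k$-dimensional. (Type 1 is called proper. In type 2 the metric is induced by a Sasaki–Einstein but not by a $3$-Sasakian structure; in type 3 it is induced by a $3$-Sasakian structure.) *)

(* Defs.v *)
From mathcomp Require Import all_boot all_order all_algebra.
From mathcomp Require Import all_classical all_reals all_analysis.

Set Implicit Arguments.
Unset Strict Implicit.
Unset Printing Implicit Defensive.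

Import Order.TTheory GRing.Theory Num.Theory.
Import numFieldNormedType.Exports.

Local Open Scope classical_set_scope.
Local Open Scope ring_scope.

(* Conventions.  Vectors are rows and linear maps act on the right.  A frame
   (e_1, ..., e_7) of a tangent space is the matrix F whose k-th row lists the
   components of e_k in a chart; the dual coframe is [invmx F], whose k-th
   column lists the components of e^k.  Tensor fields are families of
   component functions, one for each chart, of the coordinates y of that
   chart. *)

Section LinearAlgebra.
Variable R : realType.

Definition tensor3 := 'I_7 -> 'I_7 -> 'I_7 -> R.
Definition tensor4 := 'I_7 -> 'I_7 -> 'I_7 -> 'I_7 -> R.

Definition pull3 (A : 'M[R]_7) (s : tensor3) : tensor3 := fun a b c =>
  \sum_(k < 7) \sum_(l < 7) \sum_(m < 7) A a k * A b l * A c m * s k l m.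

(* Components of e^{pqr}; the labels p, q, r run from 1 to 7. *)
Definition e3 (p q r : nat) : tensor3 := fun a b c =>
  \det (\matrix_(u < 3, v < 3)
          (nth 0 [:: a.+1; b.+1; c.+1] u == nth 0 [:: p; q; r] v)%N%:R : 'M[R]_3).

Definition sigma0 : tensor3 := fun a b c =>
  e3 1 2 3 a b c + e3 1 4 5 a b c + e3 2 4 6 a b c + e3 3 4 7 a b c
  - e3 1 6 7 a b c + e3 2 5 7 a b c - e3 3 5 6 a b c.

Definition levi_civita (t : seq 'I_7) : R :=
  \det (\matrix_(u < 7, v < 7) (nth ord0 t u == v)%:R : 'M[R]_7).

Definition adapted_frame (s : tensor3) : set 'M[R]_7 :=
  [set F | F \in unitmx /\ pull3 F s = sigma0].

(* A coframe in which s takes the form sigma0 (arbitrary if there is none). *)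
Definition coframe_of (s : tensor3) : 'M[R]_7 :=
  invmx (xget 1%:M (adapted_frame s)).

Definition metric_of (s : tensor3) : 'M[R]_7 :=
  coframe_of s *m (coframe_of s)^T.

Definition volume_of (s : tensor3) (t : seq 'I_7) : R :=
  \det (coframe_of s) * levi_civita t.

(* ( *s )_{defg} = 1/3! s^{abc} vol_{abcdefg} *)
Definition star_of (s : tensor3) : tensor4 := fun d e f g =>
  (3`!%:R)^-1 * \sum_(a < 7) \sum_(b < 7) \sum_(c < 7)
     pull3 (invmx (metric_of s)) s a b c * volume_of s [:: a; b; c; d; e; f; g].

Definition G2 : set 'M[R]_7 := adapted_frame sigma0.

(* The real spin module R^8 = R + R^7, with v . (a, w) = (- <v, w>, a v + v x w)
   and <u x v, w> = sigma0(u, v, w), so that v . v . psi = - |v|^2 psi.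
   The spinor v . psi is [psi *m clifford v]. *)
Definition clifford (v : 'rV[R]_7) : 'M[R]_(1 + 7) :=
  block_mx 0 v
           (- v^T) (\matrix_(j < 7, k < 7) \sum_(i < 7) v 0 i * sigma0 i j k).

Definition Spin7 : set 'M[R]_8 :=
  [set S | exists vs : seq 'rV[R]_7,
     [/\ ~~ odd (size vs),
         forall v, v \in vs -> v *m v^T = 1%:M
       & S = \big[mulmx/1%:M]_(v <- vs) clifford v]].

(* rho is a lift G_2 -> Spin(7) of the inclusion G_2 -> SO(7): the conditions
   say that rho is a continuous homomorphism into Spin(7) and that conjugation
   by rho g induces v |-> v *m g on vectors. *)
Definition spin_lift (rho : 'M[R]_7 -> 'M[R]_8) : Prop :=
  [/\ {within G2, continuous rho},
      forall g, G2 g -> Spin7 (rho g),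
      forall g h, G2 g -> G2 h -> rho (g *m h) = rho g *m rho h
    & forall g v, G2 g ->
        (clifford v : 'M[R]_8) *m rho g = rho g *m (clifford (v *m g) : 'M[R]_8)].

(* A is a linear subspace of dimension n. *)
Definition has_dimension (V : lmodType R) (A : set V) (n : nat) : Prop :=
  exists b : 'I_n -> V,
    injective (fun c : 'rV[R]_n => \sum_(i < n) c 0 i *: b i) /\
    range (fun c : 'rV[R]_n => \sum_(i < n) c 0 i *: b i) = A.

End LinearAlgebra.

Section LocalCalculus.
Variable R : realType.
Local Notation E := 'rV[R]_7.

Definition partial (V : normedModType R) (a : 'I_7) (f : E -> V) : E -> V :=
  fun y => 'D_(delta_mx 0 a) f y.

Fixpoint Ck (V : normedModType R) (k : nat) (U : set E) (f : E -> V) : Prop :=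
  match k with
  | 0 => forall y, U y -> {for y, continuous f}
  | k'.+1 => (forall y, U y -> differentiable f y) /\
             (forall a : 'I_7, Ck k' U (partial a f))
  end.

(* Meaningful for U open. *)
Definition smooth_on (V : normedModType R) (U : set E) (f : E -> V) : Prop :=
  forall k, Ck k U f.

Definition ext_deriv (s : E -> tensor3 R) (y : E) : tensor4 R := fun a b c d =>
  partial a (fun z => s z b c d : R^o) y - partial b (fun z => s z a c d : R^o) y
  + partial c (fun z => s z a b d : R^o) y - partial d (fun z => s z a b c : R^o) y.

(* Gamma^c_{ab} of the Levi-Civita connection of g. *)
Definition christoffel (g : E -> 'M[R]_7) (c a b : 'I_7) (y : E) : R :=
  2^-1 * \sum_(d < 7) invmx (g y) c d *
    (partial a (fun z => g z b d : R^o) y + partial b (fun z => g z a d : R^o) y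
     - partial d (fun z => g z a b : R^o) y).

(* R(d_a, d_b) d_c = sum_d (riemann g d c a b) d_d, with
   R(X, Y) = [nabla_X, nabla_Y] - nabla_[X, Y]. *)
Definition riemann (g : E -> 'M[R]_7) (d c a b : 'I_7) (y : E) : R :=
  partial a (fun z => christoffel g d b c z : R^o) y
  - partial b (fun z => christoffel g d a c z : R^o) y
  + \sum_(e < 7) (christoffel g d a e y * christoffel g e b c y
                  - christoffel g d b e y * christoffel g e a c y).

Definition inner (G : 'M[R]_7) (u v : E) : R := (u *m G *m v^T) 0 0.

(* The sectional curvature is kappa on every plane <u, v> at y:
   g(R(u, v) v, u) = kappa (|u|^2 |v|^2 - g(u, v)^2), where both sides vanish
   for linearly dependent u and v. *)
Definition sectional_curvature_is (g : E -> 'M[R]_7) (kappa : R) (y : E) : Prop :=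
  forall u v : E,
    inner (g y)
      (\row_(d < 7) \sum_(c < 7) \sum_(a < 7) \sum_(b < 7)
          riemann g d c a b y * v 0 c * u 0 a * v 0 b) u
    = kappa * (inner (g y) u u * inner (g y) v v - inner (g y) u v ^+ 2).

(* (nabla_{d_a} f)_b for a 1-form f. *)
Definition nabla_form (g : E -> 'M[R]_7) (f : E -> E) (a b : 'I_7) (y : E) : R :=
  partial a (fun z => f z 0 b : R^o) y - \sum_(c < 7) christoffel g c a b y * f y 0 c.

(* nabla_{d_a} e_k for the local frame F. *)
Definition nabla_frame (g : E -> 'M[R]_7) (F : E -> 'M[R]_7) (a k : 'I_7) (y : E) : E :=
  \row_(c < 7) (partial a (fun z => F z k c : R^o) y
                + \sum_(b < 7) christoffel g c a b y * F y k b).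

(* nabla_{d_a} ph = d_a ph + 1/4 sum_{k,l} g(nabla_{d_a} e_k, e_l) e_k . e_l . ph,
   for the expression ph of a spinor field in the local orthonormal frame F. *)
Definition nabla_spinor (g : E -> 'M[R]_7) (F : E -> 'M[R]_7) (ph : E -> 'rV[R]_8)
    (a : 'I_7) (y : E) : 'rV[R]_8 :=
  partial a ph y + 4^-1 *: \sum_(k < 7) \sum_(l < 7)
    inner (g y) (nabla_frame g F a k y) (row l (F y)) *:
      (ph y *m clifford (delta_mx 0 l) *m clifford (delta_mx 0 k)).

End LocalCalculus.

Record chart (R : realType) (M : topologicalType) := Chart {
  cdom : set M;
  cmap : M -> 'rV[R]_7;
  cinv : 'rV[R]_7 -> M;
  cdom_open : open cdom;
  cimg_open : open (cmap @` cdom);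
  cmapK : forall x, cdom x -> cinv (cmap x) = x;
  cmap_continuous : {within cdom, continuous cmap};
  cinv_continuous : {within cmap @` cdom, continuous cinv} }.

Definition overlap (R : realType) (M : topologicalType) (c c' : chart R M) :
  set 'rV[R]_7 := cmap c @` (cdom c `&` cdom c').

Definition transition (R : realType) (M : topologicalType) (c c' : chart R M) :
  'rV[R]_7 -> 'rV[R]_7 := cmap c' \o cinv c.

(* A smooth 7-manifold structure on M, given by a (not necessarily maximal)
   atlas. *)
Record manifold7 (R : realType) (M : topologicalType) := Manifold7 {
  mindex : Type;
  mchart : mindex -> chart R M;
  m_hausdorff : hausdorff_space M;
  m_second_countable : @second_countable M;
  m_cover : forall x : M, exists i, cdom (mchart i) x;
  m_smooth : forall i j,
    smooth_on (overlap (mchart i) (mchart j)) (transition (mchart i) (mchart j)) }.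

Section Geometry.
Variables (R : realType) (M : topologicalType) (A : manifold7 R M).
Local Notation E := 'rV[R]_7.
Local Notation I := (mindex A).

Definition cimg (i : I) : set E := cmap (mchart i) @` cdom (mchart i).
Definition movl (i j : I) : set E := overlap (mchart i) (mchart j).
Definition mtrans (i j : I) : E -> E := transition (mchart i) (mchart j).

(* Entry (a, b) is the derivative of the b-th new coordinate along the a-th
   old one. *)
Definition mjac (i j : I) (y : E) : 'M[R]_7 := jacobian (mtrans i j) y.

Definition G2_structure (s : I -> E -> tensor3 R) : Prop :=
  [/\ forall i a b c, smooth_on (cimg i) (fun y => s i y a b c : R^o),
      forall i j y, movl i j y -> s i y = pull3 (mjac i j y) (s j (mtrans i j y))
    & forall i y, cimg i y -> exists B : 'M[R]_7,
        B \in unitmx /\ s i y = pull3 B (@sigma0 R)].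

Section WithStructure.
Variable s : I -> E -> tensor3 R.

Definition G2_metric (i : I) (y : E) : 'M[R]_7 := metric_of (s i y).

Definition nearly_parallel (tau0 : R) : Prop :=
  tau0 != 0 /\
  forall i y, cimg i y -> forall a b c d,
    ext_deriv (s i) y a b c d = tau0 * star_of (s i y) a b c d.

Definition constant_curvature : Prop :=
  exists kappa : R, forall i y, cimg i y ->
    sectional_curvature_is (G2_metric i) kappa y.

(* The components of a 1-form, and the values of a spinor field below, are set
   to 0 outside their domain, so that equality of families is equality of
   fields. *)
Definition one_form : set (I -> E -> E) :=
  [set f | [/\ forall i y, ~ cimg i y -> f i y = 0,
               forall i j y, movl i j y ->
                 f i y = f j (mtrans i j y) *m (mjac i j y)^T
             & forall i, smooth_on (cimg i) (f i)]].

(* (nabla_{d_a} f)(d_b) = - tau0 / 4 * s(f^sharp, d_a, d_b) *)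
Definition D1 (tau0 : R) : set (I -> E -> E) :=
  [set f | one_form f /\
     forall i y, cimg i y -> forall a b,
       nabla_form (G2_metric i) (f i) a b y =
       - (4^-1 * tau0) * \sum_(c < 7) (f i y *m invmx (G2_metric i y)) 0 c * s i y c a b].

Section Spinors.
Variable rho : 'M[R]_7 -> 'M[R]_8.

(* The spin structure determined by s is P x_rho Spin(7), P being the principal
   G_2-bundle of adapted frames, so its spinor bundle is P x_rho R^8 and a
   spinor field is an equivariant function on P, where [g *m F] is the frame
   obtained from F by g in G_2.  Smoothness is tested along local sections of
   P. *)
Definition local_adapted (i : I) (U : set E) (F : E -> 'M[R]_7) : Prop :=
  [/\ open U, U `<=` cimg i, smooth_on U F
    & forall y, U y -> adapted_frame (s i y) (F y)].

Definition spinor_field : set (I -> E -> 'M[R]_7 -> 'rV[R]_8) :=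
  [set ph | [/\
     forall i y F, ~ (cimg i y /\ adapted_frame (s i y) F) -> ph i y F = 0,
     forall i j y F, movl i j y -> adapted_frame (s i y) F ->
       ph i y F = ph j (mtrans i j y) (F *m mjac i j y),
     forall i y F g, cimg i y -> adapted_frame (s i y) F -> G2 g ->
       ph i y F = ph i y (g *m F) *m rho g
   & forall i U F, local_adapted i U F -> smooth_on U (fun y => ph i y (F y))]].

(* nabla_X ph = lambda X . ph; the components of d_a in the frame F are the
   a-th row of [invmx F]. *)
Definition killing (lambda : R) : set (I -> E -> 'M[R]_7 -> 'rV[R]_8) :=
  [set ph | spinor_field ph /\
     forall i U F, local_adapted i U F -> forall y, U y -> forall a,
       nabla_spinor (G2_metric i) F (fun z => ph i z (F z)) a y =
       lambda *: (ph i y (F y) *m clifford (row a (invmx (F y))))].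

(* The spinor fields determined by s up to a constant factor are those that
   are constant as functions on P, with value a G_2-invariant element of R^8. *)
Definition determined_spinor (ph : I -> E -> 'M[R]_7 -> 'rV[R]_8) : Prop :=
  spinor_field ph /\
  exists2 chi : 'rV[R]_8, chi != 0 &
    forall i y F, cimg i y -> adapted_frame (s i y) F -> ph i y F = chi.

Definition of_type (k : nat) : Prop :=
  exists lambda : R,
    [/\ lambda != 0,
        exists2 ph, determined_spinor ph & killing lambda ph
      & has_dimension (killing lambda) k].

End Spinors.
End WithStructure.
End Geometry.

(* Main.v *)
(* In an adapted frame a spinor field for the spin structure of a G_2-structure is
   a function h together with a 1-form f, because the lift rho of G_2 to Spin(7)
   is g |-> diag(1, g).  The equation d sigma = 4 * sigma and its consequence
   d * sigma = 0 determine the part of the Levi-Civita connection form that is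
   transverse to the Lie algebra of G_2.  The spinor (h, f) is therefore Killing
   with constant 1/2 exactly when dh = 0 and f lies in D_1, so the space of
   Killing spinors is the sum of the constants and D_1, and the determined
   spinors are the nonzero constants. *)

(* Conjugation does not see the sign of [rho g], so the lift is at first known only up to sign. The
   sign disappears because every element of G_2 is a product of squares; the squares come from unit
   quaternions acting on the complement of a line of the Fano plane. Metric and Hodge dual rest on
   an arbitrary choice of coframe at each point, while spinor fields are tested along smooth adapted
   frames, which must be constructed. The dual 4-form is smooth as d sigma / 4; its wedge product
   with sigma gives the volume, the form (u _| sigma) /\ (v _| sigma) /\ sigma then gives the
   metric, and a Gram-Schmidt process gives the frame. The transverse part of the connection form is
   a 7 by 7 matrix with components 1 + 7 + 14 + 27 under G_2. The 4-form equation misses the 14,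
   which the closedness of the dual form supplies. The constant 1/2 is the one for which the terms
   proportional to h cancel between connection and Clifford multiplication; a nonzero determined
   spinor excludes all others. *)
Require Import Defs.
From HB Require Import structures.
From mathcomp Require Import all_boot all_order all_algebra.
From mathcomp Require Import all_classical all_reals all_analysis.
From mathcomp Require Import ssrZ ring lra.

Set Implicit Arguments.
Unset Strict Implicit.
Unset Printing Implicit Defensive.

Import Order.TTheory GRing.Theory Num.Theory.
Import numFieldNormedType.Exports.

Local Open Scope classical_set_scope.
Local Open Scope ring_scope.

(** * Components of sigma0, its dual and epsilon *)

(* The match makes a product with a vanishing first factor free under
   call-by-value evaluation. *)
Notation zmul x y :=
  (match x with BinNums.Z0 => BinNums.Z0 | z => BinInt.Z.mul z y end).

Section Reflection.
Variable R : realType.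

Definition zr (z : BinNums.Z) : R := (int_of_Z z)%:~R.

Lemma zr0 : zr BinNums.Z0 = 0. Proof. by []. Qed.
Lemma zr1 : zr (BinInt.Z.of_nat 1) = 1. Proof. by []. Qed.
Lemma zrD x y : zr (BinInt.Z.add x y) = zr x + zr y.
Proof. by rewrite /zr -intrD -(rmorphD int_of_Z). Qed.
Lemma zrM x y : zr (BinInt.Z.mul x y) = zr x * zr y.
Proof. by rewrite /zr -intrM -(rmorphM int_of_Z). Qed.
Lemma zrN x : zr (BinInt.Z.opp x) = - zr x.
Proof. by rewrite /zr -intrN -(rmorphN int_of_Z). Qed.
Lemma zr_nat n : zr (BinInt.Z.of_nat n) = n%:R.
Proof. by rewrite /zr -[n in RHS]Znat.Nat2Z.id; case: n => // n; rewrite /= Pnat.SuccNat2Pos.id_succ. Qed.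

Lemma zr_zmul x y : zr (zmul x y) = zr x * zr y.
Proof. by case: x => [|p|p]; rewrite -?zrM// zr0 mul0r. Qed.

Definition zsumn (n : nat) (f : nat -> BinNums.Z) : BinNums.Z :=
  foldr (fun i z => BinInt.Z.add (f i) z) BinNums.Z0 (iota 0 n).

Lemma sum_zr_ord n (f : nat -> BinNums.Z) :
  \sum_(i < n) zr (f i) = zr (zsumn n f).
Proof.
rewrite -(big_mkord xpredT (fun i => zr (f i))) /index_iota subn0 /zsumn.
by elim: (iota 0 n) => [|a l IH]; rewrite ?big_nil ?zr0//= big_cons zrD IH.
Qed.

Fixpoint delete T (j : nat) (c : seq T) : seq T :=
  if c is x :: c' then if j is j'.+1 then x :: delete j' c' else c' else [::].

Lemma nth_delete T x0 j (c : seq T) k :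
  nth x0 (delete j c) k = nth x0 c (bump j k).
Proof.
elim: c j k => [|x c IH] [|j] [|k] //=; rewrite ?nth_nil//.
by rewrite IH /bump ltnS; case: (j <= k)%N.
Qed.

(** Laplace expansion of a matrix of label coincidences. Zero entries are not expanded, so a
    component of the seven-index epsilon costs a few steps instead of [7!] products. *)
Fixpoint label_det (l c : seq nat) : BinNums.Z :=
  if l is x :: l' then
    zsumn (size l) (fun j => if x == nth 0%N c j then
      (if odd j then BinInt.Z.opp (label_det l' (delete j c))
       else label_det l' (delete j c)) else BinNums.Z0)
  else BinInt.Z.of_nat 1.

Lemma label_detE (l c : seq nat) :
  \det (\matrix_(u < size l, v < size l) (nth 0%N l u == nth 0%N c v)%:R : 'M[R]_(size l))
  = zr (label_det l c).
Proof.
elim: l c => [|x l IH] c; first by rewrite det_mx00 zr1.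
rewrite (expand_det_row _ ord0) /=.
transitivity (\sum_(j < (size l).+1) zr ((fun j => if x == nth 0%N c j then
      (if odd j then BinInt.Z.opp (label_det l (delete j c))
       else label_det l (delete j c)) else BinNums.Z0) j)).
  apply: eq_bigr => j _; rewrite mxE /=; case: eqP => _; last by rewrite mul0r.
  rewrite mul1r /cofactor add0n -signr_odd.
  have -> : \det (row' ord0 (col' j
     (\matrix_(u < (size l).+1, v < (size l).+1) (nth 0%N (x :: l) u == nth 0%N c v)%:R)))
     = zr (label_det l (delete j c)).
    rewrite -IH; congr (\det _); apply/matrixP => u v; rewrite !mxE /=.
    by rewrite nth_delete.
  by case: odd; rewrite ?expr1 ?expr0 ?mul1r// mulN1r zrN.
exact: sum_zr_ord.
Qed.

Definition ords7 : seq 'I_7 := Eval compute in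
  [:: @Ordinal 7 0 isT; @Ordinal 7 1 isT; @Ordinal 7 2 isT; @Ordinal 7 3 isT;
      @Ordinal 7 4 isT; @Ordinal 7 5 isT; @Ordinal 7 6 isT].

Lemma ords7E : ords7 = index_enum 'I_7.
Proof.
apply: (inj_map val_inj); rewrite /index_enum; case: index_enum_key; rewrite -enumT.
by rewrite val_enum_ord.
Qed.

Definition zsum7 (f : 'I_7 -> BinNums.Z) : BinNums.Z :=
  foldr (fun i z => BinInt.Z.add (f i) z) BinNums.Z0 ords7.

Lemma sum_zr7 (f : 'I_7 -> BinNums.Z) : \sum_i zr (f i) = zr (zsum7 f).
Proof.
rewrite -ords7E /zsum7.
by elim: ords7 => [|a l IH]; rewrite ?big_nil ?zr0//= big_cons zrD IH.
Qed.

Definition zsigma_def (a b c : nat) : BinNums.Z :=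
  let e p q r := label_det [:: a.+1; b.+1; c.+1] [:: p; q; r]%N in
  BinInt.Z.sub (BinInt.Z.add (BinInt.Z.sub (BinInt.Z.add (BinInt.Z.add
   (BinInt.Z.add (e 1 2 3) (e 1 4 5)) (e 2 4 6)) (e 3 4 7)) (e 1 6 7)) (e 2 5 7)) (e 3 5 6).

Definition zsigma_table := Eval vm_compute in
  [seq [seq [seq zsigma_def a b c | c <- iota 0 7] | b <- iota 0 7] | a <- iota 0 7].

Definition zsigma (a b c : 'I_7) : BinNums.Z :=
  nth BinNums.Z0 (nth [::] (nth [::] zsigma_table a) b) c.

Definition zdelta (a b : 'I_7) : BinNums.Z :=
  if a == b then BinInt.Z.of_nat 1 else BinNums.Z0.

Definition zeps (a b c d e f g : 'I_7) : BinNums.Z :=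
  label_det [:: val a; val b; val c; val d; val e; val f; val g] (iota 0 7).

(** Six times the Hodge dual of [sigma0]: the sum runs over ordered triples, and [zpsi_table]
    divides by [3!]. *)
Definition zpsi_def (p q r s : 'I_7) : BinNums.Z :=
  zsum7 (fun a => zsum7 (fun b => zsum7 (fun c =>
    zmul (zsigma a b c) (zeps a b c p q r s)))).

Definition zpsi_table := Eval vm_compute in
  [seq [seq [seq [seq BinInt.Z.div (zpsi_def a b c d) (BinInt.Z.of_nat 6)
    | d <- ords7] | c <- ords7] | b <- ords7] | a <- ords7].

Definition zpsi (a b c d : 'I_7) : BinNums.Z :=
  nth BinNums.Z0 (nth [::] (nth [::] (nth [::] zpsi_table a) b) c) d.

Definition psi0 : tensor4 R := fun a b c d => zr (zpsi a b c d).

Definition eps (a b c d e f g : 'I_7) : R := levi_civita R [:: a; b; c; d; e; f; g].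

End Reflection.

(** Instance resolution builds from a statement over all indices a closed boolean, which the virtual
    machine evaluates. *)
Class decides (P : Prop) (b : bool) := decides_true : b -> P.

#[export] Instance decides_forall (P : 'I_7 -> Prop) (b : 'I_7 -> bool) :
  (forall i, decides (P i) (b i)) -> decides (forall i, P i) (all b ords7).
Proof.
move=> H; rewrite /decides ords7E => /allP h i; apply/H/h.
exact: mem_index_enum.
Qed.

#[export] Instance decides_eqZ (x y : BinNums.Z) :
  decides (x = y) (BinInt.Z.eqb x y).
Proof. by move=> /BinInt.Z.eqb_eq. Qed.

#[export] Instance decides_imply (b0 : bool) (P : Prop) (b : bool) :
  decides P b -> decides (b0 -> P) (b0 ==> b).
Proof. by move=> H /implyP h /h /H. Qed.

Ltac decide7 := apply: decides_true; vm_cast_no_check (erefl true).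

Class reified (R : realType) (x : R) (z : BinNums.Z) := reifiedE : x = zr R z.

Section Reified.
Variable R : realType.
Implicit Types x y : R.

Lemma eq_reified x y z t : reified x z -> reified y t -> z = t -> x = y.
Proof. by move=> -> -> ->. Qed.

#[export] Instance reified0 : reified (0 : R) BinNums.Z0. Proof. by []. Qed.
#[export] Instance reified1 : reified (1 : R) (BinInt.Z.of_nat 1). Proof. by []. Qed.
#[export] Instance reifiedD x y z t :
  reified x z -> reified y t -> reified (x + y) (BinInt.Z.add z t).
Proof. by move=> -> ->; rewrite /reified zrD. Qed.
#[export] Instance reifiedN x z : reified x z -> reified (- x) (BinInt.Z.opp z).
Proof. by move=> ->; rewrite /reified zrN. Qed.
#[export] Instance reifiedM x y z t :
  reified x z -> reified y t -> reified (x * y) (zmul z t).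
Proof. by move=> -> ->; rewrite /reified zr_zmul. Qed.
#[export] Instance reified_nat n : reified (n%:R : R) (BinInt.Z.of_nat n).
Proof. by rewrite /reified zr_nat. Qed.
#[export] Instance reified_delta (i j : 'I_7) : reified ((i == j)%:R : R) (zdelta i j).
Proof. by rewrite /zdelta; case: eqP. Qed.
#[export] Instance reified_sum (F : 'I_7 -> R) f :
  (forall i, reified (F i) (f i)) -> reified (\sum_(i < 7) F i) (zsum7 f).
Proof. by move=> H; rewrite /reified -sum_zr7; apply: eq_bigr => i _; apply: H. Qed.
#[export] Instance reified_psi0 a b c d : reified (psi0 R a b c d) (zpsi a b c d).
Proof. by []. Qed.

#[export] Instance reified_eps a b c d e f g :
  reified (eps R a b c d e f g) (zeps a b c d e f g).
Proof.
rewrite /reified /zeps -label_detE /eps /levi_civita.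
congr (\det _); apply/matrixP => u v; rewrite !mxE nth_iota// add0n.
congr (_ %:R); case: u => u; do 7 (case: u => //= u); by rewrite !ltnS ltn0.
Qed.

#[export] Instance reified_sigma0 a b c : reified (sigma0 R a b c) (zsigma a b c).
Proof.
have e3E p q r : e3 R p q r a b c = zr R (label_det [:: a.+1; b.+1; c.+1] [:: p; q; r]%N).
  by rewrite -label_detE.
rewrite /reified /sigma0 !e3E -!zrN -!zrD; congr zr.
move: a b c {e3E}; decide7.
Qed.

End Reified.

(* Proves an identity between tensor components over all indices, both sides
   being polynomials with integer coefficients in eps, sigma0, psi0 and delta. *)
Ltac by_components := intros; eapply eq_reified;
  [ typeclasses eauto | typeclasses eauto | ];
  repeat match goal with i : ordinal 7 |- _ => revert i end;
  decide7.

Section Identities.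
Variable R : realType.
Local Notation s := (@sigma0 R).
Local Notation p := (@psi0 R).
Local Notation d i j := ((i == j)%:R : R).
Implicit Types a b c e i j k : 'I_7.

Lemma sigma0_swap12 a b c : s b a c = - s a b c.
Proof. by_components. Qed.

Lemma sigma0_swap23 a b c : s a c b = - s a b c.
Proof. by_components. Qed.

Lemma star_sigma0 a b c e : \sum_(i < 7) \sum_(j < 7) \sum_(k < 7)
  s i j k * eps R i j k a b c e = 6%:R * p a b c e.
Proof. by_components. Qed.

(** The standard self-contraction of the 4-form. On 2-forms it yields the quadratic equation behind
    [psi0_eigen]. *)
Lemma psi0_contract2 a b c e : \sum_(i < 7) \sum_(j < 7) p a b i j * p c e i j =
  4%:R * (d a c * d b e - d a e * d b c) - 2%:R * p a b c e.
Proof. by_components. Qed.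

End Identities.

(** * The forms preserved by G2 *)

Section Epsilon.
Variable R : realType.
Local Notation I := 'I_7.
Implicit Types (A B C D : 'M[R]_7) (t : tensor3 R) (q : tensor4 R).

Lemma sum_delta (F : I -> R) i : \sum_k (i == k)%:R * F k = F i.
Proof.
rewrite (bigD1 i)//= eqxx mul1r big1 ?addr0// => k /negbTE; rewrite eq_sym => ->.
by rewrite mul0r.
Qed.

Lemma sum_delta' (F : I -> R) i : \sum_k (k == i)%:R * F k = F i.
Proof. by rewrite -[RHS]sum_delta; apply: eq_bigr => k _; rewrite eq_sym. Qed.

Definition det_rows (l : seq 'rV[R]_7) : R := \det (\matrix_(u < 7) nth 0 l u).

Lemma det_rows_slot (l1 l2 : seq 'rV[R]_7) (x : I -> R) :
  (size l1 < 7)%N ->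
  \sum_a x a * det_rows (l1 ++ delta_mx 0 a :: l2) =
  det_rows (l1 ++ (\row_a x a) :: l2).
Proof.
move=> hs; pose u := Ordinal hs.
(* Cofactors along row [u] do not involve that row, so it may be filled with [0]. *)
pose cof j := cofactor (\matrix_(u < 7) nth 0 (l1 ++ 0 :: l2) u) u j.
have E r : det_rows (l1 ++ r :: l2) = \sum_j r 0 j * cof j.
  rewrite /det_rows (expand_det_row _ u); apply: eq_bigr => j _.
  rewrite !mxE nth_cat ltnn subnn /=; congr (_ * (_ * \det _)).
  apply/matrixP => k m; rewrite !mxE.
  have: lift u k != u by rewrite eq_sym neq_lift.
  rewrite -val_eqE /= !nth_cat; case: ltngtP => //= h _.
  by rewrite -(subnSK h).
rewrite E; transitivity (\sum_a \sum_j x a * ((a == j)%:R * cof j)).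
  apply: eq_bigr => a _; rewrite E mulr_sumr; apply: eq_bigr => j _.
  by rewrite mxE /= eq_sym.
rewrite exchange_big /=; apply: eq_bigr => j _; rewrite mxE.
rewrite -[RHS](sum_delta' (fun a => x a * cof j)); apply: eq_bigr => a _; ring.
Qed.

Lemma epsE a b c d e f g : eps R a b c d e f g =
  det_rows [:: delta_mx 0 a; delta_mx 0 b; delta_mx 0 c; delta_mx 0 d;
               delta_mx 0 e; delta_mx 0 f; delta_mx 0 g].
Proof.
rewrite /eps /levi_civita /det_rows; congr (\det _); apply/matrixP => u v.
rewrite !mxE; case: u => u hu.
by do 7 (case: u hu => [|u] hu /=; first by rewrite mxE eq_sym).
Qed.

(** The sums are nested so that [det_rows_slot] absorbs them one row at a time; what results is the
    determinant of the matrix of [eps] times the transpose of [C]. *)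
Lemma eps_mulmx C a b c d e f g :
  \sum_i C i a * (\sum_j C j b * (\sum_k C k c * (\sum_l C l d * (\sum_m C m e *
  (\sum_n C n f * (\sum_o C o g * eps R i j k l m n o)))))) =
  \det C * eps R a b c d e f g.
Proof.
pose r x := \row_i C i x : 'rV[R]_7.
transitivity (det_rows [:: r a; r b; r c; r d; r e; r f; r g]).
  rewrite -(det_rows_slot (l1 := [::]))//; apply: eq_bigr => i _; congr (_ * _).
  rewrite -(det_rows_slot (l1 := [:: _]))//; apply: eq_bigr => j _; congr (_ * _).
  rewrite -(det_rows_slot (l1 := [:: _; _]))//; apply: eq_bigr => k _; congr (_ * _).
  rewrite -(det_rows_slot (l1 := [:: _; _; _]))//; apply: eq_bigr => l _; congr (_ * _).
  rewrite -(det_rows_slot (l1 := [:: _; _; _; _]))//; apply: eq_bigr => m _; congr (_ * _).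
  rewrite -(det_rows_slot (l1 := [:: _; _; _; _; _]))//; apply: eq_bigr => n _; congr (_ * _).
  rewrite -(det_rows_slot (l1 := [:: _; _; _; _; _; _]))//; apply: eq_bigr => o _.
  by rewrite epsE.
rewrite /eps /levi_civita -(det_tr C) mulrC -det_mulmx; congr (\det _).
apply/matrixP => u v; rewrite !mxE.
rewrite (bigD1 (nth ord0 [:: a; b; c; d; e; f; g] u))//= !mxE eqxx mul1r.
rewrite big1 ?addr0; last by move=> j /negbTE h; rewrite !mxE eq_sym h mul0r.
case: u => u hu.
by do 7 (case: u hu => [|u] hu /=; first by rewrite mxE).
Qed.

Local Notation I7 := (I * I * I * I * I * I * I)%type.
Definition eps7 (x : I7) : R := let: (a, b, c, d, e, f, g) := x in eps R a b c d e f g.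
Definition wt7 C (x y : I7) : R :=
  let: (a, b, c, d, e, f, g) := x in let: (i, j, k, l, m, n, o) := y in
  C a i * C b j * C c k * C d l * C e m * C f n * C g o.

Lemma pair3_big (F : I -> I -> I -> R) :
  \sum_i \sum_j \sum_k F i j k = \sum_(x : I * I * I) F x.1.1 x.1.2 x.2.
Proof. by rewrite pair_bigA pair_bigA. Qed.

Lemma pair4_big (F : I -> I -> I -> I -> R) :
  \sum_i \sum_j \sum_k \sum_l F i j k l =
  \sum_(x : I * I * I * I) F x.1.1.1 x.1.1.2 x.1.2 x.2.
Proof. by rewrite pair_bigA pair_bigA pair_bigA. Qed.

Lemma pair7_big (F : I7 -> R) : \sum_x F x =
  \sum_a \sum_b \sum_c \sum_d \sum_e \sum_f \sum_g F (a, b, c, d, e, f, g).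
Proof.
rewrite !pair_bigA; apply: eq_bigr => x _; congr F.
by case: x => -[[[[[a b] c] d] e] f] g.
Qed.

Lemma eps7_mulmx C y : \sum_x wt7 C x y * eps7 x = \det C * eps7 y.
Proof.
case: y => -[[[[[a b] c] d] e] f] g; rewrite pair7_big -eps_mulmx.
do 6 (apply: eq_bigr => ? _; rewrite ?mulr_sumr).
by apply: eq_bigr => ? _; rewrite /wt7 /eps7 !mulrA.
Qed.

(** Pulling back a seven-index tensor multiplies its contraction with epsilon by the determinant;
    [eps223_pull] and [eps34_pull] are special cases. *)
Lemma sum_eps7_pull C (T : I7 -> R) :
  \sum_x (\sum_y wt7 C x y * T y) * eps7 x = \det C * \sum_y T y * eps7 y.
Proof.
transitivity (\sum_x \sum_y wt7 C x y * T y * eps7 x).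
  by apply: eq_bigr => x _; rewrite mulr_suml.
rewrite exchange_big mulr_sumr; apply: eq_bigr => y _.
rewrite mulrCA -eps7_mulmx mulr_sumr; apply: eq_bigr => x _.
by rewrite [wt7 _ _ _ * _]mulrC mulrA.
Qed.

Definition pull4 A (t : tensor4 R) : tensor4 R := fun a b c d =>
  \sum_k \sum_l \sum_m \sum_n A a k * A b l * A c m * A d n * t k l m n.

(** The slots may carry different matrices: the derivative of a pull-back and the infinitesimal
    action of a matrix are sums of such tensors. *)
Definition slots3 A B C t : tensor3 R := fun a b c =>
  \sum_(x : I * I * I) A a x.1.1 * B b x.1.2 * C c x.2 * t x.1.1 x.1.2 x.2.

Definition slots4 A B C D q : tensor4 R := fun a b c e =>
  \sum_(x : I * I * I * I) A a x.1.1.1 * B b x.1.1.2 * C c x.1.2 * D e x.2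
    * q x.1.1.1 x.1.1.2 x.1.2 x.2.

Lemma pull3_slots A t : pull3 A t = slots3 A A A t.
Proof. by do 3 (apply/funext => ?); rewrite /pull3 pair3_big. Qed.

Lemma pull4_slots A q : pull4 A q = slots4 A A A A q.
Proof. by do 4 (apply/funext => ?); rewrite /pull4 pair4_big. Qed.

Lemma slots3_comp A B C A' B' C' t :
  slots3 A B C (slots3 A' B' C' t) = slots3 (A *m A') (B *m B') (C *m C') t.
Proof.
apply/funext => a; apply/funext => b; apply/funext => c; rewrite /slots3.
transitivity (\sum_(x : I * I * I) \sum_(y : I * I * I)
   A a x.1.1 * B b x.1.2 * C c x.2 * (A' x.1.1 y.1.1 * B' x.1.2 y.1.2 * C' x.2 y.2)
   * t y.1.1 y.1.2 y.2).
  apply: eq_bigr => x _; rewrite mulr_sumr.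
  by apply: eq_bigr => y _; rewrite !mulrA.
rewrite exchange_big; apply: eq_bigr => y _; rewrite !mxE big_distrlr /= pair_bigA.
rewrite big_distrlr /= pair_bigA mulr_suml; apply: eq_bigr => x _ /=; ring.
Qed.

Lemma slots4_comp A B C D A' B' C' D' q :
  slots4 A B C D (slots4 A' B' C' D' q) =
  slots4 (A *m A') (B *m B') (C *m C') (D *m D') q.
Proof.
apply/funext => a; apply/funext => b; apply/funext => c; apply/funext => e.
rewrite /slots4.
transitivity (\sum_(x : I * I * I * I) \sum_(y : I * I * I * I)
   A a x.1.1.1 * B b x.1.1.2 * C c x.1.2 * D e x.2 *
   (A' x.1.1.1 y.1.1.1 * B' x.1.1.2 y.1.1.2 * C' x.1.2 y.1.2 * D' x.2 y.2)
   * q y.1.1.1 y.1.1.2 y.1.2 y.2).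
  apply: eq_bigr => x _; rewrite mulr_sumr.
  by apply: eq_bigr => y _; rewrite !mulrA.
rewrite exchange_big; apply: eq_bigr => y _; rewrite !mxE big_distrlr /= pair_bigA.
rewrite big_distrlr /= pair_bigA big_distrlr /= pair_bigA mulr_suml.
apply: eq_bigr => x _ /=; ring.
Qed.

Lemma pull3_comp A B t : pull3 A (pull3 B t) = pull3 (A *m B) t.
Proof. by rewrite !pull3_slots slots3_comp. Qed.

Lemma pull4_comp A B q : pull4 A (pull4 B q) = pull4 (A *m B) q.
Proof. by rewrite !pull4_slots slots4_comp. Qed.

Lemma sum_mx1 (F : I -> R) i : \sum_j (1%:M : 'M[R]_7) i j * F j = F i.
Proof. by rewrite -[RHS]sum_delta; apply: eq_bigr => j _; rewrite mxE. Qed.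

Lemma slots3E A B C t a b c : slots3 A B C t a b c =
  \sum_k A a k * (\sum_l B b l * (\sum_m C c m * t k l m)).
Proof.
rewrite /slots3 -(pair3_big (fun k l m => A a k * B b l * C c m * t k l m)).
by do 3 (apply: eq_bigr => ? _; rewrite ?mulr_sumr); rewrite !mulrA.
Qed.

Lemma slots4E A B C D q a b c e : slots4 A B C D q a b c e =
  \sum_k A a k * (\sum_l B b l * (\sum_m C c m * (\sum_n D e n * q k l m n))).
Proof.
rewrite /slots4 -(pair4_big (fun k l m n => A a k * B b l * C c m * D e n * q k l m n)).
by do 4 (apply: eq_bigr => ? _; rewrite ?mulr_sumr); rewrite !mulrA.
Qed.

Lemma pull3_1 t : pull3 1%:M t = t.
Proof. by do 3 (apply/funext => ?); rewrite pull3_slots slots3E !sum_mx1. Qed.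

Lemma pull4_1 q : pull4 1%:M q = q.
Proof. by do 4 (apply/funext => ?); rewrite pull4_slots slots4E !sum_mx1. Qed.

End Epsilon.

(** * Metric, volume and Hodge dual of a G_2-form in an adapted frame *)

Section Forms.
Variable R : realType.
Local Notation s := (@sigma0 R).
Local Notation p := (@psi0 R).
Local Notation I := 'I_7.
Implicit Types (C F T g : 'M[R]_7) (t : tensor3 R).

Definition pull2 C (X : I -> I -> R) : I -> I -> R := fun a b =>
  \sum_k \sum_l C a k * C b l * X k l.

(** On forms, [eps223] and [eps34] are the coefficients of top-degree wedge products, multiplied by
    [2! 2! 3!] and [3! 4!]. *)
Definition eps223 (X Y : I -> I -> R) (Z : I -> I -> I -> R) : R :=
  \sum_a \sum_b X a b * (\sum_c \sum_d Y c d *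
    (\sum_e \sum_f \sum_g Z e f g * eps R a b c d e f g)).

Definition eps34 (X : I -> I -> I -> R) (Y : I -> I -> I -> I -> R) : R :=
  \sum_a \sum_b \sum_c X a b c * (\sum_d \sum_e \sum_f \sum_g
    Y d e f g * eps R a b c d e f g).

Lemma eps223E X Y Z : eps223 X Y Z = \sum_x
  (let: (a, b, c, d, e, f, g) := x in X a b * Y c d * Z e f g) * eps7 R x.
Proof.
rewrite pair7_big /eps223; do 2 (apply: eq_bigr => ? _).
rewrite mulr_sumr; apply: eq_bigr => ? _; rewrite mulr_sumr; apply: eq_bigr => ? _.
rewrite !mulr_sumr; apply: eq_bigr => ? _; rewrite !mulr_sumr; apply: eq_bigr => ? _.
by rewrite !mulr_sumr; apply: eq_bigr => ? _; rewrite /eps7 !mulrA.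
Qed.

Lemma eps34E X Y : eps34 X Y = \sum_x
  (let: (a, b, c, d, e, f, g) := x in X a b c * Y d e f g) * eps7 R x.
Proof.
rewrite pair7_big /eps34; do 3 (apply: eq_bigr => ? _).
do 4 (rewrite mulr_sumr; apply: eq_bigr => ? _).
by rewrite /eps7 !mulrA.
Qed.

Lemma eps223_pull C X Y Z :
  eps223 (pull2 C X) (pull2 C Y) (pull3 C Z) = \det C * eps223 X Y Z.
Proof.
rewrite !eps223E -sum_eps7_pull; apply: eq_bigr => -[[[[[[a b] c] d] e] f] g] _.
congr (_ * _); rewrite pair7_big -mulrA /pull2 /pull3.
do 2 (rewrite mulr_suml; apply: eq_bigr => ? _).
do 2 (rewrite mulr_suml mulr_sumr; apply: eq_bigr => ? _).
do 3 (rewrite !mulr_sumr; apply: eq_bigr => ? _).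
rewrite /wt7; ring.
Qed.

Lemma eps34_pull C X Y :
  eps34 (pull3 C X) (pull4 C Y) = \det C * eps34 X Y.
Proof.
rewrite !eps34E -sum_eps7_pull; apply: eq_bigr => -[[[[[[a b] c] d] e] f] g] _.
congr (_ * _); rewrite pair7_big /pull3 /pull4.
do 3 (rewrite mulr_suml; apply: eq_bigr => ? _).
do 4 (rewrite mulr_sumr; apply: eq_bigr => ? _).
rewrite /wt7; ring.
Qed.

(** The wedge product of [sigma0] with its dual is 7 times the volume, and [1008 = 3! 4! 7]. *)
Lemma eps34_sigma0 : eps34 s p = 1008%:R.
Proof. rewrite /eps34; by_components. Qed.

(* (u _| t) /\ (v _| t) /\ t as a bilinear form in u and v, with respect to the
   coordinate volume: it recovers the metric from a G2-form. *)
Definition bryant_form t : 'M[R]_7 := \matrix_(i, j) eps223 (t i) (t j) t.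

(** The [-6] of the formula that defines the metric of a G_2-form, times [2! 2! 3!]. *)
Lemma bryant_sigma0 : bryant_form s = (- 144%:R)%:M.
Proof.
apply/matrixP => i j; rewrite !mxE; transitivity (- 144%:R * (i == j)%:R : R).
  rewrite /eps223; by_components.
by rewrite mulr_natr.
Qed.

Lemma pull3_pull2 C t i a b : pull3 C t i a b = \sum_k C i k * pull2 C (t k) a b.
Proof.
rewrite /pull3 /pull2; apply: eq_bigr => k _; rewrite mulr_sumr.
apply: eq_bigr => l _; rewrite mulr_sumr; apply: eq_bigr => m _; ring.
Qed.

Lemma eps223_sum (c e : I -> R) (X Y : I -> I -> I -> R) Z :
  eps223 (fun a b => \sum_k c k * X k a b) (fun a b => \sum_l e l * Y l a b) Z =
  \sum_k \sum_l c k * e l * eps223 (X k) (Y l) Z.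
Proof.
transitivity (\sum_k \sum_l \sum_(x : I * I * I * I * I * I * I)
  c k * e l * ((let: (a, b, c, d, e, f, g) := x in X k a b * Y l c d * Z e f g)
   * eps7 R x)); last first.
  by apply: eq_bigr => k _; apply: eq_bigr => l _; rewrite eps223E mulr_sumr.
under eq_bigr do rewrite exchange_big /=.
rewrite exchange_big eps223E; apply: eq_bigr => -[[[[[[a b] i] d] j] f] g] _ /=.
rewrite big_distrlr /= !mulr_suml; apply: eq_bigr => k _.
rewrite !mulr_suml; apply: eq_bigr => l _; ring.
Qed.

Lemma bryant_pull C t : bryant_form (pull3 C t) = \det C *: (C *m bryant_form t *m C^T).
Proof.
apply/matrixP => i j; rewrite !mxE.
rewrite (_ : pull3 C t i = fun a b => \sum_k C i k * pull2 C (t k) a b); last first.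
  by apply/funext => a; apply/funext => b; apply: pull3_pull2.
rewrite (_ : pull3 C t j = fun a b => \sum_k C j k * pull2 C (t k) a b); last first.
  by apply/funext => a; apply/funext => b; apply: pull3_pull2.
rewrite eps223_sum exchange_big mulr_sumr; apply: eq_bigr => l _ /=.
rewrite !mxE mulr_suml mulr_sumr; apply: eq_bigr => k _.
by rewrite eps223_pull !mxE; ring.
Qed.

Lemma expr9_eq1 (x : R) : x ^+ 9 = 1 -> x = 1.
Proof.
move=> h; have x0 : 0 <= x.
  rewrite leNgt; apply/negP => x0.
  by have := @exprn_odd_lt0 R 9 x isT; rewrite h x0 ltr10.
by apply/eqP; rewrite -(pexpr_eq1 (n := 9))// h.
Qed.

(** Invariance of [bryant_form] gives [det g] times [g g^T] equal to 1. Taking determinants, with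
    exponent [7 + 2], yields [(det g)^9 = 1], and 1 is the only real root. *)
Lemma G2_orthogonal g : G2 g -> g *m g^T = 1%:M.
Proof.
case=> gu hg; have := bryant_pull g s; rewrite hg bryant_sigma0.
rewrite mul_mx_scalar -scalemxAl scalerA => h.
have {}h : \det g *: (g *m g^T) = 1%:M.
  apply: (@scalerI _ _ (- 144%:R)); first by rewrite oppr_eq0 pnatr_eq0.
  by rewrite scalerA mulrC -h scalemx1.
suff d1 : \det g = 1 by rewrite -h d1 scale1r.
apply: expr9_eq1; have := congr1 determinant h.
by rewrite detZ det_mulmx det_tr det1 -expr2 -exprD.
Qed.

Lemma G2_det g : G2 g -> \det g = 1.
Proof.
move=> hg; have hu := G2_orthogonal hg; case: hg => gu hg.
have := bryant_pull g s; rewrite hg bryant_sigma0.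
rewrite mul_mx_scalar -scalemxAl scalerA hu scalemx1.
move/matrixP/(_ ord0 ord0); rewrite !mxE !mulr1n => h.
apply: (@mulIf _ (- 144%:R)); first by rewrite oppr_eq0 pnatr_eq0.
by rewrite -h mul1r.
Qed.

Lemma adapted_unit t F : adapted_frame t F -> F \in unitmx.
Proof. by case. Qed.

Lemma adapted_coframe t F : adapted_frame t F -> t = pull3 (invmx F) s.
Proof. by case=> Fu <-; rewrite pull3_comp mulVmx// pull3_1. Qed.

Lemma adapted_G2 t F F' : adapted_frame t F -> adapted_frame t F' ->
  G2 (F' *m invmx F).
Proof.
move=> hF [uF' hF']; have := adapted_coframe hF; case: hF => uF _ ht.
by split; rewrite ?unitmx_mul ?uF' ?unitmx_inv// -pull3_comp -ht.
Qed.

(** The chosen coframe differs from any other by an element of G_2, which is why metric, volume and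
    Hodge dual can be computed in every adapted frame. *)
Lemma coframe_ofP t F : adapted_frame t F ->
  exists2 g, G2 g & invmx F = coframe_of t *m g.
Proof.
move=> hF; have hF' : adapted_frame t (xget 1%:M (adapted_frame t)).
  exact: (xgetI 1%:M hF).
exists (xget 1%:M (adapted_frame t) *m invmx F); first exact: (adapted_G2 hF hF').
by case: hF' => uF' _; rewrite /coframe_of mulmxA mulVmx ?mul1mx.
Qed.

Lemma metric_ofE t F : adapted_frame t F -> metric_of t = invmx F *m (invmx F)^T.
Proof.
case/coframe_ofP => g hg ->; rewrite /metric_of trmx_mul mulmxA -[_ *m g *m _]mulmxA.
by rewrite (G2_orthogonal hg) mulmx1.
Qed.

Lemma coframe_metric_inv F T : F *m T = 1%:M -> invmx (T *m T^T) = F^T *m F.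
Proof.
move=> FT; have h : (T *m T^T) *m (F^T *m F) = 1%:M.
  by rewrite -mulmxA (mulmxA T^T) -trmx_mul FT trmx1 mul1mx (mulmx1C FT).
have [u _] := mulmx1_unit h.
by rewrite -[RHS]mul1mx -(mulVmx u) -mulmxA h mulmx1.
Qed.

Lemma metric_inv t F : adapted_frame t F -> invmx (metric_of t) = F^T *m F.
Proof.
by move=> hF; rewrite (metric_ofE hF) (coframe_metric_inv (mulmxV (adapted_unit hF))).
Qed.

Lemma det_coframe_of t F : adapted_frame t F -> \det (coframe_of t) = \det (invmx F).
Proof. by case/coframe_ofP => g hg ->; rewrite det_mulmx (G2_det hg) mulr1. Qed.

(** Raising the indices of [t] gives the pull-back of [sigma0] by [F^T]. The determinant in the
    volume form is spread by [eps_mulmx] as seven coframe factors over the slots of epsilon; three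
    of them cancel [F^T], four remain, and the 6 of [star_sigma0] cancels [3!]. *)
Lemma star_ofE t F : adapted_frame t F -> star_of t = pull4 (invmx F) p.
Proof.
move=> hF; apply/funext => d; apply/funext => e; apply/funext => f; apply/funext => g.
have uF := adapted_unit hF; set T := invmx F.
have hp : pull3 (invmx (metric_of t)) t = pull3 F^T s.
  by rewrite (metric_inv hF) -pull3_comp; case: hF => _ ->.
have hs : pull3 T^T (pull3 F^T s) = s.
  by rewrite pull3_comp -trmx_mul mulmxV// trmx1 pull3_1.
rewrite /star_of hp.
pose E x y := eps7 R (x.1.1, x.1.2, x.2, y.1.1.1, y.1.1.2, y.1.2, y.2).
pose W3 (x y : I * I * I) := T x.1.1 y.1.1 * T x.1.2 y.1.2 * T x.2 y.2.
pose W4 (y : I * I * I * I) := T d y.1.1.1 * T e y.1.1.2 * T f y.1.2 * T g y.2.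
have key a b c : volume_of t [:: a; b; c; d; e; f; g] =
    \sum_y \sum_z W3 (a, b, c) y * (W4 z * E y z).
  rewrite /volume_of (det_coframe_of hF) -/T -det_tr -/(eps R a b c d e f g) -eps_mulmx.
  rewrite -(pair3_big (fun i j k => \sum_z W3 (a, b, c) (i, j, k) * (W4 z * E (i, j, k) z))).
  apply: eq_bigr => i _; rewrite mulr_sumr; apply: eq_bigr => j _.
  rewrite !mulr_sumr; apply: eq_bigr => k _.
  rewrite -(pair4_big (fun l m n o => W3 (a, b, c) (i, j, k) *
    (W4 (l, m, n, o) * E (i, j, k) (l, m, n, o)))).
  do 4 (rewrite !mulr_sumr; apply: eq_bigr => ? _).
  by rewrite /W3 /W4 /E /= !mxE; ring.
rewrite pair3_big.
transitivity ((3`!%:R)^-1 * \sum_z \sum_y s y.1.1 y.1.2 y.2 * (W4 z * E y z)).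
  congr (_ * _); transitivity (\sum_(x : I * I * I) \sum_y \sum_z
    pull3 F^T s x.1.1 x.1.2 x.2 * (W3 x y * (W4 z * E y z))).
    apply: eq_bigr => -[[a b] c] _; rewrite key mulr_sumr.
    by apply: eq_bigr => y _; rewrite mulr_sumr.
  rewrite exchange_big [RHS]exchange_big; apply: eq_bigr => y _.
  rewrite exchange_big; apply: eq_bigr => z _.
  rewrite -{2}hs /pull3 pair3_big mulr_suml; apply: eq_bigr => x _.
  by rewrite /W3 /pull3 !mxE; ring.
rewrite mulr_sumr /pull4 pair4_big; apply: eq_bigr => z _.
have := star_sigma0 R z.1.1.1 z.1.1.2 z.1.2 z.2; rewrite pair3_big => h.
transitivity (W4 z * ((3`!%:R)^-1 * (6%:R * p z.1.1.1 z.1.1.2 z.1.2 z.2))).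
  rewrite -h mulrCA; congr (_ * _); rewrite mulr_sumr.
  by apply: eq_bigr => y _; rewrite /E /eps7; ring.
by rewrite mulKf// pnatr_eq0.
Qed.

End Forms.

(** * Generators of G2 and basic triples *)

(** The lines of the Fano plane: the supports of the seven monomials of [sigma0], in their order and
    with labels counted from 0. *)
Definition line_points (L : nat) : seq nat :=
  nth [::] [:: [:: 0; 1; 2]; [:: 0; 3; 4]; [:: 1; 3; 5]; [:: 2; 3; 6];
               [:: 0; 5; 6]; [:: 1; 4; 6]; [:: 2; 4; 5]]%N L.

Definition line_table := Eval vm_compute in
  [seq [seq a \in line_points L | a <- iota 0 7] | L <- iota 0 7].

Definition on_line (L a : 'I_7) : bool := nth false (nth [::] line_table L) a.

Definition zon_line (L a : 'I_7) : BinNums.Z :=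
  if on_line L a then BinInt.Z.of_nat 1 else BinNums.Z0.

(* A point off the line L, playing the role of 1 on the complement of L. *)
Definition base (L : 'I_7) : 'I_7 :=
  nth (head ord0 ords7) ords7 (nth 0 [:: 3; 1; 0; 0; 1; 0; 0] L)%N.

Section G2Transitivity.
Variable R : realType.
Local Notation s := (@sigma0 R).
Local Notation I := 'I_7.
Local Notation d i j := ((i == j)%:R : R).
Local Notation e i := (delta_mx 0 i : 'rV[R]_7).
Local Notation o n := (@Ordinal 7 n isT).
Implicit Types (L a b c i j k m u v w : I) (g q : 'M[R]_7).

(** * Elements of G_2 given by unit quaternions *)

Section QuaternionicRotations.
Implicit Types x y z : I -> R.

Definition onL L a : R := (on_line L a)%:R.

#[export] Instance reified_onL L a : reified (onL L a) (zon_line L a).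
Proof. by rewrite /zon_line /onL; case: on_line. Qed.

Lemma onLE L a : onL L a = (on_line L a)%:R. Proof. by []. Qed.

Definition offL L a : R := 1 - onL L a.

#[export] Instance reified_offL L a :
  reified (offL L a) (BinInt.Z.sub (BinInt.Z.of_nat 1) (zon_line L a)).
Proof. by rewrite /zon_line /offL /onL; case: on_line; rewrite ?subrr ?subr0. Qed.

Definition flip L a : R := 1 - 2%:R * d a (base L).

(* The span of the line L together with 1 is a quaternion algebra H, and the
   complement of L is a copy of H with unit base L.  [quat L w] is the left
   multiplication by w on the complement, obtained from the cross product with
   w (which has the opposite handedness) by conjugating with the reflection
   of base L; [quat L (base L)] is the identity of the complement. *)
Definition quat L u a k : R := offL L a * (offL L k *
  (d u (base L) * d a k + onL L u * (flip L a * (flip L k * s u a k)))).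

Definition Q L x : 'M[R]_7 :=
  \matrix_(a, k) (onL L a * d a k + \sum_u x u * quat L u a k).

(** Indicator of the four indices that span the quaternions attached to [L]; [quat L u] vanishes for
    all other [u]. *)
Definition qdom L u : R := onL L u + d u (base L).
Definition qnorm L x : R := \sum_u qdom L u * x u ^+ 2.

#[export] Instance reified_flip L a : reified (flip L a)
  (BinInt.Z.sub (BinInt.Z.of_nat 1) (BinInt.Z.mul (BinInt.Z.of_nat 2) (zdelta a (base L)))).
Proof.
rewrite /flip /zdelta; case: eqP => _; last by rewrite mulr0 subr0.
by rewrite mulr1 -[2]/(1 + 1) opprD addrA subrr add0r.
Qed.

Lemma sum_antisym (D : I -> I -> R) x :
  (forall u v, D u v + D v u = 0) -> \sum_u \sum_v x u * x v * D u v = 0.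
Proof.
move=> h; apply: (mulfI (x := 2%:R)); first by rewrite pnatr_eq0.
rewrite mulr0 mulr_natl mulr2n {2}exchange_big -big_split big1//= => u _.
by rewrite -big_split big1//= => v _; rewrite (mulrC (x v)) -mulrDr h mulr0.
Qed.

Definition tri3 (A B C : I -> I -> R) a b c : R :=
  \sum_k A a k * (\sum_l B b l * (\sum_m s k l m * C c m)).
Definition idL L a k : R := onL L a * d a k.

Lemma tri3_PPP L a b c :
  tri3 (idL L) (idL L) (idL L) a b c = onL L a * (onL L b * (onL L c * s a b c)).
Proof. rewrite /tri3 /idL; by_components. Qed.

Lemma tri3_PPE L u a b c : tri3 (idL L) (idL L) (quat L u) a b c = 0.
Proof. rewrite /tri3 /idL /quat; by_components. Qed.
(** Polarization of a known fact: left multiplication by a quaternion [w] multiplies by [|w|^2] the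
    2-forms which the points of [L] induce on the complement of [L]. *)
Lemma tri3_PEE L u v a b c :
  tri3 (idL L) (quat L u) (quat L v) a b c + tri3 (idL L) (quat L v) (quat L u) a b c
  = 2%:R * (d u v * (qdom L u * (onL L a * (offL L b * (offL L c * s a b c))))).
Proof. rewrite /tri3 /idL /quat /qdom; by_components. Qed.

Lemma tri3_swap12 A B C a b c : tri3 A B C a b c = - tri3 B A C b a c.
Proof.
rewrite /tri3 -sumrN.
transitivity (\sum_k \sum_l A a k * (B b l * \sum_m s k l m * C c m)).
  by apply: eq_bigr => k _; rewrite mulr_sumr.
rewrite exchange_big; apply: eq_bigr => l _ /=; rewrite mulr_sumr -sumrN.
apply: eq_bigr => k _; rewrite !mulr_sumr -sumrN; apply: eq_bigr => m _.
rewrite (sigma0_swap12 _ l k); ring.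
Qed.

Lemma tri3_swap23 A B C a b c : tri3 A B C a b c = - tri3 A C B a c b.
Proof.
rewrite /tri3 -sumrN; apply: eq_bigr => k _; rewrite -mulrN; congr (_ * _).
transitivity (\sum_l \sum_m B b l * (s k l m * C c m)).
  by apply: eq_bigr => l _; rewrite mulr_sumr.
rewrite exchange_big -sumrN; apply: eq_bigr => l _ /=; rewrite mulr_sumr -sumrN.
apply: eq_bigr => m _; rewrite (sigma0_swap23 _ k l m); ring.
Qed.

Lemma tri3_sumr A B (C : I -> I -> I -> R) x a b c :
  tri3 A B (fun a k => \sum_u x u * C u a k) a b c = \sum_u x u * tri3 A B (C u) a b c.
Proof.
transitivity (\sum_k \sum_l \sum_m \sum_u x u * (A a k * (B b l * (s k l m * C u c m)))).
  rewrite /tri3; do 3 (apply: eq_bigr => ? _; rewrite ?mulr_sumr).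
  by apply: eq_bigr => u _; ring.
rewrite pair3_big exchange_big; apply: eq_bigr => u _; rewrite /tri3 mulr_sumr.
rewrite -(pair3_big (fun k l m => x u * (A a k * (B b l * (s k l m * C u c m))))).
by apply: eq_bigr => k _; do 2 (rewrite !mulr_sumr; apply: eq_bigr => ? _).
Qed.

Lemma tri3_sum A (B C : I -> I -> I -> R) x a b c :
  tri3 A (fun a k => \sum_u x u * B u a k) (fun a k => \sum_u x u * C u a k) a b c =
  \sum_u \sum_v x u * x v * tri3 A (B u) (C v) a b c.
Proof.
rewrite exchange_big tri3_sumr; apply: eq_bigr => v _; rewrite tri3_swap23 tri3_sumr.
rewrite -sumrN mulr_sumr; apply: eq_bigr => u _.
by rewrite (tri3_swap23 _ (B u)); ring.
Qed.

Lemma tri3D1 A A' B C a b c :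
  tri3 (fun i j => A i j + A' i j) B C a b c = tri3 A B C a b c + tri3 A' B C a b c.
Proof. by rewrite /tri3 -big_split; apply: eq_bigr => k _; rewrite mulrDl. Qed.

Lemma tri3D2 A B B' C a b c :
  tri3 A (fun i j => B i j + B' i j) C a b c = tri3 A B C a b c + tri3 A B' C a b c.
Proof. by rewrite !(tri3_swap12 A) tri3D1 opprD. Qed.

Lemma tri3D3 A B C C' a b c :
  tri3 A B (fun i j => C i j + C' i j) a b c = tri3 A B C a b c + tri3 A B C' a b c.
Proof. by rewrite !(tri3_swap23 A B) tri3D2 opprD. Qed.

Lemma pull3_tri3 (A : 'M[R]_7) a b c : pull3 A s a b c = tri3 A A A a b c.
Proof.
rewrite /pull3 /tri3; apply: eq_bigr => k _.
do 2 (rewrite ?mulr_sumr; apply: eq_bigr => ? _); ring.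
Qed.

Lemma sigma0_off L a b c : offL L a * (offL L b * (offL L c * s a b c)) = 0.
Proof. by_components. Qed.

(** Any two lines of the Fano plane meet, so a monomial of [sigma0] has either one or three indices
    on [L]. *)
Lemma sigma0_line L a b c : s a b c =
  onL L a * (onL L b * (onL L c * s a b c)) + onL L a * (offL L b * (offL L c * s a b c))
  + onL L b * (offL L a * (offL L c * s a b c)) + onL L c * (offL L a * (offL L b * s a b c)).
Proof. by_components. Qed.

(** Expand [Q L x] into the identity on [L] and the quaternionic part [X] on the complement. The
    block with three indices on [L] is untouched, the blocks with one are multiplied by [qnorm L x],
    and the others vanish. *)
Lemma Q_pull L x : qnorm L x = 1 -> pull3 (Q L x) s = s.
Proof.
move=> nx; apply/funext => a; apply/funext => b; apply/funext => c.
pose X a k := \sum_u x u * quat L u a k.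
have QE : (Q L x : I -> I -> R) = fun a k => idL L a k + X a k.
  by apply/funext => i; apply/funext => k; rewrite mxE.
have PXX i j k : tri3 (idL L) X X i j k = onL L i * (offL L j * (offL L k * s i j k)).
  rewrite tri3_sum; set S := onL L i * _.
  apply/eqP; rewrite -subr_eq0; apply/eqP.
  (* The unit norm turns the right-hand side into a quadratic form in [x] as well, so that the
     polarized identity can be compared coefficientwise. *)
  have -> : S = \sum_u \sum_v x u * x v * (d u v * (qdom L u * S)).
    transitivity (\sum_u qdom L u * x u ^+ 2 * S).
      by rewrite -mulr_suml -/(qnorm L x) nx mul1r.
    apply: eq_bigr => u _; rewrite -[LHS](sum_delta (fun v => qdom L u * (x u * x v) * S)).
    by apply: eq_bigr => v _; ring.
  rewrite -sumrB; under eq_bigr do rewrite -sumrB.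
  under eq_bigr do under eq_bigr do rewrite -mulrBr.
  apply: sum_antisym => u v; rewrite addrACA tri3_PEE -/S (eq_sym v u).
  by case: eqP => [->|_] /=; rewrite ?mulr1n ?mulr0n; ring.
have PPX i j k : tri3 (idL L) (idL L) X i j k = 0.
  by rewrite tri3_sumr big1// => u _; rewrite tri3_PPE mulr0.
have Xoff i k : X i k = X i k * offL L k.
  rewrite /X mulr_suml; apply: eq_bigr => u _; rewrite /quat /offL /onL.
  by case: (on_line L k) => /=; ring.
have XXX i j k : tri3 X X X i j k = 0.
  rewrite /tri3 big1// => k0 _; rewrite mulr_sumr big1// => l _.
  rewrite !mulr_sumr big1// => m _; rewrite (Xoff i) (Xoff j) (Xoff k).
  transitivity (X i k0 * X j l * X k m * (offL L k0 * (offL L l * (offL L m * s k0 l m)))).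
    ring.
  by rewrite sigma0_off mulr0.
rewrite pull3_tri3 QE !(tri3D1, tri3D2, tri3D3) tri3_PPP PPX XXX PXX.
rewrite (tri3_swap23 _ X) PPX.
rewrite (tri3_swap12 X (idL L) (idL L)) (tri3_swap23 _ X) PPX.
rewrite (tri3_swap12 X) PXX (tri3_swap23 X X) (tri3_swap12 X) PXX.
rewrite [RHS](sigma0_line L) (sigma0_swap12 _ a b c).
rewrite (sigma0_swap12 _ a c b) (sigma0_swap23 _ a b c); ring.
Qed.

Lemma G2_1 : G2 (1%:M : 'M[R]_7).
Proof. by split; [exact: unitmx1 | exact: pull3_1]. Qed.

Lemma G2_mul g q : G2 g -> G2 q -> G2 (g *m q).
Proof.
by move=> [ug hg] [uq hq]; split; rewrite ?unitmx_mul ?ug// -pull3_comp hq.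
Qed.

Lemma G2_inv g : G2 g -> G2 (invmx g).
Proof.
by move=> [ug hg]; split; rewrite ?unitmx_inv// -{1}hg pull3_comp mulVmx// pull3_1.
Qed.

(* A sign attached multiplicatively to the elements of G_2 is trivial on squares. *)
Inductive square_product : 'M[R]_7 -> Prop :=
| square_product1 : square_product 1%:M
| square_productM q g : square_product q -> G2 g -> square_product (q *m (g *m g)).

Lemma square_product_G2 q : square_product q -> G2 q.
Proof. by elim=> [|q' g _ hq' hg]; [exact: G2_1 | do 2 apply: G2_mul => //]. Qed.

Lemma square_product_mul q q' :
  square_product q -> square_product q' -> square_product (q *m q').
Proof.
move=> hq; elim=> [|p g _ IH hg]; first by rewrite mulmx1.
by rewrite mulmxA; apply: square_productM.
Qed.

(** A singular [A] would make [bryant_form] of the pull-back vanish. *)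
Lemma pull3_unit (A : 'M[R]_7) t : pull3 A t = s -> A \in unitmx.
Proof.
move=> h; rewrite unitmxE unitfE; apply/negP => /eqP h0.
have := bryant_pull A t; rewrite h bryant_sigma0 h0 scale0r => /matrixP/(_ ord0 ord0).
by rewrite !mxE /= => /eqP; rewrite oppr_eq0 pnatr_eq0.
Qed.

Lemma Q_G2 L x : qnorm L x = 1 -> G2 (Q L x).
Proof. by move=> /Q_pull h; split => //; apply: pull3_unit h. Qed.

(** Polarization of [w^2 = 2 Re(w) w - |w|^2] for quaternions, [base L] being the real unit. *)
Lemma quat_mul L u v a c :
  \sum_k quat L u a k * quat L v k c + \sum_k quat L v a k * quat L u k c
  = 2%:R * (d u (base L) * quat L v a c + d v (base L) * quat L u a c
            - d u v * (qdom L u * quat L (base L) a c)).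
Proof. rewrite /quat /qdom; by_components. Qed.

Lemma quat_dom L u a c : quat L u a c = qdom L u * quat L u a c.
Proof. rewrite /quat /qdom; by_components. Qed.

Lemma quat_on L u a k : onL L a * quat L u a k = 0.
Proof. rewrite /quat; by_components. Qed.

Lemma quat_on' L u a k : onL L k * quat L u a k = 0.
Proof. rewrite /quat; by_components. Qed.

Lemma Q_ext L x y : (forall u, qdom L u * x u = qdom L u * y u) -> Q L x = Q L y.
Proof.
move=> h; apply/matrixP => a k; rewrite !mxE; congr (_ + _).
by apply: eq_bigr => u _; rewrite quat_dom !mulrA ![_ * qdom _ _]mulrC h.
Qed.

Lemma Q_square L x :
  Q L x *m Q L x = Q L (fun u => 2%:R * x (base L) * x u - d u (base L) * qnorm L x).
Proof.
apply/matrixP => a c; rewrite !mxE.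
pose X a k := \sum_u x u * quat L u a k.
have onX b k : onL L b * X b k = 0.
  by rewrite /X mulr_sumr big1// => u _; rewrite mulrCA quat_on mulr0.
have Xon b k : X b k * onL L k = 0.
  by rewrite /X mulr_suml big1// => u _; rewrite -mulrA [_ * onL _ _]mulrC quat_on' mulr0.
have on2 b : onL L b * onL L b = onL L b.
  by rewrite /onL; case: on_line; rewrite ?mulr1 ?mulr0.
transitivity (\sum_k (d a k * (onL L a * (onL L k * d k c)) +
   d a k * (onL L a * X k c) + d k c * (X a k * onL L k) + X a k * X k c)).
  by apply: eq_bigr => k _; rewrite !mxE -/(X _ _) -/(X _ _); ring.
rewrite !big_split /= !sum_delta sum_delta' onX Xon !addr0 mulrA on2; congr (_ + _).
apply/eqP; rewrite -subr_eq0; apply/eqP.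
transitivity (\sum_u \sum_v x u * x v * (\sum_k quat L u a k * quat L v k c
   - (d u (base L) * quat L v a c + d v (base L) * quat L u a c
            - d u v * (qdom L u * quat L (base L) a c)))); last first.
  apply: sum_antisym => u v; rewrite addrACA quat_mul (eq_sym v u).
  by have [->|_] := eqVneq u v; rewrite ?mulr1n ?mulr0n; ring.
transitivity (\sum_u \sum_v x u * x v * (\sum_k quat L u a k * quat L v k c)
  - (\sum_u \sum_v d u (base L) * (x u * x v * quat L v a c)
    + \sum_u \sum_v d v (base L) * (x u * x v * quat L u a c)
    - \sum_u \sum_v d u v * (x u * x v * qdom L u * quat L (base L) a c))); last first.
  rewrite !pair_bigA -[X in _ - X]/(_ + _ - _).
  transitivity (\sum_(p : I * I) (x p.1 * x p.2 * (\sum_k quat L p.1 a k * quat L p.2 k c)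
    - (d p.1 (base L) * (x p.1 * x p.2 * quat L p.2 a c)
    + d p.2 (base L) * (x p.1 * x p.2 * quat L p.1 a c)
    - d p.1 p.2 * (x p.1 * x p.2 * qdom L p.1 * quat L (base L) a c)))).
    by rewrite sumrB sumrB big_split.
  by apply: eq_bigr => p _ /=; ring.
congr (_ - _).
  rewrite /X; transitivity (\sum_k \sum_u \sum_v
      x u * x v * (quat L u a k * quat L v k c)).
    apply: eq_bigr => k _; rewrite big_distrlr; apply: eq_bigr => u _ /=.
    by apply: eq_bigr => v _; ring.
  rewrite exchange_big; apply: eq_bigr => u _; rewrite exchange_big.
  by apply: eq_bigr => v _; rewrite mulr_sumr.
have -> : \sum_u \sum_v d u (base L) * (x u * x v * quat L v a c) = x (base L) * X a c.
  rewrite exchange_big /X mulr_sumr; apply: eq_bigr => v _ /=.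
  by rewrite (sum_delta' (fun u => x u * x v * quat L v a c)) mulrA.
have -> : \sum_u \sum_v d v (base L) * (x u * x v * quat L u a c) = x (base L) * X a c.
  rewrite /X mulr_sumr; apply: eq_bigr => u _ /=.
  by rewrite (sum_delta' (fun v => x u * x v * quat L u a c)); ring.
have -> : \sum_u \sum_v d u v * (x u * x v * qdom L u * quat L (base L) a c)
    = qnorm L x * quat L (base L) a c.
  rewrite /qnorm mulr_suml; apply: eq_bigr => u _ /=.
  by rewrite (sum_delta (fun v => x u * x v * qdom L u * quat L (base L) a c)) /qdom; ring.
transitivity (\sum_u (2%:R * x (base L) * (x u * quat L u a c)) -
   \sum_u d u (base L) * (qnorm L x * quat L u a c)).
  by rewrite -sumrB; apply: eq_bigr => u _; ring.
rewrite -mulr_sumr -/(X a c) sum_delta'; ring.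
Qed.

(** An imaginary unit of the quaternions attached to [L], which serves as a square root of -1. *)
Definition line_point L : I := nth (head ord0 ords7) ords7 (head 0%N (line_points L)).

Lemma qdom_line_point L u : qdom L u * d u (line_point L) = d u (line_point L).
Proof. rewrite /qdom; by_components. Qed.

Lemma qnorm_line_point L : qnorm L (fun u => d u (line_point L)) = 1.
Proof.
rewrite /qnorm; transitivity (\sum_u d u (line_point L) * 1).
  apply: eq_bigr => u _; rewrite -/(qdom L u).
  by rewrite expr2 mulrA qdom_line_point; case: eqP => _; rewrite ?mulr1 ?mulr0 ?mul0r.
by rewrite sum_delta'.
Qed.

Lemma qdom_base L : qdom L (base L) = 1.
Proof. rewrite /qdom; by_components. Qed.

Lemma line_point_base L : d (base L) (line_point L) = 0.
Proof. by_components. Qed.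

Lemma qdom_ge0 L u : 0 <= qdom L u.
Proof. by rewrite /qdom addr_ge0// ler0n. Qed.

Lemma qnorm_base L x : x (base L) ^+ 2 <= qnorm L x.
Proof.
rewrite /qnorm (bigD1 (base L))//= -/(qdom L _) qdom_base mul1r lerDl sumr_ge0// => u _.
by rewrite mulr_ge0 ?sqr_ge0 ?qdom_ge0.
Qed.

Lemma qnorm_eq1_comp L x u : qnorm L x = 1 -> x (base L) = -1 -> u != base L ->
  qdom L u * x u = 0.
Proof.
move=> h hb hu; have := qnorm_base L x; rewrite h hb.
have : qnorm L x = 1 + \sum_(u | u != base L) qdom L u * x u ^+ 2.
  by rewrite /qnorm (bigD1 (base L))//= -/(qdom L _) qdom_base hb mul1r sqrrN expr1n.
rewrite h => /eqP; rewrite -subr_eq0 opprD addrA subrr add0r oppr_eq0.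
rewrite psumr_eq0; last by move=> i _; rewrite mulr_ge0 ?sqr_ge0 ?qdom_ge0.
move=> /allP /(_ u (mem_index_enum _)); rewrite hu /= mulf_eq0 expf_eq0 /=.
by case/orP => /eqP -> _; rewrite ?mul0r ?mulr0.
Qed.

(** A unit quaternion [z] other than -1 has the square root [(z + 1) / |z + 1|], where
    [|z + 1|^2 = 2 (1 + Re z)]. A unit quaternion with real part -1 is -1, the square of an
    imaginary unit. *)
Lemma Q_sqrt L z : qnorm L z = 1 -> exists2 x, qnorm L x = 1 & Q L z = Q L x *m Q L x.
Proof.
move=> hz; have [zb|zb] := eqVneq (z (base L)) (-1).
  exists (fun u => d u (line_point L)); first exact: qnorm_line_point.
  rewrite Q_square line_point_base mulr0; apply: Q_ext => u.
  rewrite /= !mul0r sub0r.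
  rewrite qnorm_line_point.
  have [->|hu] := eqVneq u (base L); first by rewrite zb mulr1.
  by rewrite (qnorm_eq1_comp hz zb hu) mul0r oppr0 mulr0.
have zb1 : 0 < 1 + z (base L).
  have := qnorm_base L z; rewrite hz ltNge => h; apply/negP => h1.
  have {}zb : z (base L) < -1 by rewrite lt_neqAle zb; lra.
  nra.
set n := Num.sqrt (2%:R * (1 + z (base L))).
have n2 : n ^+ 2 = 2%:R * (1 + z (base L)).
  by rewrite /n sqr_sqrtr// mulr_ge0// ltW.
have n0 : n != 0 by rewrite sqrtr_eq0 -ltNge mulr_gt0.
pose x u := (z u + d u (base L)) / n.
have xn : qnorm L x = 1.
  have -> : qnorm L x = (\sum_u (qdom L u * z u ^+ 2 +
      d u (base L) * (qdom L u * (2%:R * z u + 1)))) / n ^+ 2.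
    rewrite /qnorm mulr_suml; apply: eq_bigr => u _; rewrite /x -/(qdom L u).
    by rewrite expr_div_n; case: eqP => _ /=; rewrite ?mulr1n ?mulr0n; field.
  rewrite big_split /= -/(qnorm L z) hz sum_delta' qdom_base n2.
  by field; rewrite gt_eqF.
exists x => //; rewrite Q_square xn; apply: Q_ext => u; congr (_ * _).
rewrite /x eqxx mulr1.
have -> : 2%:R * ((z (base L) + 1) / n) * ((z u + d u (base L)) / n) =
  (2%:R * (1 + z (base L)) / n ^+ 2) * (z u + d u (base L)) by field.
by rewrite -n2 divff ?expf_neq0//; ring.
Qed.

Lemma Q_square_product L z : qnorm L z = 1 -> square_product (Q L z).
Proof.
case/Q_sqrt => x hx ->; rewrite -[X in square_product X]mul1mx.
by apply: square_productM (Q_G2 hx); apply: square_product1.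
Qed.

End QuaternionicRotations.

(** * Simple transitivity of G_2 on basic triples *)

Section BasicTriples.
Implicit Types x y z : 'rV[R]_7.

(** Component [u] of the conjugate of the quaternion that corresponds to the axis [m] off [L].
    Multiplication by its own conjugate takes a vector of the complement to its squared length on
    the axis [base L]. *)
Definition rot_coef L u m : R := d u (base L) * d m (base L) + onL L u * s u (base L) m.

Lemma rot_coef_norm L m k :
  \sum_u qdom L u * (rot_coef L u m * rot_coef L u k) = d m k * offL L m.
Proof. rewrite /qdom /rot_coef; by_components. Qed.

Lemma rot_coef_quat L a m k :
  (\sum_u rot_coef L u m * quat L u a k - d k (base L) * (d a m * offL L a)) +
  (\sum_u rot_coef L u a * quat L u m k - d k (base L) * (d m a * offL L m)) = 0.
Proof. rewrite /quat /rot_coef; by_components. Qed.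

(** Left multiplication by the normalized conjugate of the part of [x] off [L] turns this part onto
    the axis [base L], with its length [r] as coordinate. If that part vanishes there is nothing to
    turn. *)
Lemma line_reduction L x : exists q,
  [/\ square_product q, forall a, on_line L a -> e a *m q = e a
    & exists2 r : R, 0 <= r & forall k, (x *m q) 0 k = onL L k * x 0 k + d k (base L) * r].
Proof.
pose n2 : R := \sum_a offL L a * x 0 a ^+ 2.
have off0 a : 0 <= offL L a by rewrite /offL /onL; case: on_line; rewrite ?subrr ?subr0.
have n2_ge0 : 0 <= n2 by apply: sumr_ge0 => a _; rewrite mulr_ge0 ?sqr_ge0.
have [n20|n20] := eqVneq n2 0.
  exists 1%:M; split; first exact: square_product1.
    by move=> a _; rewrite mulmx1.
  exists 0 => // k; rewrite mulmx1 mulr0 addr0.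
  move/eqP: n20; rewrite psumr_eq0 => [|a _]; last by rewrite mulr_ge0 ?sqr_ge0.
  move=> /allP /(_ k (mem_index_enum _)) /=; rewrite /offL mulf_eq0 expf_eq0 /=.
  by rewrite subr_eq0 => /orP[/eqP <-|/eqP ->]; rewrite ?mul1r ?mulr0.
set n := Num.sqrt n2.
have n_neq0 : n != 0 by rewrite sqrtr_eq0 -ltNge lt_neqAle eq_sym n20.
have nn : n ^+ 2 = n2 by rewrite sqr_sqrtr.
pose z u := (\sum_m x 0 m * rot_coef L u m) / n.
have hz : qnorm L z = 1.
  rewrite /qnorm; transitivity ((\sum_u \sum_m \sum_k
      x 0 m * x 0 k * (qdom L u * (rot_coef L u m * rot_coef L u k))) / n ^+ 2).
    rewrite mulr_suml; apply: eq_bigr => u _; rewrite -/(qdom L u) /z expr_div_n.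
    rewrite mulrA; congr (_ / _); rewrite expr2 big_distrlr mulr_sumr.
    apply: eq_bigr => m _; rewrite mulr_sumr; apply: eq_bigr => k _ /=; ring.
  rewrite nn; apply: canLR (mulfK n20) _; rewrite mul1r exchange_big.
  apply: eq_bigr => m _; rewrite exchange_big /=.
  transitivity (\sum_k d m k * (x 0 m * x 0 k * offL L m)).
    by apply: eq_bigr => k _; rewrite -mulr_sumr rot_coef_norm; ring.
  by rewrite sum_delta; ring.
exists (Q L z); split; first exact: Q_square_product.
  move=> a ha; rewrite -rowE; apply/rowP => k; rewrite !mxE onLE ha mul1r eqxx /=.
  rewrite (eq_sym k) big1 ?addr0// => u _; rewrite /quat /offL /onL ha.
  by rewrite subrr mul0r mulr0.
exists n; first exact: sqrtr_ge0.
move=> k; rewrite mxE.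
transitivity (\sum_a d a k * (onL L a * x 0 a) + \sum_a \sum_m
   x 0 a * x 0 m * (\sum_u rot_coef L u m * quat L u a k) / n).
  rewrite -big_split; apply: eq_bigr => a _; rewrite mxE mulrDr; congr (_ + _).
    by rewrite /=; ring.
  rewrite mulr_sumr /z; transitivity (\sum_u \sum_m
     x 0 a * x 0 m * (rot_coef L u m * quat L u a k) / n).
    apply: eq_bigr => u _; rewrite mulrAC mulr_suml mulr_suml mulr_sumr.
    by apply: eq_bigr => m _; ring.
  by rewrite exchange_big; apply: eq_bigr => m _; rewrite -mulr_suml -mulr_sumr.
rewrite sum_delta'; congr (_ + _).
have -> : d k (base L) * n = \sum_a \sum_m
    x 0 a * x 0 m * (d k (base L) * (d a m * offL L a)) / n.
  transitivity (d k (base L) * n2 / n).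
    by rewrite -nn -mulrA expr2 mulfK.
  rewrite /n2 mulr_sumr mulr_suml; apply: eq_bigr => a _.
  transitivity (\sum_m d a m * (x 0 a * x 0 m * (d k (base L) * offL L a) / n)).
    by rewrite sum_delta; ring.
  by apply: eq_bigr => m _; ring.
apply/eqP; rewrite -subr_eq0 -sumrB; apply/eqP.
under eq_bigr do rewrite -sumrB.
under eq_bigr do under eq_bigr do rewrite -mulrBl -mulrBr.
transitivity ((\sum_a \sum_m x 0 a * x 0 m * (\sum_u rot_coef L u m * quat L u a k
   - d k (base L) * (d a m * offL L a))) / n).
  by rewrite mulr_suml; apply: eq_bigr => a _; rewrite mulr_suml.
rewrite (sum_antisym (D := fun a m => \sum_u rot_coef L u m * quat L u a k
   - d k (base L) * (d a m * offL L a)) (fun a => x 0 a)) ?mul0r//.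
by move=> a m; apply: rot_coef_quat.
Qed.

Lemma inner_G2 g x y : G2 g -> (x *m g) *m (y *m g)^T = x *m y^T.
Proof. by move=> hg; rewrite trmx_mul mulmxA -(mulmxA x) G2_orthogonal// mulmx1. Qed.

Lemma sqnormE x : (x *m x^T) 0 0 = \sum_k x 0 k ^+ 2.
Proof. by rewrite mxE; apply: eq_bigr => k _; rewrite mxE. Qed.

Lemma unit_axis x i (r : R) : x *m x^T = 1%:M -> 0 <= r ->
  (forall k, x 0 k = d k i * r) -> x = e i.
Proof.
move=> /matrixP/(_ 0 0); rewrite sqnormE mxE eqxx => h r0 hx.
have : r ^+ 2 = 1.
  rewrite -[RHS]h -[LHS](sum_delta' (fun _ => r ^+ 2) i); apply: eq_bigr => k _.
  by rewrite hx exprMn; case: eqP; rewrite ?expr1n ?mul1r ?expr0n ?mul0r.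
move/eqP; rewrite pexpr_eq1// => /eqP r1; apply/rowP => k.
by rewrite hx r1 mulr1 mxE.
Qed.

(** A reduction keeps the coordinates on its line and replaces the others by one at its base. For
    the lines chosen the support shrinks to {0,1,2,3}, {0,1,3}, {0,3} and {0}. *)
Lemma unit_to_axis0 x : x *m x^T = 1%:M ->
  exists2 q, square_product q & x *m q = e (o 0).
Proof.
move=> hx.
have [q1 [h1 _ [r1 _ e1]]] := line_reduction (o 0) x.
have [q2 [h2 _ [r2 _ e2]]] := line_reduction (o 2) (x *m q1).
have [q3 [h3 _ [r3 _ e3]]] := line_reduction (o 3) (x *m q1 *m q2).
have [q4 [h4 _ [r4 hr e4]]] := line_reduction (o 5) (x *m q1 *m q2 *m q3).
exists (q1 *m q2 *m q3 *m q4); first by do 3 apply: square_product_mul => //.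
rewrite !mulmxA; apply: (unit_axis (r := r4)) => //.
  by rewrite !inner_G2//; apply: square_product_G2.
move=> k; rewrite e4 e3 e2 e1 /onL.
by case: k => k hk; do 7 (case: k hk => [|k] hk /=; first by rewrite ?(mul0r, mul1r, add0r, addr0)).
Qed.

(** All three lines pass through the point 0, so the first axis stays fixed; the supports are
    {1,2,3}, {1,3} and {1}. *)
Lemma unit_to_axis1 x : x *m x^T = 1%:M -> x 0 (o 0) = 0 ->
  exists2 q, square_product q & e (o 0) *m q = e (o 0) /\ x *m q = e (o 1).
Proof.
move=> hx x0.
have [q1 [h1 f1 [r1 _ e1]]] := line_reduction (o 0) x.
have [q2 [h2 f2 [r2 _ e2]]] := line_reduction (o 1) (x *m q1).
have [q3 [h3 f3 [r3 hr e3]]] := line_reduction (o 4) (x *m q1 *m q2).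
exists (q1 *m q2 *m q3); first by do 2 apply: square_product_mul => //.
rewrite !mulmxA f1// f2// f3//; split=> //; apply: (unit_axis (r := r3)) => //.
  by rewrite !inner_G2//; apply: square_product_G2.
move=> k; rewrite e3 e2 e1 /onL.
case: k => k hk; do 7 (case: k hk => [|k] hk /=; first by
  rewrite ?(val_inj (erefl : \val (Ordinal hk) = \val (o 0))) ?x0 ?(mul0r, mul1r, mulr0, add0r, addr0)).
by [].
Qed.

Lemma unit_to_axis3 x : x *m x^T = 1%:M -> x 0 (o 0) = 0 -> x 0 (o 1) = 0 -> x 0 (o 2) = 0 ->
  exists2 q, square_product q &
    [/\ e (o 0) *m q = e (o 0), e (o 1) *m q = e (o 1) & x *m q = e (o 3)].
Proof.
move=> hx x0 x1 x2.
have [q [h f [r hr e1]]] := line_reduction (o 0) x.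
exists q => //; rewrite !f//; split=> //; apply: (unit_axis (r := r)) => //.
  by rewrite !inner_G2//; apply: square_product_G2.
move=> k; rewrite e1 /onL.
case: k => k hk; do 7 (case: k hk => [|k] hk /=; first by
  rewrite ?(val_inj (erefl : \val (Ordinal hk) = \val (o 0))) ?x0
    ?(val_inj (erefl : \val (Ordinal hk) = \val (o 1))) ?x1
    ?(val_inj (erefl : \val (Ordinal hk) = \val (o 2))) ?x2
  ?(mul0r, mul1r, mulr0, add0r, addr0)).
by [].
Qed.

Definition triple (t : tensor3 R) x y z : R :=
  \sum_i \sum_j \sum_k x 0 i * y 0 j * z 0 k * t i j k.

Lemma triple_delta t a b c : triple t (e a) (e b) (e c) = t a b c.
Proof.
rewrite /triple; transitivity (\sum_i d i a * (\sum_j d j b * (\sum_k d k c * t i j k))).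
  do 2 (apply: eq_bigr => ? _; rewrite ?mulr_sumr); apply: eq_bigr => ? _.
  by rewrite !mxE /= !mulrA.
by rewrite !sum_delta'.
Qed.

Lemma triple_pull3 g t x y z : triple (pull3 g t) x y z = triple t (x *m g) (y *m g) (z *m g).
Proof.
pose B x y z : 'M[R]_7 := \matrix_(i < 7) nth 0 [:: x; y; z] i.
have E t' x' y' z' : triple t' x' y' z' = pull3 (B x' y' z') t' (o 0) (o 1) (o 2).
  by rewrite /triple /pull3; do 3 (apply: eq_bigr => ? _); rewrite !mxE.
rewrite !E pull3_comp; congr (pull3 _ t _ _ _).
apply/matrixP => i j; rewrite !mxE.
case: i => i hi; do 3 (case: i hi => [|i] hi /=; first by
  rewrite mxE; apply: eq_bigr => k _; rewrite mxE).
by rewrite nth_nil mxE big1// => k _; rewrite mxE /= nth_nil mxE mul0r.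
Qed.

Lemma triple_G2 g x y z : G2 g -> triple s (x *m g) (y *m g) (z *m g) = triple s x y z.
Proof. by case=> _ hg; rewrite -triple_pull3 hg. Qed.

Lemma inner_axis x i : (e i *m x^T) 0 0 = x 0 i.
Proof. by rewrite -rowE !mxE. Qed.

Lemma sigma0_axes k : s (o 0) (o 1) k = d (o 2) k.
Proof. by_components. Qed.

Lemma sigma0_eq0 a b c : (s a b c == 0) = BinInt.Z.eqb (zsigma a b c) BinNums.Z0.
Proof.
rewrite reified_sigma0; case: zsigma => [|p|p] /=; first by rewrite zr0 eqxx.
  by rewrite /zr intr_eq0 /=; case: (Pnat.Pos2Nat.is_succ p) => n ->.
by rewrite /zr intr_eq0.
Qed.

Lemma sigma0_neq0 a b c : ~~ BinInt.Z.eqb (zsigma a b c) BinNums.Z0 -> s a b c != 0.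
Proof. by rewrite sigma0_eq0. Qed.

Lemma sigma0_third a b c m : s a b c != 0 -> s a b m = s a b c * d m c.
Proof.
rewrite sigma0_eq0 => h; eapply eq_reified; [typeclasses eauto|typeclasses eauto|].
move: a b c m h; decide7.
Qed.

(** The three vectors are brought to their axes one after another, each move fixing the axes already
    reached. Once [x] and [y] are at the axes 0 and 1, [triple s x y z] is the coordinate 2 of [z],
    which must vanish for the last move. *)
Lemma basic_triple x y z :
  x *m x^T = 1%:M -> y *m y^T = 1%:M -> z *m z^T = 1%:M ->
  x *m y^T = 0 -> x *m z^T = 0 -> y *m z^T = 0 -> triple s x y z = 0 ->
  exists2 q, square_product q &
    [/\ x *m q = e (o 0), y *m q = e (o 1) & z *m q = e (o 3)].
Proof.
move=> xx yy zz xy xz yz t.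
have [q1 s1 e1] := unit_to_axis0 xx; have g1 := square_product_G2 s1.
have [||q2 s2 [f2 e2]] := @unit_to_axis1 (y *m q1).
- by rewrite inner_G2.
- by rewrite -inner_axis -e1 inner_G2// xy mxE.
have g2 := square_product_G2 s2.
have [||||q3 s3 [f3 f3' e3]] := @unit_to_axis3 (z *m q1 *m q2).
- by rewrite !inner_G2.
- by rewrite -inner_axis -f2 -e1 !inner_G2// xz mxE.
- by rewrite -inner_axis -e2 !inner_G2// yz mxE.
- have : triple s (x *m q1 *m q2) (y *m q1 *m q2) (z *m q1 *m q2) = 0.
    by rewrite !triple_G2.
  rewrite e1 f2 e2 => <-; rewrite /triple.
  transitivity (\sum_i d i (o 0) * (\sum_j d j (o 1) *
    (\sum_k (z *m q1 *m q2) 0 k * s i j k))); last first.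
    do 2 (apply: eq_bigr => ? _; rewrite ?mulr_sumr); apply: eq_bigr => ? _.
    by rewrite [X in _ = X * _ * _ * _]mxE [X in _ = _ * X * _ * _]mxE !mulrA.
  rewrite !sum_delta'; set w := _ *m q2.
  transitivity (\sum_k d (o 2) k * w 0 k); first by rewrite sum_delta.
  by apply: eq_bigr => k _; rewrite mulrC sigma0_axes.
exists (q1 *m q2 *m q3); first by do 2 apply: square_product_mul => //.
by rewrite !mulmxA e1 e2 e3 f2 f3 f3'.
Qed.

(** Invariance of the cross product, from that of [sigma0] and of the metric. *)
Lemma G2_cross g a b k : G2 g ->
  \sum_i \sum_j g a i * g b j * s i j k = \sum_m s a b m * g m k.
Proof.
move=> hg; have gg : g^T *m g = 1%:M by apply: mulmx1C; apply: G2_orthogonal.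
case: hg => _ hg; transitivity (\sum_m pull3 g s a b m * g m k); last by rewrite hg.
rewrite /pull3; symmetry.
transitivity (\sum_i \sum_j \sum_l (g a i * g b j * s i j l * \sum_m g m l * g m k)).
  under eq_bigr do rewrite pair3_big mulr_suml.
  rewrite exchange_big pair3_big; apply: eq_bigr => p _ /=; rewrite mulr_sumr.
  by apply: eq_bigr => m _; ring.
do 2 (apply: eq_bigr => ? _); rewrite -[RHS](sum_delta' (fun l => _ * s _ _ l)).
apply: eq_bigr => l _; rewrite mulrC; congr (_ * _).
have /matrixP/(_ l k) := gg; rewrite !mxE => <-.
by apply: eq_bigr => m _; rewrite mxE.
Qed.

Lemma G2_line g (ax bx cx : I) : G2 g -> s ax bx cx != 0 ->
  e ax *m g = e ax -> e bx *m g = e bx -> e cx *m g = e cx.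
Proof.
rewrite -!rowE => hg h /rowP ha /rowP hb; apply/rowP => k.
have := G2_cross ax bx k hg.
have -> : \sum_i \sum_j g ax i * g bx j * s i j k = s ax bx k.
  transitivity (\sum_i d i ax * \sum_j d j bx * s i j k); last by rewrite !sum_delta'.
  apply: eq_bigr => i _; rewrite mulr_sumr; apply: eq_bigr => j _.
  by have := ha i; have := hb j; rewrite !mxE /= => -> ->; rewrite mulrA.
have line m : s ax bx m = s ax bx cx * d m cx. by exact: sigma0_third.
have -> : \sum_m s ax bx m * g m k = s ax bx cx * g cx k.
  rewrite -[RHS](sum_delta' (fun m => s ax bx cx * g m k)).
  by apply: eq_bigr => m _; rewrite line; ring.
by rewrite line => /(mulfI h) hk; rewrite !mxE -hk.
Qed.

(** The axes 0, 1 and 3 generate the others by cross products, along the lines {0,1,2}, {0,3,4},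
    {1,3,5} and {2,3,6}. *)
Lemma G2_fix3 g : G2 g -> e (o 0) *m g = e (o 0) -> e (o 1) *m g = e (o 1) ->
  e (o 3) *m g = e (o 3) -> g = 1%:M.
Proof.
move=> hg h0 h1 h3.
have h2 := @G2_line g (o 0) (o 1) (o 2) hg (@sigma0_neq0 (o 0) (o 1) (o 2) isT) h0 h1.
have h4 := @G2_line g (o 0) (o 3) (o 4) hg (@sigma0_neq0 (o 0) (o 3) (o 4) isT) h0 h3.
have h5 := @G2_line g (o 1) (o 3) (o 5) hg (@sigma0_neq0 (o 1) (o 3) (o 5) isT) h1 h3.
have h6 := @G2_line g (o 2) (o 3) (o 6) hg (@sigma0_neq0 (o 2) (o 3) (o 6) isT) h2 h3.
apply/row_matrixP => i; rewrite row1 rowE; move: h0 h1 h2 h3 h4 h5 h6.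
case: i => i hi; do 7 (case: i hi => [|i] hi; first by
  rewrite (bool_irrelevance hi isT)).
by [].
Qed.

(** The inverse of [g] takes the axes 0, 1, 3 to a basic triple, and some product of squares [q]
    takes this triple back. Hence [invmx g *m q] fixes the three axes and [q = g]. *)
Lemma G2_square_product g : G2 g -> square_product g.
Proof.
move=> hg; have hgI := G2_inv hg.
have := basic_triple (x := e (o 0) *m invmx g) (y := e (o 1) *m invmx g) (z := e (o 3) *m invmx g).
have ee i j : (e i) *m (e j)^T = (d i j)%:M.
  by apply/rowP => k; rewrite -rowE !mxE /= !ord1 eqxx mulr1n eq_sym.
rewrite !inner_G2// !ee /= !triple_G2// triple_delta.
have -> : s (o 0) (o 1) (o 3) = 0 by rewrite reified_sigma0.
rewrite !raddf0 => /(_ erefl erefl erefl) /(_ erefl erefl erefl erefl) [q sq [h0 h1 h3]].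
have hq := square_product_G2 sq.
have : invmx g *m q = 1%:M.
  by apply: G2_fix3; rewrite ?mulmxA//; apply: G2_mul.
by case: hg => ug _ /(congr1 (mulmx g)); rewrite mulmxA mulmxV// mul1mx mulmx1 => <-.
Qed.

End BasicTriples.

End G2Transitivity.

(** * The spin representation and the lift of G2 *)

Section Clifford.
Variable R : realType.
Local Notation s := (@sigma0 R).
Local Notation p := (@psi0 R).
Local Notation I := 'I_7.
Local Notation d i j := ((i == j)%:R : R).
Local Notation e i := (delta_mx 0 i : 'rV[R]_7).
Implicit Types (a b c i j k l m : I) (u v w : 'rV[R]_7) (g : 'M[R]_7).

Definition crossm v : 'M[R]_7 := \matrix_(j, k) \sum_i v 0 i * s i j k.

Lemma cliffordE v : clifford v = block_mx 0 v (- v^T) (crossm v).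
Proof. by []. Qed.

Lemma crossm_linear : linear crossm.
Proof.
move=> a u v; apply/matrixP => j k; rewrite !mxE mulr_sumr -big_split.
by apply: eq_bigr => i _; rewrite !mxE mulrDl mulrA.
Qed.
HB.instance Definition _ := GRing.isLinear.Build R _ _ _ crossm crossm_linear.

Lemma clifford_linear : linear (@clifford R).
Proof.
move=> a u v; rewrite !cliffordE scale_block_mx add_block_mx scaler0 addr0.
by congr block_mx; [rewrite linearP /= opprD scalerN | rewrite linearP].
Qed.
HB.instance Definition _ := GRing.isLinear.Build R _ _ _ (@clifford R) clifford_linear.

Lemma mul_crossmE u v k : (u *m crossm v) 0 k = \sum_j \sum_i u 0 j * v 0 i * s i j k.
Proof.
rewrite mxE; apply: eq_bigr => j _; rewrite mxE mulr_sumr.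
by apply: eq_bigr => i _; rewrite mulrA.
Qed.

Lemma mul_crossmC u v : u *m crossm v = - (v *m crossm u).
Proof.
apply/rowP => k; rewrite [RHS]mxE !mul_crossmE exchange_big -sumrN.
apply: eq_bigr => i _; rewrite -sumrN; apply: eq_bigr => j _.
by rewrite (sigma0_swap12 _ j i); ring.
Qed.

Lemma crossm_tr v : (crossm v)^T = - crossm v.
Proof.
apply/matrixP => j k; rewrite !mxE -sumrN; apply: eq_bigr => i _.
by rewrite (sigma0_swap23 _ i j k) mulrN.
Qed.

(** Polarization of [u x (u x v) = <u, v> u - |u|^2 v]. *)
Lemma sigma0_anticommute i j k l :
  \sum_m (s i j m * s k m l + s k j m * s i m l) =
  d i l * d j k + d k l * d j i - 2%:R * (d i k * d j l).
Proof. by_components. Qed.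

Lemma crossm_anticommute u v : crossm u *m crossm v + crossm v *m crossm u =
  u^T *m v + v^T *m u - (2%:R * (u *m v^T) 0 0)%:M.
Proof.
apply/matrixP => j l; rewrite !mxE.
transitivity (\sum_i \sum_k u 0 i * v 0 k *
   (d i l * d j k + d k l * d j i - 2%:R * (d i k * d j l))).
  rewrite -big_split.
  transitivity (\sum_m \sum_i \sum_k u 0 i * v 0 k * (s i j m * s k m l + s k j m * s i m l)).
    apply: eq_bigr => m _ /=; rewrite !mxE [X in _ + X]mulrC !big_distrlr /= -big_split.
    apply: eq_bigr => i _; rewrite -big_split; apply: eq_bigr => k _ /=; ring.
  rewrite exchange_big; apply: eq_bigr => i _; rewrite exchange_big.
  by apply: eq_bigr => k _; rewrite -mulr_sumr sigma0_anticommute.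
transitivity (\sum_i (u 0 i * v 0 j * d i l + d j i * (u 0 i * v 0 l)
   - 2%:R * (u 0 i * v 0 i) * d j l)).
  apply: eq_bigr => i _; symmetry.
  transitivity (\sum_k d j k * (u 0 i * v 0 k * d i l) +
      \sum_k d k l * (d j i * (u 0 i * v 0 k)) -
      \sum_k d i k * (2%:R * (u 0 i * v 0 k) * d j l)).
    by rewrite !sum_delta sum_delta'.
  by rewrite -big_split -sumrB; apply: eq_bigr => k _ /=; ring.
rewrite sumrB big_split /= sum_delta [X in X - _]addrC; congr (_ + _ - _).
- by rewrite big_ord1 !mxE.
- rewrite big_ord1 !mxE mulrC -[RHS](sum_delta' (fun i => u 0 i * v 0 j)).
  by apply: eq_bigr => i _; rewrite mulrC.
- rewrite -mulr_suml -mulr_sumr mulr_natr.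
  by congr (_ * _ *+ _); apply: eq_bigr => i _; rewrite mxE.
Qed.

Lemma clifford_anticommute u v : clifford u *m clifford v + clifford v *m clifford u =
  (- (2%:R * (u *m v^T) 0 0))%:M.
Proof.
rewrite !cliffordE !mulmx_block !mul0mx !add0r !mulmx0 !add0r.
rewrite add_block_mx [RHS](scalar_mx_block 1 7).
have tr11 (B : 'M[R]_1) : B^T = B by apply/matrixP => i j; rewrite !ord1 mxE.
have Evu : v *m u^T = u *m v^T by rewrite -[LHS]tr11 trmx_mul trmxK.
congr block_mx.
- rewrite !mulmxN Evu -opprD; apply/matrixP => i j; rewrite !ord1 !mxE eqxx mulr1n.
  by rewrite -mulr2n mulr_natl.
- by rewrite (mul_crossmC v) subrr.
- rewrite !mulmxN -opprD.
  have E x y : crossm x *m y^T = - (y *m crossm x)^T.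
    by rewrite trmx_mul crossm_tr mulNmx opprK.
  by rewrite !E (mul_crossmC v) linearN /= opprK subrr oppr0.
- rewrite !mulNmx addrACA crossm_anticommute -opprD addrA addNr add0r.
  by rewrite raddfN.
Qed.

Lemma clifford_sq v : clifford v *m clifford v = (- (v *m v^T) 0 0)%:M.
Proof.
apply: (@scalerI _ _ 2%:R); first by rewrite pnatr_eq0.
rewrite scaler_nat mulr2n clifford_anticommute scale_scalar_mx.
by congr (_%:M); rewrite mulrN.
Qed.

Lemma clifford_tr v : (clifford v)^T = - clifford v.
Proof.
by rewrite !cliffordE tr_block_mx opp_block_mx crossm_tr linearN /= trmxK trmx0 oppr0 opprK.
Qed.

Lemma Spin7_orthogonal (S : 'M[R]_8) : Spin7 S -> S *m S^T = 1%:M.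
Proof.
case=> vs [_ h ->]; elim: vs h => [|v vs IH] h.
  by rewrite big_nil trmx1 mulmx1.
rewrite big_cons trmx_mul mulmxA -(mulmxA (clifford v)).
rewrite IH => [|w hw]; last by apply: h; rewrite inE hw orbT.
rewrite mulmx1 -[X in X = _]/((clifford v : 'M[R]_(1 + 7)) *m (clifford v)^T).
by rewrite clifford_tr mulmxN clifford_sq h ?mem_head// -raddfN opprK mxE eqxx.
Qed.

(* A spinor in an adapted frame is a scalar and a vector; G_2 fixes the scalar. *)
Definition spinor (h : R) w : 'rV[R]_(1 + 7) := row_mx h%:M w.

Lemma spinor_clifford h w v :
  spinor h w *m clifford v = spinor (- (w *m v^T) 0 0) (h *: v + w *m crossm v).
Proof.
rewrite /spinor cliffordE mul_row_block mulmx0 add0r mulmxN mul_scalar_mx.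
by congr row_mx; apply/matrixP => i j; rewrite !ord1 !mxE eqxx.
Qed.

(** The invariant spinor generates the module: an operator with known Clifford commutators is
    determined by its value there. *)
Lemma spinorE h w : spinor h w = h *: spinor 1 0 + spinor 1 0 *m clifford w.
Proof.
rewrite spinor_clifford /spinor scale_row_mx add_row_mx !mul0mx scaler0 scale1r addr0 add0r.
congr row_mx; rewrite scale_scalar_mx mulr1 !mxE oppr0.
by apply/matrixP => i j; rewrite !ord1 !mxE eqxx addr0.
Qed.

Lemma spinor_scalar h w : spinor h w 0 0 = h.
Proof. by rewrite /spinor mxE; case: splitP => // k _; rewrite !ord1 mxE eqxx. Qed.

Lemma spinor_vector h w : rsubmx (spinor h w) = w.
Proof. exact: row_mxKr. Qed.

Lemma spinor_split (ph : 'rV[R]_(1 + 7)) : ph = spinor (ph 0 0) (rsubmx ph).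
Proof.
rewrite /spinor -[LHS]hsubmxK; congr row_mx; apply/matrixP => i j.
by rewrite !ord1 !mxE eqxx mulr1n; congr (ph _ _); apply: val_inj.
Qed.

Definition G2_spin g : 'M[R]_(1 + 7) := block_mx 1%:M 0 0 g.

Lemma G2_spin_mul g h : G2_spin g *m G2_spin h = G2_spin (g *m h).
Proof. by rewrite mulmx_block !mulmx0 !mul0mx !addr0 mulmx1 add0r. Qed.

Lemma G2_spin1 : G2_spin 1%:M = 1%:M.
Proof. by rewrite /G2_spin -(scalar_mx_block 1 7). Qed.

Lemma G2_spin_orthogonal g : G2 g -> G2_spin g *m (G2_spin g)^T = 1%:M.
Proof.
move=> hg; rewrite tr_block_mx trmx1 !trmx0 -/(G2_spin g^T) G2_spin_mul.
by rewrite G2_orthogonal// G2_spin1.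
Qed.

Lemma G2_tr g : G2 g -> G2 g^T.
Proof.
move=> hg; have := G2_inv hg; rewrite -[X in G2 X]mul1mx.
by rewrite -(mulmx1C (G2_orthogonal hg)) -mulmxA mulmxV ?mulmx1//; case: hg.
Qed.

Lemma crossm_G2 v g : G2 g -> crossm v *m g = g *m crossm (v *m g).
Proof.
move=> hg; apply/matrixP => j k; rewrite !mxE.
transitivity (\sum_i v 0 i * \sum_m s i j m * g m k).
  under eq_bigr do rewrite mxE mulr_suml.
  by rewrite exchange_big; apply: eq_bigr => i _; rewrite mulr_sumr;
     apply: eq_bigr => m _; rewrite mulrA.
under eq_bigr do rewrite -G2_cross//.
transitivity (\sum_l \sum_n \sum_i g j l * (v 0 i * g i n * s n l k)); last first.
  apply: eq_bigr => l _; rewrite mxE mulr_sumr; apply: eq_bigr => n _.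
  by rewrite mxE mulr_suml mulr_sumr.
transitivity (\sum_i \sum_n \sum_l g j l * (v 0 i * g i n * s n l k)).
  apply: eq_bigr => i _; rewrite mulr_sumr; apply: eq_bigr => n _.
  by rewrite mulr_sumr; apply: eq_bigr => l _; ring.
rewrite pair3_big; rewrite pair3_big.
rewrite (reindex_inj (h := fun x : I * I * I => (x.2, x.1.2, x.1.1))).
  by apply: eq_bigr => -[[x y] z] _.
by move=> [[x y] z] [[x' y'] z'] [-> -> ->].
Qed.

Lemma clifford_G2 v g : G2 g -> clifford v *m G2_spin g = G2_spin g *m clifford (v *m g).
Proof.
move=> hg; rewrite !cliffordE !mulmx_block !mulmx0 !mul0mx !mulmx1 !mul1mx.
by rewrite !addr0 !add0r crossm_G2// mulmxN trmx_mul mulmxA G2_orthogonal// mul1mx.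
Qed.

Lemma psi0_diag i j k : p i i j k = 0.
Proof. by_components. Qed.

Lemma psi0_clifford m n : \sum_i \sum_j \sum_l p i j n l *
   (- (d i m * d j l) + \sum_k s i m k * s j k l - \sum_k s j i k * s k m l) =
  - 48%:R * d m n.
Proof. by_components. Qed.

(** The relation is the one that the invariant spinor satisfies: two orthogonal Clifford factors act
    on it as their cross product. The contraction [psi0_clifford] shows that it fails on every
    nonzero vector [w]. *)
Lemma spinor_commutant_kernel w :
  (forall i j, i != j -> spinor 0 w *m clifford (e i) *m clifford (e j) =
     spinor 0 w *m clifford (e i *m crossm (e j))) -> w = 0.
Proof.
move=> h; apply/rowP => n; rewrite mxE.
apply: (mulfI (x := - 48%:R : R)); first by rewrite oppr_eq0 pnatr_eq0.
rewrite mulr0.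
transitivity (\sum_i \sum_j \sum_l p i j n l * \sum_m w 0 m *
   (- (d i m * d j l) + \sum_k s i m k * s j k l - \sum_k s j i k * s k m l)).
  transitivity (\sum_m d m n * (- 48%:R * w 0 m)).
    by rewrite (sum_delta' (fun m => - 48%:R * w 0 m)).
  transitivity (\sum_m \sum_i \sum_j \sum_l w 0 m * (p i j n l *
   (- (d i m * d j l) + \sum_k s i m k * s j k l - \sum_k s j i k * s k m l))).
    apply: eq_bigr => m _.
    rewrite (_ : _ * _ = w 0 m * (- 48%:R * d m n)); last by ring.
    rewrite -psi0_clifford mulr_sumr.
    apply: eq_bigr => i _; rewrite mulr_sumr; apply: eq_bigr => j _.
    by rewrite mulr_sumr.
  rewrite exchange_big; apply: eq_bigr => i _; rewrite exchange_big.
  apply: eq_bigr => j _; rewrite exchange_big; apply: eq_bigr => l _.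
  by rewrite mulr_sumr; apply: eq_bigr => m _; rewrite mulrCA.
rewrite big1// => i _; rewrite big1// => j _; rewrite big1// => l _.
have [->|ij] := eqVneq i j.
  by rewrite psi0_diag mul0r.
have := h _ _ ij; rewrite !spinor_clifford !scale0r !add0r.
move/eq_row_mx => [_ /rowP/(_ l)] hl.
suff -> : \sum_m w 0 m * (- (d i m * d j l) + \sum_k s i m k * s j k l -
   \sum_k s j i k * s k m l) = 0 by rewrite mulr0.
transitivity ((- (w *m (e i)^T) 0 0 *: e j + w *m crossm (e i) *m crossm (e j)) 0 l
  - (w *m crossm (e i *m crossm (e j))) 0 l); last by rewrite hl subrr.
have E1 a b k : crossm (e a) b k = s a b k.
  by rewrite mxE -[RHS](sum_delta' (fun c => s c b k)); apply: eq_bigr => c _; rewrite mxE.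
have E2 k : (w *m crossm (e i)) 0 k = \sum_m w 0 m * s i m k.
  by rewrite mxE; apply: eq_bigr => m _; rewrite E1.
have -> : (- (w *m (e i)^T) 0 0 *: e j + w *m crossm (e i) *m crossm (e j)) 0 l =
    - w 0 i * d j l + \sum_m w 0 m * \sum_k s i m k * s j k l.
  have -> : (w *m (e i)^T) 0 0 = w 0 i.
    rewrite mxE -[RHS](sum_delta' (fun m => w 0 m)).
    by apply: eq_bigr => m _; rewrite !mxE mulrC.
  rewrite mxE [X in X + _]mxE; congr (_ + _); first by rewrite mxE /= (eq_sym l).
  rewrite mxE; under eq_bigr do rewrite E2 E1 mulr_suml.
  rewrite exchange_big; apply: eq_bigr => m _; rewrite mulr_sumr.
  by apply: eq_bigr => k _; rewrite mulrA.
have -> : (w *m crossm (e i *m crossm (e j))) 0 l = \sum_m w 0 m * \sum_k s j i k * s k m l.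
  rewrite mxE; apply: eq_bigr => m _; rewrite mxE; congr (_ * _).
  by apply: eq_bigr => k _; rewrite -rowE mxE E1.
rewrite -[w 0 i](sum_delta (fun m => w 0 m)) mulNr mulr_suml -sumrN -big_split -sumrB.
by apply: eq_bigr => m _ /=; ring.
Qed.

(** Schur's lemma for the spin module. Subtract the scalar read off at the invariant spinor; the
    rest [Y] takes that spinor to a pure vector, which inherits its Clifford relations and is
    therefore 0. Since the invariant spinor generates the module, [Y = 0]. *)
Lemma spinor_commutant (X : 'M[R]_(1 + 7)) :
  (forall v, clifford v *m X = X *m clifford v) -> exists a : R, X = a%:M.
Proof.
move=> hX; pose a := (spinor 1 0 *m X) 0 0; exists a.
pose Y := X - a%:M.
have hY v : clifford v *m Y = Y *m clifford v.
  by rewrite mulmxBl mulmxBr hX scalar_mxC.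
suff hw : spinor 1 0 *m Y = 0.
  apply/eqP; rewrite -subr_eq0 -/Y; apply/eqP/row_matrixP => i; rewrite row0 rowE.
  rewrite (spinor_split (delta_mx 0 i)) spinorE mulmxDl -scalemxAl hw scaler0 add0r.
  by rewrite -mulmxA hY mulmxA hw mul0mx.
set w := rsubmx (spinor 1 0 *m Y).
have Ew : spinor 1 0 *m Y = spinor 0 w.
  rewrite (spinor_split (_ *m Y)) -/w; congr (spinor _ w).
  rewrite mulmxBr mxE -/a mul_mx_scalar !mxE.
  by case: splitP => // j _; rewrite !ord1 !mxE mulr1 subrr.
have w0 : w = 0.
  apply: spinor_commutant_kernel => i j ij; rewrite -Ew.
  rewrite -(mulmxA _ Y) -hY mulmxA -(mulmxA _ Y) -hY mulmxA.
  rewrite -(mulmxA _ Y) -hY mulmxA; congr (_ *m Y).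
  rewrite !spinor_clifford !mul0mx !scale1r !addr0 !mxE !oppr0 scale0r add0r.
  rewrite big1 ?oppr0// => k _; rewrite !mxE /=.
  have [->|_] := eqVneq k i; last by rewrite mul0r.
  by rewrite (negbTE ij) mulr0.
by rewrite Ew w0 /spinor raddf0 row_mx0.
Qed.

(* Schur's lemma gives rho g = +-G2_spin g, and G_2 is generated by squares. *)
Lemma spin_lift_G2 (rho : 'M[R]_7 -> 'M[R]_8) g : spin_lift rho -> G2 g ->
  rho g = G2_spin g.
Proof.
move=> [_ hS hM hC] hg.
(* The scalar is a sign because [rho q] and [G2_spin q] are both orthogonal. *)
have scal q : G2 q -> exists2 a : R, a ^+ 2 = 1 & rho q = a *: (G2_spin q : 'M[R]_8).
  move=> hq.
  have qq : q *m q^T = 1%:M := G2_orthogonal hq.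
  have qi : G2_spin q^T *m G2_spin q = 1%:M.
    by rewrite G2_spin_mul (mulmx1C qq) G2_spin1.
  have [|a ha] := @spinor_commutant ((rho q : 'M[R]_(1 + 7)) *m G2_spin q^T).
    move=> v; rewrite mulmxA.
    rewrite (hC q v hq : clifford v *m rho q = rho q *m clifford (v *m q)) -!mulmxA.
    congr (rho q *m _).
    have h := clifford_G2 (v *m q) (G2_tr hq).
    by rewrite -mulmxA qq mulmx1 in h.
  have rhoE : rho q = a *: (G2_spin q : 'M[R]_8).
    by rewrite -[LHS]mulmx1 -qi mulmxA -[X in X *m _]/((rho q : 'M[R]_(1 + 7)) *m _) ha mul_scalar_mx.
  exists a => //; have := Spin7_orthogonal (hS _ hq).
  rewrite rhoE linearZ /= -scalemxAr -scalemxAl scalerA -expr2.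
  rewrite -[X in _ *: X]/(G2_spin q *m (G2_spin q)^T) G2_spin_orthogonal//.
  by move=> /matrixP/(_ ord0 ord0); rewrite !mxE mulr1.
elim: (G2_square_product hg) => [|q h sq IH hh].
  have [a a2 ha] := scal _ (G2_1 R); have := hM _ _ (G2_1 R) (G2_1 R).
  rewrite mulmx1 ha G2_spin1 -scalemxAr -scalemxAl mulmx1 scalerA -expr2 a2.
  by move=> ->; rewrite scale1r.
have [a a2 ha] := scal _ hh; have hq := square_product_G2 sq.
rewrite hM//; last exact: G2_mul.
by rewrite hM// IH ha -scalemxAr -scalemxAl scalerA -expr2 a2 scale1r -!G2_spin_mul.
Qed.

End Clifford.

(** * Calculus of smooth functions *)

Section Smooth.
Variable R : realType.
Local Notation E := 'rV[R]_7.
Implicit Types (U : set E) (k : nat) (a b : 'I_7) (y : E).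

Section General.
Variable V : normedModType R.
Implicit Types f g : E -> V.

Lemma open_near U (P : E -> Prop) y : open U -> U y -> (forall z, U z -> P z) ->
  \forall z \near y, P z.
Proof. by move=> oU Uy h; apply: filterS h _; apply: open_nbhs_nbhs. Qed.

Lemma partial_ext U a f g y : open U -> (forall z, U z -> f z = g z) -> U y ->
  partial a f y = partial a g y.
Proof. by move=> oU fg Uy; apply: near_eq_derive; apply: open_near oU Uy fg. Qed.

Lemma differentiable_near0 f y : (\forall z \near y, f z = 0) -> differentiable f y.
Proof.
move=> f0.
have o : f \o shift y = cst (f y) + (\0 : E -> V) +o_ (0 : E) id.
  apply/eqaddoP => _/posnumP[eps]; near=> h.
  have fy : f y = 0 by apply: nbhs_singleton f0.
  rewrite /= !fctE /= fy addr0 subr0 [f _](_ : _ = 0) ?normr0 ?mulr_ge0//.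
  by near: h; move: f0; rewrite (near_shift 0) /= subr0.
apply/diff_locallyP; have c : continuous (\0 : E -> V) by apply: cst_continuous.
by rewrite (diff_unique c o).
Unshelve. all: by end_near. Qed.

Lemma differentiable_ext U f g y : open U -> (forall z, U z -> f z = g z) -> U y ->
  differentiable f y -> differentiable g y.
Proof.
move=> oU fg Uy df; have -> : g = f + (g - f) by rewrite addrC subrK.
apply: differentiableD; [exact: df | apply: differentiable_near0].
by apply: (open_near oU Uy) => z Uz; rewrite !fctE fg// subrr.
Qed.

Lemma Ck_ext k U f g : open U -> (forall z, U z -> f z = g z) ->
  Ck k U f -> Ck k U g.
Proof.
move=> oU; elim: k f g => [|k IH] f g fg /=.
  move=> h y Uy; rewrite /prop_for /continuous_at -(fg _ Uy).
  apply: cvg_trans (h y Uy).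
  exact: (near_eq_cvg (F := nbhs y) (open_near oU Uy fg)).
move=> [h1 h2]; split=> [y Uy|a]; first exact: differentiable_ext fg Uy (h1 _ Uy).
by apply: IH (h2 a) => y Uy; apply: partial_ext oU fg Uy.
Qed.

Lemma Ck_pred k U f : Ck k.+1 U f -> Ck k U f.
Proof.
elim: k f => [|k IH] f; first by move=> [h _] y Uy; apply/differentiable_continuous/h.
by move=> [h1 h2]; split=> // a; apply/IH/h2.
Qed.

Lemma Ck_sub k U U' f : U `<=` U' -> Ck k U' f -> Ck k U f.
Proof.
move=> UU'; elim: k f => [|k IH] f /=; first by move=> h y /UU'; apply: h.
by move=> [h1 h2]; split=> [y /UU'|a]; [apply: h1 | apply/IH/h2].
Qed.

Lemma Ck_local k U f : (forall y, U y -> exists2 U', U' y & Ck k U' f) -> Ck k U f.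
Proof.
elim: k f => [|k IH] f h; first by move=> y /h [U' U'y hf]; apply: hf.
split=> [y /h [U' U'y [hf _]]|a]; first exact: hf.
by apply: IH => y /h [U' U'y [_ hf]]; exists U' => //; apply: hf.
Qed.

Lemma Ck_cst k U (c : V) : Ck k U (fun=> c).
Proof.
elim: k c => [|k IH] c /=; first by move=> y _; apply: cst_continuous.
split=> [y _|a]; first exact: differentiable_cst.
rewrite (_ : partial a _ = fun=> 0); first exact: IH.
by apply/funext => y; rewrite /partial derive_cst.
Qed.

Lemma Ck_add k U f g : open U -> Ck k U f -> Ck k U g -> Ck k U (fun z => f z + g z).
Proof.
move=> oU; elim: k f g => [|k IH] f g /=.
  by move=> hf hg y Uy; exact: (continuousD (hf y Uy) (hg y Uy)).
move=> [f1 f2] [g1 g2]; split=> [y Uy|a].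
  by apply: differentiableD; [apply: f1 | apply: g1].
apply: (Ck_ext oU _ (IH _ _ (f2 a) (g2 a))) => y Uy.
by rewrite /partial deriveD//; apply: diff_derivable; [apply: f1 | apply: g1].
Qed.

End General.

Implicit Types (f g : E -> R^o).

Lemma Ck_mul k U f g : open U -> Ck k U f -> Ck k U g ->
  Ck k U (fun z => f z * g z : R^o).
Proof.
move=> oU; elim: k f g => [|k IH] f g hf hg.
  by move=> y Uy; apply: (continuousM (hf y Uy) (hg y Uy)).
split=> [y Uy|a].
  by apply: (@differentiableM R E f g); [apply: hf.1 | apply: hg.1].
have h := Ck_add oU (IH _ _ (Ck_pred hf) (hg.2 a)) (IH _ _ (Ck_pred hg) (hf.2 a)).
apply: (Ck_ext oU _ h) => y Uy.
rewrite /partial; symmetry; apply: (@deriveM R E f g); apply: diff_derivable.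
  exact: hf.1.
exact: hg.1.
Qed.

Lemma mvt_line (f : E -> R^o) y v (t : R) : 0 < t ->
  (forall x, 0 <= x <= t -> derivable f (y + x *: v) v) ->
  exists2 c, 0 < c < t & f (y + t *: v) - f y = t * 'D_v f (y + c *: v).
Proof.
move=> t0 df; pose g (x : R) : R := f (y + x *: v).
have drv x : 0 <= x <= t -> is_derive (x : R^o) 1 (g : R^o -> R^o) ('D_v f (y + x *: v)).
  move=> /df dfx; have gE : (fun h => h^-1 *: ((g \o shift x) (h *: (1 : R^o)) - g x)) =
      fun h => h^-1 *: ((f \o shift (y + x *: v)) (h *: v) - f (y + x *: v)) :> R^o.
    apply/funext => h; rewrite /g /= [h *: 1]mulr1 scalerDl; congr (_ *: (f _ - _)).
    by rewrite addrCA.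
  by apply: DeriveDef; rewrite /derivable /derive gE.
have [||c] := @MVT R g (fun x => 'D_v f (y + x *: v)) 0 t t0.
- by move=> x; rewrite in_itv /= => /andP[x0 xt]; apply: drv; rewrite !ltW.
- apply: continuous_in_subspaceT => x; rewrite inE /= in_itv /= => hx.
  apply: (@differentiable_continuous _ R^o R^o x g); apply/derivable1_diffP.
  by have [] := drv x hx.
- rewrite in_itv /= => hc; rewrite subr0 /g scale0r addr0 mulrC => ->.
  by exists c.
Qed.

Lemma is_derive_shift_fun (f : E -> R^o) (w z v : E) : derivable f (z + w) v ->
  is_derive z v (fun x => f (x + w) : R^o) ('D_v f (z + w)).
Proof.
move=> df; have gE : (fun h => h^-1 *: (((fun x => f (x + w)) \o shift z) (h *: v) - f (z + w)))
    = fun h => h^-1 *: ((f \o shift (z + w)) (h *: v) - f (z + w)) :> R^o.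
  by apply/funext => h; rewrite /= addrA.
by apply: DeriveDef; rewrite /derivable /derive gE.
Qed.

(** The second difference of [f] over a square of side [t] is [t^2] times a mixed derivative at some
    point of the square, for either order of differentiation. If the two orders differed at [y],
    continuity would contradict this on a small square. *)
Lemma partial_comm (U : set E) (f : E -> R^o) a b y : open U -> Ck 2 U f -> U y ->
  partial a (partial b f) y = partial b (partial a f) y.
Proof.
move=> oU hf Uy; pose ea : E := delta_mx 0 a; pose eb : E := delta_mx 0 b.
have [r r0 hr] : exists2 r : R, 0 < r & forall z, `|z - y| < r -> U z.
  have /nbhs_ballP[r r0 hr] : nbhs y U by apply: open_nbhs_nbhs.
  by exists r => // z hz; apply: hr; rewrite -ball_normE /= distrC.
(* Points of the square with corner [y] and side [t] lie within [t * K] of [y]. *)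
pose K : R := `|ea| + `|eb| + 1.
have K0 : 0 < K by rewrite ltr_wpDl// addr_ge0.
have dist t c c' : 0 <= c <= t -> 0 <= c' <= t -> `|y + c *: ea + c' *: eb - y| <= t * K.
  move=> /andP[c0 ct] /andP[c0' ct'].
  rewrite addrAC [y + _]addrC addrK.
  apply: (le_trans (ler_normD _ _)); rewrite !normrZ !ger0_norm// /K !mulrDr mulr1.
  have t0 : 0 <= t by apply: le_trans ct.
  have h1 := ler_wpM2r (normr_ge0 ea) ct.
  have h2 := ler_wpM2r (normr_ge0 eb) ct'.
  by rewrite ler_wpDr// lerD.
have inU t c c' : 0 <= c <= t -> 0 <= c' <= t -> t * K < r -> U (y + c *: ea + c' *: eb).
  by move=> hc hc' htr; apply: hr; apply: le_lt_trans htr; apply: dist.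
(* Both orders at once: the mean value theorem is applied along [u] to the difference [phi] in
   direction [v], and again along [v]. *)
have second u v t : (u = ea /\ v = eb) \/ (u = eb /\ v = ea) -> 0 < t -> t * K < r ->
    exists c c', [/\ 0 <= c <= t, 0 <= c' <= t &
     f (y + t *: ea + t *: eb) - f (y + t *: ea) - f (y + t *: eb) + f y =
     t ^+ 2 * 'D_v ('D_u f) (y + c *: u + c' *: v)].
  move=> huv t0 tr.
  have inU' x x' : 0 <= x <= t -> 0 <= x' <= t -> U (y + x *: u + x' *: v).
    by case: huv => -[-> ->] hx hx'; [|rewrite addrAC]; apply: (inU t).
  have tt : 0 <= t <= t by rewrite lexx ltW.
  have zt : 0 <= (0 : R) <= t by rewrite lexx ltW.
  pose phi z : R^o := f (z + t *: v) - f z.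
  have dphi x : 0 <= x <= t ->
      is_derive (y + x *: u) u phi ('D_u f (y + x *: u + t *: v) - 'D_u f (y + x *: u)).
    move=> hx; have d1 : derivable f (y + x *: u) u.
      by apply/diff_derivable/hf.1; have := inU' x 0 hx zt; rewrite scale0r addr0.
    have d2 : derivable f (y + x *: u + t *: v) u by apply/diff_derivable/hf.1/inU'.
    have := is_derive_shift_fun d2 => h2; have h1 := derivableP d1.
    exact: (is_deriveB h2 h1).
  have [c hc e1] := mvt_line t0 (fun x hx => @ex_derive _ _ _ _ _ _ _ (dphi x hx)).
  have hc' : 0 <= c <= t by case/andP: hc => h1 h2; rewrite !ltW.
  have dDu x' : 0 <= x' <= t -> differentiable ('D_u f : E -> R^o) (y + c *: u + x' *: v).
    move=> hx'; have [_ h2] := hf; case: huv => -[eu _]; rewrite eu.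
      by apply: (h2 a).1; rewrite -eu; apply: inU'.
    by apply: (h2 b).1; rewrite -eu; apply: inU'.
  have [c' hc2 e2] := mvt_line t0 (fun x hx => diff_derivable (dDu x hx)).
  exists c, c'; split=> //; first by case/andP: hc2 => h1 h2; rewrite !ltW.
  have -> : f (y + t *: ea + t *: eb) - f (y + t *: ea) - f (y + t *: eb) + f y =
      phi (y + t *: u) - phi y.
    rewrite /phi; case: huv => -[-> ->]; first by ring.
    by rewrite (addrAC y (t *: eb)); ring.
  rewrite e1 expr2 -mulrA -e2; congr (_ * _).
  by have := dphi c hc' => h; rewrite (@derive_val _ _ _ _ _ _ _ h).
have [_ h2] := hf.
apply/eqP; rewrite -subr_eq0; apply/negPn/negP => ne.
set A := partial a (partial b f) in ne; set B := partial b (partial a f) in ne.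
have e0 : 0 < `|A y - B y| / 2%:R by rewrite divr_gt0 ?normr_gt0.
have cA : {for y, continuous A} by apply: (h2 b).2 y Uy.
have cB : {for y, continuous B} by apply: (h2 a).2 y Uy.
have nA : \forall z \near y, `|A y - A z| < `|A y - B y| / 2%:R.
  by move/cvgrPdist_lt : cA => /(_ _ e0).
have nB : \forall z \near y, `|B y - B z| < `|A y - B y| / 2%:R.
  by clear -cB e0; move/cvgrPdist_lt : cB => /(_ _ e0).
have /nbhs_ballP[dl dl0 hd] : \forall z \near y,
    `|A y - A z| < `|A y - B y| / 2%:R /\ `|B y - B z| < `|A y - B y| / 2%:R.
  exact: filterI nA nB.
have {}hd z : `|z - y| < dl -> `|A y - A z| < `|A y - B y| / 2%:R /\
    `|B y - B z| < `|A y - B y| / 2%:R.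
  by move=> hz; apply: hd; rewrite -ball_normE /= distrC.
have {}dl0 : 0 < dl by [].
pose t := Num.min r dl / 2%:R / K.
have t0 : 0 < t by rewrite !divr_gt0// lt_min r0.
have tK : t * K = Num.min r dl / 2%:R by rewrite /t divfK// gt_eqF.
have tr : t * K < r.
  rewrite tK ltr_pdivrMr// mulr_natr mulr2n; apply: (@le_lt_trans _ _ r).
    by rewrite ge_min lexx.
  by rewrite ltrDl.
have td : t * K < dl.
  rewrite tK ltr_pdivrMr// mulr_natr mulr2n; apply: (@le_lt_trans _ _ dl).
    by rewrite ge_min lexx orbT.
  by rewrite ltrDl.
have [c [c' [hc hc' e1]]] := second ea eb t (or_introl (conj erefl erefl)) t0 tr.
have [d [d' [hd1 hd2 e2]]] := second eb ea t (or_intror (conj erefl erefl)) t0 tr.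
move: e2; rewrite e1; set z1 := _ + _; set z2 := _ + _ => /mulfI e12.
have {}e12 : B z1 = A z2 by apply: e12; rewrite expf_neq0// gt_eqF.
have [_ b1] := hd z1 (le_lt_trans (dist _ _ _ hc hc') td).
have dz2 : `|z2 - y| <= t * K.
  have -> : z2 = y + d' *: ea + d *: eb by rewrite /z2 addrAC.
  exact: dist.
have [b2 _] := hd z2 (le_lt_trans dz2 td).
move: b1 b2; rewrite e12; move: (A y) (B y) (A z2) => u v w b1 b2.
have := ler_distD w u v; rewrite (distrC w v) => h; clear -b1 b2 h; lra.
Qed.

End Smooth.

(** * Closure properties of smooth functions *)

Section SmoothOn.
Variable R : realType.
Local Notation E := 'rV[R]_7.
Implicit Types (U : set E) (a : 'I_7) (y : E) (f g : E -> R^o).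

Lemma smooth_ext (V : normedModType R) U (f g : E -> V) :
  open U -> (forall z, U z -> f z = g z) -> smooth_on U f -> smooth_on U g.
Proof. by move=> oU fg h k; apply: Ck_ext fg (h k). Qed.

Lemma smooth_sub (V : normedModType R) U U' (f : E -> V) :
  U `<=` U' -> smooth_on U' f -> smooth_on U f.
Proof. by move=> UU h k; apply: Ck_sub UU (h k). Qed.

Lemma smooth_local (V : normedModType R) U (f : E -> V) :
  (forall y, U y -> exists2 U', U' y & smooth_on U' f) -> smooth_on U f.
Proof.
by move=> h k; apply: Ck_local => y /h [U' U'y hf]; exists U' => //; apply: hf.
Qed.

Lemma smooth_cst (V : normedModType R) U (c : V) : smooth_on U (fun=> c).
Proof. by move=> k; apply: Ck_cst. Qed.

Lemma smooth_partial (V : normedModType R) U a (f : E -> V) :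
  smooth_on U f -> smooth_on U (partial a f).
Proof. by move=> h k; apply: (h k.+1).2. Qed.

Lemma smooth_differentiable (V : normedModType R) U (f : E -> V) y :
  smooth_on U f -> U y -> differentiable f y.
Proof. by move=> h; apply: (h 1%N).1. Qed.

Lemma smooth_derivable (V : normedModType R) U (f : E -> V) y v :
  smooth_on U f -> U y -> derivable f y v.
Proof. by move=> h Uy; apply/diff_derivable/(smooth_differentiable h). Qed.

Lemma smooth_continuous (V : normedModType R) U (f : E -> V) y :
  smooth_on U f -> U y -> {for y, continuous f}.
Proof. by move=> h Uy; apply/differentiable_continuous/(smooth_differentiable h). Qed.

Lemma smooth_add (V : normedModType R) U (f g : E -> V) : open U ->
  smooth_on U f -> smooth_on U g -> smooth_on U (fun z => f z + g z).
Proof. by move=> oU hf hg k; apply: Ck_add. Qed.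

Lemma smooth_mul U f g : open U ->
  smooth_on U f -> smooth_on U g -> smooth_on U (fun z => f z * g z : R^o).
Proof. by move=> oU hf hg k; apply: Ck_mul. Qed.

Lemma smooth_opp U f : open U -> smooth_on U f -> smooth_on U (fun z => - f z : R^o).
Proof.
move=> oU hf; apply: (smooth_ext oU _ (smooth_mul oU (smooth_cst U (-1 : R^o)) hf)).
by move=> z _; rewrite mulN1r.
Qed.

Lemma smooth_sub_fun U f g : open U ->
  smooth_on U f -> smooth_on U g -> smooth_on U (fun z => f z - g z : R^o).
Proof. by move=> oU hf hg; apply: smooth_add => //; apply: smooth_opp. Qed.

Lemma smooth_sum U (I : Type) (r : seq I) (P : pred I) (F : I -> E -> R^o) : open U ->
  (forall i, smooth_on U (F i)) -> smooth_on U (fun z => \sum_(i <- r | P i) F i z : R^o).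
Proof.
move=> oU hF; elim: r => [|i r IH].
  by under eq_fun do rewrite big_nil; apply: smooth_cst.
under eq_fun do rewrite big_cons; case: (P i) => //.
exact: smooth_add.
Qed.

Lemma smooth_prod U (I : Type) (r : seq I) (P : pred I) (F : I -> E -> R^o) : open U ->
  (forall i, smooth_on U (F i)) -> smooth_on U (fun z => \prod_(i <- r | P i) F i z : R^o).
Proof.
move=> oU hF; elim: r => [|i r IH].
  by under eq_fun do rewrite big_nil; apply: smooth_cst.
under eq_fun do rewrite big_cons; case: (P i) => //.
exact: smooth_mul.
Qed.

Lemma powR_differentiable (x p : R) : 0 < x ->
  differentiable (@powR R ^~ p : R^o -> R^o) x.
Proof. by move=> x0; apply/derivable1_diffP; have [] := is_derive1_powR p x0. Qed.

(** The exponent varies in the induction, since the derivative involves the power [p - 1]. Inverses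
    and the normalization of vectors both reduce to this lemma. *)
Lemma smooth_powR U f (p : R) : open U -> (forall y, U y -> 0 < f y) ->
  smooth_on U f -> smooth_on U (fun z => f z `^ p : R^o).
Proof.
move=> oU f0 hf; move=> k; elim: k p => [|k IH] p.
  move=> y Uy; apply: (@continuous_comp _ _ _ f (@powR R ^~ p)).
    exact: (smooth_continuous hf).
  exact/differentiable_continuous/powR_differentiable/f0.
split=> [y Uy|a].
  apply: (@differentiable_comp _ _ _ _ f (@powR R ^~ p)).
    exact: (smooth_differentiable hf).
  exact/powR_differentiable/f0.
have h := Ck_mul oU (Ck_mul oU (Ck_cst k U (p : R^o)) (IH (p - 1))) (smooth_partial a hf k).
apply: (Ck_ext oU _ h) => y Uy.
have df := smooth_differentiable hf Uy.
have dp := powR_differentiable p (f0 _ Uy).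
rewrite /partial !deriveE//; last exact: (@differentiable_comp _ _ _ _ f (@powR R ^~ p)).
rewrite (@diff_comp _ _ _ _ f (@powR R ^~ p))//= diff1E//.
rewrite derive1E (@derive_val _ _ _ _ _ _ _ (is_derive1_powR p (f0 _ Uy))).
by rewrite mulrC.
Qed.

(** As [f] may be negative, the power -1 is taken of its square: [1 / f = f (f^2)^-1]. *)
Lemma smooth_inv U f : open U -> (forall y, U y -> f y != 0) ->
  smooth_on U f -> smooth_on U (fun z => (f z)^-1 : R^o).
Proof.
move=> oU f0 hf.
have f2 : forall y, U y -> 0 < f y * f y.
  by move=> y /f0 h; rewrite -expr2 exprn_even_gt0.
have h := smooth_mul oU hf (smooth_powR (-1) oU f2 (smooth_mul oU hf hf)).
apply: (smooth_ext oU _ h) => y Uy; rewrite powR_inv1; last by rewrite ltW// f2.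
by rewrite invfM mulrA divff ?mul1r// f0.
Qed.

Lemma partial_mx m n (f : E -> 'M[R]_(m, n)) a y i j : differentiable f y ->
  partial a f y i j = partial a (fun z => f z i j : R^o) y.
Proof. by move=> df; rewrite /partial derive_mx ?mxE//; apply: diff_derivable. Qed.

Lemma differentiable_entry m n (f : E -> 'M[R]_(m, n)) y i j : differentiable f y ->
  differentiable (fun z => f z i j : R^o) y.
Proof.
move=> df; apply: (@differentiable_comp _ _ _ _ f (fun N : 'M[R]_(m, n) => N i j : R^o)) => //.
exact: differentiable_coord.
Qed.

Lemma smooth_entry U m n (f : E -> 'M[R]_(m, n)) i j : open U ->
  smooth_on U f -> smooth_on U (fun z => f z i j : R^o).
Proof.
move=> oU hf k; elim: k f hf => [|k IH] f hf.
  by move=> y Uy; apply/differentiable_continuous/differentiable_entry/(smooth_differentiable hf).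
split=> [y Uy|a]; first exact/differentiable_entry/(smooth_differentiable hf).
apply: (Ck_ext oU _ (IH _ (smooth_partial a hf))) => y Uy.
exact/partial_mx/(smooth_differentiable hf).
Qed.

Lemma differentiable_mx m n (f : E -> 'M[R]_(m, n)) y :
  (forall i j, differentiable (fun z => f z i j : R^o) y) -> differentiable f y.
Proof.
move=> df; have -> : f = \sum_i \sum_j (fun z => f z i j *: delta_mx i j).
  apply/funext => z; rewrite fct_sumE [LHS]matrix_sum_delta.
  by apply: eq_bigr => i _; rewrite fct_sumE.
apply: differentiable_sum => i; apply: differentiable_sum => j.
exact/(@differentiableZl _ _ _ (fun z => f z i j : R^o)).
Qed.

Lemma smooth_mx U m n (f : E -> 'M[R]_(m, n)) : open U ->
  (forall i j, smooth_on U (fun z => f z i j : R^o)) -> smooth_on U f.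
Proof.
move=> oU hf k; elim: k f hf => [|k IH] f hf.
  move=> y Uy; apply/differentiable_continuous/differentiable_mx => i j.
  exact: (smooth_differentiable (hf i j)).
have df y : U y -> differentiable f y.
  by move=> Uy; apply: differentiable_mx => i j; apply: (smooth_differentiable (hf i j)).
split=> // a; apply: IH => i j; apply: (smooth_ext oU _ (smooth_partial a (hf i j))).
by move=> y Uy; rewrite partial_mx//; apply: df.
Qed.

Lemma smooth_mulmx U m n p (f : E -> 'M[R]_(m, n)) (g : E -> 'M[R]_(n, p)) : open U ->
  smooth_on U f -> smooth_on U g -> smooth_on U (fun z => f z *m g z).
Proof.
move=> oU hf hg; apply: smooth_mx => // i j; under eq_fun do rewrite mxE.
by apply: smooth_sum => // k; apply: smooth_mul => //; apply: smooth_entry.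
Qed.

Lemma smooth_tr U m n (f : E -> 'M[R]_(m, n)) : open U ->
  smooth_on U f -> smooth_on U (fun z => (f z)^T).
Proof.
move=> oU hf; apply: smooth_mx => // i j; under eq_fun do rewrite mxE.
exact: smooth_entry.
Qed.

Lemma smooth_det U n (f : E -> 'M[R]_n) : open U ->
  smooth_on U f -> smooth_on U (fun z => \det (f z) : R^o).
Proof.
move=> oU hf; apply: smooth_sum => // s; apply: smooth_mul => //; first exact: smooth_cst.
by apply: smooth_prod => // i; apply: smooth_entry.
Qed.

Lemma smooth_invmx U n (f : E -> 'M[R]_n) : open U ->
  (forall y, U y -> f y \in unitmx) -> smooth_on U f -> smooth_on U (fun z => invmx (f z)).
Proof.
move=> oU fu hf; apply: smooth_mx => // i j.
have h : smooth_on U (fun z => (\det (f z))^-1 * cofactor (f z) j i : R^o).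
  apply: smooth_mul => //.
    by apply: smooth_inv => // [y /fu|]; [rewrite unitmxE unitfE | apply: smooth_det].
  apply: smooth_mul => //; first exact: smooth_cst.
  apply: smooth_det => //; apply: smooth_mx => // u v.
  by under eq_fun do rewrite !mxE; apply: smooth_entry.
apply: (smooth_ext oU _ h) => y Uy.
by rewrite /invmx fu// !mxE.
Qed.

Lemma diff_partial (f : E -> R^o) y v : differentiable f y ->
  'D_v f y = \sum_a v 0 a * partial a f y.
Proof.
move=> df; rewrite deriveE// {1}[v]row_sum_delta linear_sum.
by apply: eq_bigr => a _; rewrite linearZ /= /partial deriveE.
Qed.

Lemma locally_constant U f y : open U -> U y ->
  (forall z, U z -> differentiable f z) -> (forall z a, U z -> partial a f z = 0) ->
  \forall z \near y, f z = f y.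
Proof.
move=> oU Uy df pf.
have /nbhs_ballP[r /= r0 hr] : nbhs y U by apply: open_nbhs_nbhs.
apply/nbhs_ballP; exists r => // z; rewrite -ball_normE /= => yz.
have inU (x : R) : 0 <= x <= 1 -> U (y + x *: (z - y)).
  move=> /andP[x0 x1]; apply: hr; rewrite -ball_normE /= opprD addrA subrr sub0r normrN.
  rewrite normrZ ger0_norm// distrC; apply: le_lt_trans yz.
  by rewrite ler_piMl.
have [|c hc] := @mvt_line R f y (z - y) 1 ltr01.
  by move=> x /inU /df h; apply: diff_derivable.
have hU : U (y + c *: (z - y)) by case/andP: hc => c0 c1; apply: inU; rewrite !ltW.
rewrite diff_partial; last exact: df.
rewrite big1 => [|a _]; last by rewrite pf// mulr0.
by rewrite mulr0 scale1r [y + _]addrC subrK => /subr0_eq.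
Qed.

End SmoothOn.

(** * Torsion of a nearly parallel structure *)

Section TorsionAlgebra.
Variable R : realType.
Local Notation s := (@sigma0 R).
Local Notation p := (@psi0 R).
Local Notation I := 'I_7.
Local Notation d i j := ((i == j)%:R : R).
Implicit Types (a b c j k l m n q u x : I) (w : I -> I -> R).

Lemma sum_skew_sym w (D : I -> I -> R) :
  (forall a b, w a b = - w b a) -> (forall a b, D a b = D b a) ->
  \sum_a \sum_b w a b * D a b = 0.
Proof.
move=> hw hD; apply: (mulfI (x := 2%:R)); first by rewrite pnatr_eq0.
rewrite mulr0 mulr_natl mulr2n {2}exchange_big -big_split big1//= => a _.
by rewrite -big_split big1//= => b _; rewrite hw (hD b) mulNr addNr.
Qed.

Definition act3 w (t : tensor3 R) : tensor3 R := fun k l m =>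
  \sum_a (w k a * t a l m + w l a * t k a m + w m a * t k l a).

Definition act4 w (t : tensor4 R) : tensor4 R := fun k l m n =>
  \sum_a (w k a * t a l m n + w l a * t k a m n + w m a * t k l a n + w n a * t k l m a).

(** On skew matrices this is, up to a factor, the projection of the 2-forms to their 7-dimensional
    component; the kernel is the Lie algebra of G_2. *)
Definition dual7 w q : R := \sum_a \sum_b s q a b * w a b.

Lemma sum_row w (G : I -> R) k : \sum_a w k a * G a = \sum_a \sum_b w a b * (d k a * G b).
Proof.
rewrite exchange_big; apply: eq_bigr => b _ /=.
rewrite -(sum_delta (fun a => w a b * G b) k).
by apply: eq_bigr => a _; ring.
Qed.

(** The difference of the two sides is linear in [w]. Its coefficients [D] are symmetric, by a check
    of components, and so pair to 0 with a skew [w]. The same argument serves for [act4_psi0]. *)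
Lemma act3_sigma0 w k l m : (forall a b, w a b = - w b a) ->
  2%:R * act3 w s k l m = - \sum_q dual7 w q * p q k l m.
Proof.
move=> hw; apply/eqP; rewrite -subr_eq0 opprK; apply/eqP.
have hs := sum_skew_sym (D := fun a b => 2%:R * (d k a * s b l m + d l a * s k b m
   + d m a * s k l b) + \sum_q s q a b * p q k l m) hw.
rewrite -[RHS]hs; last by move=> a b; move: k l m a b {hs}; by_components.
under [RHS]eq_bigr => a _ do under eq_bigr => b _ do rewrite mulrDr.
under [RHS]eq_bigr => a _ do rewrite big_split.
rewrite big_split /=; congr (_ + _).
  rewrite /act3 !big_split /= !sum_row !mulrDr !mulr_sumr -!big_split.
  apply: eq_bigr => a _ /=; rewrite !mulr_sumr -!big_split.
  by apply: eq_bigr => b _ /=; ring.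
rewrite /dual7; under eq_bigr => q _ do rewrite mulr_suml.
rewrite exchange_big; apply: eq_bigr => a _ /=.
under eq_bigr => q _ do rewrite mulr_suml.
rewrite exchange_big; apply: eq_bigr => b _ /=.
by rewrite mulr_sumr; apply: eq_bigr => q _; ring.
Qed.

Lemma act4_psi0 w k l m n : (forall a b, w a b = - w b a) ->
  2%:R * act4 w p k l m n = dual7 w k * s l m n - dual7 w l * s k m n
    + dual7 w m * s k l n - dual7 w n * s k l m.
Proof.
move=> hw; apply/eqP; rewrite -subr_eq0; apply/eqP.
have hs := sum_skew_sym (D := fun a b => 2%:R * (d k a * p b l m n + d l a * p k b m n
   + d m a * p k l b n + d n a * p k l m b) - (s k a b * s l m n - s l a b * s k m n
   + s m a b * s k l n - s n a b * s k l m)) hw.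
rewrite -[RHS]hs; last by move=> a b; move: k l m n a b {hs}; by_components.
under [RHS]eq_bigr => a _ do under eq_bigr => b _ do rewrite mulrBr.
under [RHS]eq_bigr => a _ do rewrite sumrB.
rewrite sumrB; congr (_ - _).
  rewrite /act4 !big_split /= !sum_row !mulrDr !mulr_sumr -!big_split.
  apply: eq_bigr => a _ /=; rewrite !mulr_sumr -!big_split.
  by apply: eq_bigr => b _ /=; ring.
rewrite /dual7 !mulr_suml -sumrB -big_split -sumrB; apply: eq_bigr => a _ /=.
rewrite !mulr_suml -sumrB -big_split -sumrB; apply: eq_bigr => b _ /=; ring.
Qed.

(** The alternation that occurs in an exterior derivative; four terms are enough when [T j] is
    alternating, and five in [alt5]. *)
Definition alt4 (T : I -> tensor3 R) : tensor4 R := fun j k l m =>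
  T j k l m - T k j l m + T l j k m - T m j k l.

Definition alt5 (T : I -> tensor4 R) : I -> tensor4 R := fun j k l m n =>
  T j k l m n - T k j l m n + T l j k m n - T m j k l n + T n j k l m.

(** Contraction with [psi0] makes a 7 by 7 matrix equation of an equation between 4-forms;
    [alt5_contract] does this for 5-forms with [sigma0]. *)
Lemma alt4_contract a b j k : \sum_l \sum_m \sum_n p k l m n *
   (d j a * p b l m n - d l a * p b j m n + d m a * p b j l n - d n a * p b j l m) =
  12%:R * (d j a * d k b) + 12%:R * (d a b * d j k) - 6%:R * p a b j k.
Proof. by_components. Qed.

Lemma alt5_contract a b j k : \sum_l \sum_m \sum_n s l m n *
  ((d j a * (d k b * s l m n - d l b * s k m n + d m b * s k l n - d n b * s k l m))
  - (d k a * (d j b * s l m n - d l b * s j m n + d m b * s j l n - d n b * s j l m))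
  + (d l a * (d j b * s k m n - d k b * s j m n + d m b * s j k n - d n b * s j k m))
  - (d m a * (d j b * s k l n - d k b * s j l n + d l b * s j k n - d n b * s j k l))
  + (d n a * (d j b * s k l m - d k b * s j l m + d l b * s j k m - d m b * s j k l)))
  = 12%:R * (d j a * d k b) - 12%:R * (d k a * d j b) - 6%:R * p a b j k.
Proof. by_components. Qed.

Lemma psi0_swap a b c j : p a b c j = - p b a c j.
Proof. by_components. Qed.

Lemma psi0_pair a b c j : p a b c j = p c j a b.
Proof. by_components. Qed.

Lemma sum_delta2 w j k : \sum_a \sum_b w a b * (d j a * d k b) = w j k.
Proof.
transitivity (\sum_a d j a * (\sum_b d k b * w a b)); last by rewrite !sum_delta.
apply: eq_bigr => a _; rewrite mulr_sumr; apply: eq_bigr => b _; ring.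
Qed.

(* The eigenvalues x of psi0 on 2-forms satisfy x^2 = 8 - 2 x, so 4 is not one. *)
Lemma psi0_eigen w : (forall j k, 4%:R * w j k = \sum_a \sum_b w a b * p a b j k) ->
  (forall j k, w j k = - w k j) -> forall j k, w j k = 0.
Proof.
move=> hw sw j k.
have : \sum_c \sum_x (\sum_a \sum_b w a b * p a b c x) * p c x j k = 16%:R * w j k.
  rewrite [LHS](_ : _ = 4%:R * \sum_c \sum_x w c x * p c x j k).
    by rewrite -hw; ring.
  rewrite mulr_sumr; apply: eq_bigr => c _; rewrite mulr_sumr; apply: eq_bigr => x _.
  by rewrite -hw mulrA.
have -> : \sum_c \sum_x (\sum_a \sum_b w a b * p a b c x) * p c x j k =
    \sum_a \sum_b w a b * (\sum_c \sum_x p a b c x * p j k c x).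
  transitivity (\sum_c \sum_x \sum_a \sum_b w a b * (p a b c x * p j k c x)).
    apply: eq_bigr => c _; apply: eq_bigr => x _; rewrite mulr_suml.
    apply: eq_bigr => a _; rewrite mulr_suml; apply: eq_bigr => b _.
    by rewrite (psi0_pair c x) mulrA.
  under eq_bigr do rewrite exchange_big /=.
  rewrite exchange_big; apply: eq_bigr => a _ /=.
  under eq_bigr do rewrite exchange_big /=.
  rewrite exchange_big; apply: eq_bigr => b _ /=.
  by rewrite mulr_sumr; apply: eq_bigr => c _; rewrite mulr_sumr.
have -> : \sum_a \sum_b w a b * (\sum_c \sum_x p a b c x * p j k c x) =
    4%:R * w j k - 4%:R * w k j - 2%:R * (4%:R * w j k).
  transitivity (4%:R * (\sum_a \sum_b w a b * (d j a * d k b))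
    - 4%:R * (\sum_a \sum_b w a b * (d k a * d j b))
    - 2%:R * (\sum_a \sum_b w a b * p a b j k)); last by rewrite !sum_delta2 hw.
  rewrite !mulr_sumr -!sumrB; apply: eq_bigr => a _; rewrite !mulr_sumr -!sumrB.
  apply: eq_bigr => b _; rewrite psi0_contract2 !(eq_sym a) !(eq_sym b); ring.
by rewrite (sw k j); lra.
Qed.

Lemma sum_delta_alt w u k l m n (c1 c2 c3 c4 : R) :
  \sum_a \sum_b w a b * (d u a * (d k b * c1 - d l b * c2 + d m b * c3 - d n b * c4)) =
  w u k * c1 - w u l * c2 + w u m * c3 - w u n * c4.
Proof.
transitivity (\sum_a d u a * (\sum_b
    w a b * (d k b * c1 - d l b * c2 + d m b * c3 - d n b * c4))).
  by apply: eq_bigr => a _; rewrite mulr_sumr; apply: eq_bigr => b _; ring.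
rewrite sum_delta.
transitivity (\sum_b d k b * (w u b * c1) - \sum_b d l b * (w u b * c2)
   + \sum_b d m b * (w u b * c3) - \sum_b d n b * (w u b * c4)); last by rewrite !sum_delta.
by rewrite -sumrB -big_split -sumrB; apply: eq_bigr => b _ /=; ring.
Qed.

Lemma sum2_alt (X1 X2 X3 X4 X5 : I -> I -> R) w :
  \sum_a \sum_b w a b * (X1 a b - X2 a b + X3 a b - X4 a b + X5 a b) =
  \sum_a \sum_b w a b * X1 a b - \sum_a \sum_b w a b * X2 a b
  + \sum_a \sum_b w a b * X3 a b - \sum_a \sum_b w a b * X4 a b
  + \sum_a \sum_b w a b * X5 a b.
Proof.
rewrite -sumrB -big_split -sumrB -big_split; apply: eq_bigr => a _ /=.
by rewrite -sumrB -big_split -sumrB -big_split; apply: eq_bigr => b _ /=; ring.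
Qed.

Lemma sum_exchange w (S : I -> I -> I -> R) (B : I -> I -> I -> I -> I -> R) :
  \sum_a \sum_b w a b * (\sum_l \sum_m \sum_n S l m n * B a b l m n) =
  \sum_l \sum_m \sum_n S l m n * (\sum_a \sum_b w a b * B a b l m n).
Proof.
transitivity (\sum_a \sum_b \sum_l \sum_m \sum_n S l m n * (w a b * B a b l m n)).
  apply: eq_bigr => a _; apply: eq_bigr => b _; do 3 (rewrite mulr_sumr; apply: eq_bigr => ? _).
  by rewrite mulrCA.
rewrite pair_bigA; under eq_bigr do rewrite pair_bigA.
under eq_bigr do rewrite pair_bigA.
rewrite exchange_big [RHS]pair_bigA [RHS]pair_bigA; apply: eq_bigr => x _ /=.
by rewrite -(pair_bigA _ (fun a b => S x.1.1 x.1.2 x.2 * (w a b * B a b x.1.1 x.1.2 x.2)))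
  mulr_sumr; apply: eq_bigr => a _; rewrite mulr_sumr.
Qed.

Lemma sum_delta_alt4 w j l m n :
  \sum_a \sum_b w a b *
    (d j a * p b l m n - d l a * p b j m n + d m a * p b j l n - d n a * p b j l m)
  = \sum_q w j q * p q l m n - \sum_q w l q * p q j m n + \sum_q w m q * p q j l n
    - \sum_q w n q * p q j l m.
Proof.
have E c (X : I -> R) : \sum_a \sum_b w a b * (d c a * X b) = \sum_q w c q * X q.
  transitivity (\sum_a d c a * (\sum_b w a b * X b)); last by rewrite sum_delta.
  by apply: eq_bigr => a _; rewrite mulr_sumr; apply: eq_bigr => b _; ring.
rewrite -!E -sumrB -big_split -sumrB; apply: eq_bigr => a _ /=.
by rewrite -sumrB -big_split -sumrB; apply: eq_bigr => b _ /=; ring.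
Qed.

(* Contracting the second equation with sigma0 shows that t_jq = dual7 (w j) q is
   symmetric; contracting the first with psi0 then determines t. *)
Lemma torsion_determined (w : I -> I -> I -> R) :
  (forall j a b, w j a b = - w j b a) ->
  (forall j k l m, alt4 (fun j => act3 (w j) s) j k l m = - (4%:R * p j k l m)) ->
  (forall j k l m n, alt5 (fun j => act4 (w j) p) j k l m n = 0) ->
  forall j q, dual7 (w j) q = 2%:R * d j q.
Proof.
move=> sw h4 h5; pose t j q := dual7 (w j) q.
have Y j k : 12%:R * t j k - 12%:R * t k j - 6%:R * (\sum_a \sum_b t a b * p a b j k) = 0.
  transitivity (\sum_l \sum_m \sum_n s l m n *
    (2%:R * alt5 (fun j => act4 (w j) p) j k l m n)); last first.
    by do 3 (rewrite big1// => ? _); rewrite h5 mulr0 mulr0.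
  transitivity (\sum_a \sum_b t a b * (12%:R * (d j a * d k b) - 12%:R * (d k a * d j b)
     - 6%:R * p a b j k)).
    transitivity (12%:R * (\sum_a \sum_b t a b * (d j a * d k b))
      - 12%:R * (\sum_a \sum_b t a b * (d k a * d j b))
      - 6%:R * (\sum_a \sum_b t a b * p a b j k)); first by rewrite !sum_delta2.
    rewrite !mulr_sumr -!sumrB; apply: eq_bigr => a _; rewrite !mulr_sumr -!sumrB.
    by apply: eq_bigr => b _; ring.
  under eq_bigr => a _ do under eq_bigr => b _ do rewrite -alt5_contract.
  rewrite sum_exchange; do 3 (apply: eq_bigr => ? _); congr (_ * _).
  by rewrite sum2_alt !sum_delta_alt /t -!act4_psi0// /alt5; ring.
have X (j k : I) : 24%:R * d j k * 8%:R = 12%:R * t j k + 12%:R * (\sum_a t a a) * d j k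
    - 6%:R * (\sum_a \sum_b t a b * p a b j k).
  transitivity (\sum_l \sum_m \sum_n p k l m n *
    (- 2%:R * alt4 (fun j => act3 (w j) s) j l m n)).
    transitivity (8%:R * (\sum_l \sum_m \sum_n p k l m n * p j l m n)).
      rewrite mulrC; congr (_ * _); move: j k; by_components.
    do 3 (rewrite mulr_sumr; apply: eq_bigr => ? _); rewrite h4; ring.
  transitivity (\sum_a \sum_b t a b * (12%:R * (d j a * d k b) + 12%:R * (d a b * d j k)
     - 6%:R * p a b j k)); last first.
    transitivity (12%:R * (\sum_a \sum_b t a b * (d j a * d k b))
      + 12%:R * (\sum_a \sum_b d a b * (t a b * d j k))
      - 6%:R * (\sum_a \sum_b t a b * p a b j k)); last first.
      rewrite !sum_delta2; congr (_ + _ - _); rewrite -mulrA; congr (_ * _).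
      by rewrite mulr_suml; apply: eq_bigr => a _; rewrite sum_delta.
    rewrite !mulr_sumr -big_split -sumrB; apply: eq_bigr => a _ /=.
    rewrite !mulr_sumr -big_split -sumrB; apply: eq_bigr => b _ /=; ring.
  under [RHS]eq_bigr => a _ do under eq_bigr => b _ do rewrite -alt4_contract.
  rewrite sum_exchange; apply: eq_bigr => l _; apply: eq_bigr => m _; apply: eq_bigr => n _.
  congr (_ * _); rewrite sum_delta_alt4.
  have E u x y z : \sum_q t u q * p q x y z = - (2%:R * act3 (w u) s x y z).
    by rewrite act3_sigma0// opprK.
  by rewrite !E /alt4; ring.
(* Since [psi0] sees only the skew part of [t], the relation [Y] makes [u] an eigenvector of [psi0]
   on 2-forms for the excluded eigenvalue 4. *)
pose u j k := t j k - t k j.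
have u0 : forall j k, u j k = 0.
  apply: psi0_eigen => j k; last by rewrite /u; ring.
  have -> : \sum_a \sum_b u a b * p a b j k = 2%:R * (\sum_a \sum_b t a b * p a b j k).
    rewrite mulr_natl mulr2n [X in _ = _ + X]exchange_big -big_split; apply: eq_bigr => a _ /=.
    rewrite -big_split; apply: eq_bigr => b _ /=.
    by rewrite (psi0_swap b a) /u; ring.
  by have := Y j k; rewrite /u => h; lra.
have sym j k : t j k = t k j by apply/eqP; rewrite -subr_eq0 -/(u j k) u0.
have X' j k : 192%:R * d j k = 12%:R * t j k + 12%:R * (\sum_a t a a) * d j k.
  have h0 : \sum_a \sum_b t a b * p a b j k = 0.
    transitivity (\sum_a \sum_b p a b j k * t a b).
      by apply: eq_bigr => a _; apply: eq_bigr => b _; rewrite mulrC.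
    by apply: sum_skew_sym => // a b; apply: psi0_swap.
  by have := X j k; rewrite h0 mulr0 subr0 => <-; ring.
(* The trace of [X'] reads 192 times 7 equal to 12 + 12 times 7 traces. *)
have tr : \sum_a t a a = 14%:R.
  have : \sum_(j < 7) 192%:R * d j j = \sum_(j < 7) (12%:R * t j j + 12%:R * (\sum_a t a a) * d j j).
    by apply: eq_bigr => j _; apply: X'.
  rewrite big_split -!mulr_sumr.
  have -> : \sum_(j < 7) d j j = 7%:R.
    by rewrite (eq_bigr (fun=> 1)) ?sumr_const ?card_ord// => j _; rewrite eqxx.
  rewrite /=; move: (\sum_a t a a) => T h; lra.
move=> j q; have := X' j q; rewrite tr -/(t j q) => h; lra.
Qed.

End TorsionAlgebra.

(** * Infinitesimal action of matrices on pulled back tensors *)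

Section SlotAction.
Variable R : realType.
Local Notation I := 'I_7.
Implicit Types (a b c j k l m n x : I) (A : 'M[R]_7) (t : tensor3 R) (r : tensor4 R).

Lemma act3_slots (w : 'M[R]_7) t : act3 w t = fun k l m =>
  slots3 w 1%:M 1%:M t k l m + slots3 1%:M w 1%:M t k l m + slots3 1%:M 1%:M w t k l m.
Proof.
apply/funext => k; apply/funext => l; apply/funext => m.
rewrite /act3 !big_split /= !slots3E !sum_mx1.
by congr (_ + _ + _); apply: eq_bigr => a _; rewrite ?sum_mx1.
Qed.

Lemma act4_slots (w : 'M[R]_7) r : act4 w r = fun k l m n =>
  slots4 w 1%:M 1%:M 1%:M r k l m n + slots4 1%:M w 1%:M 1%:M r k l m n
  + slots4 1%:M 1%:M w 1%:M r k l m n + slots4 1%:M 1%:M 1%:M w r k l m n.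
Proof.
apply/funext => k; apply/funext => l; apply/funext => m; apply/funext => n.
rewrite /act4 !big_split /= !slots4E !sum_mx1.
by congr (_ + _ + _ + _); apply: eq_bigr => a _; rewrite ?sum_mx1.
Qed.

(* For X = d_a T this computes d_a (T^* t), G being the Christoffel matrix and w
   the connection form in the frame dual to T. *)
Lemma slots3_leibniz (G T w X : 'M[R]_7) t a b c : X = G *m T - T *m w ->
  slots3 X T T t a b c + slots3 T X T t a b c + slots3 T T X t a b c =
  act3 G (pull3 T t) a b c - pull3 T (act3 w t) a b c.
Proof.
move=> ->; have E i j : (G *m T - T *m w) i j = (G *m T) i j - (T *m w) i j by rewrite !mxE.
rewrite !act3_slots !pull3_slots !slots3_comp !mul1mx.
have -> : slots3 T T T (fun k l m => slots3 w 1%:M 1%:M t k l m +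
    slots3 1%:M w 1%:M t k l m + slots3 1%:M 1%:M w t k l m) a b c =
    slots3 T T T (slots3 w 1%:M 1%:M t) a b c + slots3 T T T (slots3 1%:M w 1%:M t) a b c
    + slots3 T T T (slots3 1%:M 1%:M w t) a b c.
  by rewrite -!big_split; apply: eq_bigr => x _ /=; ring.
rewrite !slots3_comp !mulmx1 /slots3 -!big_split -sumrB; apply: eq_bigr => x _ /=.
by rewrite !E; ring.
Qed.

Lemma slots4_leibniz (G T w X : 'M[R]_7) r a b c e : X = G *m T - T *m w ->
  slots4 X T T T r a b c e + slots4 T X T T r a b c e + slots4 T T X T r a b c e
    + slots4 T T T X r a b c e =
  act4 G (pull4 T r) a b c e - pull4 T (act4 w r) a b c e.
Proof.
move=> ->; have E i j : (G *m T - T *m w) i j = (G *m T) i j - (T *m w) i j by rewrite !mxE.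
rewrite !act4_slots !pull4_slots !slots4_comp !mul1mx.
have -> : slots4 T T T T (fun k l m n => slots4 w 1%:M 1%:M 1%:M r k l m n +
    slots4 1%:M w 1%:M 1%:M r k l m n + slots4 1%:M 1%:M w 1%:M r k l m n
    + slots4 1%:M 1%:M 1%:M w r k l m n) a b c e =
    slots4 T T T T (slots4 w 1%:M 1%:M 1%:M r) a b c e
    + slots4 T T T T (slots4 1%:M w 1%:M 1%:M r) a b c e
    + slots4 T T T T (slots4 1%:M 1%:M w 1%:M r) a b c e
    + slots4 T T T T (slots4 1%:M 1%:M 1%:M w r) a b c e.
  by rewrite -!big_split; apply: eq_bigr => x _ /=; ring.
rewrite !slots4_comp !mulmx1 /slots4 -!big_split -sumrB; apply: eq_bigr => x _ /=.
by rewrite !E; ring.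
Qed.

Lemma pull4_swap12 A r a b c e :
  pull4 A r b a c e = pull4 A (fun a b c e => r b a c e) a b c e.
Proof.
rewrite !pull4_slots /slots4 (reindex_inj (h := fun x : I * I * I * I =>
  (x.1.1.2, x.1.1.1, x.1.2, x.2))); last by move=> [[[x y] z] k] [[[x' y'] z'] k'] [-> -> -> ->].
by apply: eq_bigr => x _ /=; ring.
Qed.

Lemma pull4_swap23 A r a b c e :
  pull4 A r a c b e = pull4 A (fun a b c e => r a c b e) a b c e.
Proof.
rewrite !pull4_slots /slots4 (reindex_inj (h := fun x : I * I * I * I =>
  (x.1.1.1, x.1.2, x.1.1.2, x.2))); last by move=> [[[x y] z] k] [[[x' y'] z'] k'] [-> -> -> ->].
by apply: eq_bigr => x _ /=; ring.
Qed.

Lemma pull4_swap34 A r a b c e :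
  pull4 A r a b e c = pull4 A (fun a b c e => r a b e c) a b c e.
Proof.
rewrite !pull4_slots /slots4 (reindex_inj (h := fun x : I * I * I * I =>
  (x.1.1.1, x.1.1.2, x.2, x.1.2))); last by move=> [[[x y] z] k] [[[x' y'] z'] k'] [-> -> -> ->].
by apply: eq_bigr => x _ /=; ring.
Qed.

Lemma pull4_alt4 A (T : I -> tensor3 R) a b c e :
  alt4 (fun a => pull4 A T a) a b c e = pull4 A (alt4 T) a b c e.
Proof.
rewrite {1}/alt4 (pull4_swap12 A T a b).
have -> : pull4 A T c a b e = pull4 A (fun a b c e => T c a b e) a b c e.
  by rewrite pull4_swap12 pull4_swap23.
have -> : pull4 A T e a b c = pull4 A (fun a b c e => T e a b c) a b c e.
  by rewrite pull4_swap12 pull4_swap23 pull4_swap34.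
rewrite !pull4_slots /slots4 -sumrB -big_split -sumrB; apply: eq_bigr => x _ /=.
rewrite /alt4; ring.
Qed.

Definition slots5 A (V : I -> tensor4 R) : I -> tensor4 R := fun a b c e f =>
  \sum_(x : I * (I * I * I * I)) A a x.1 *
    (A b x.2.1.1.1 * A c x.2.1.1.2 * A e x.2.1.2 * A f x.2.2) *
    V x.1 x.2.1.1.1 x.2.1.1.2 x.2.1.2 x.2.2.

Lemma slots5E A V a b c e f : slots5 A V a b c e f = \sum_j A a j * pull4 A (V j) b c e f.
Proof.
rewrite /slots5 -(pair_bigA _ (fun (j : I) (y : I * I * I * I) => A a j *
    (A b y.1.1.1 * A c y.1.1.2 * A e y.1.2 * A f y.2) * V j y.1.1.1 y.1.1.2 y.1.2 y.2)).
apply: eq_bigr => j _; rewrite pull4_slots /slots4 mulr_sumr.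
by apply: eq_bigr => y _; ring.
Qed.

Lemma slots5_swap12 A V a b c e f :
  slots5 A V b a c e f = slots5 A (fun a b c e f => V b a c e f) a b c e f.
Proof.
rewrite /slots5 (reindex_inj (h := fun x : I * (I * I * I * I) =>
  (x.2.1.1.1, (x.1, x.2.1.1.2, x.2.1.2, x.2.2)))); first by apply: eq_bigr => x _ /=; ring.
by move=> [h [[[x y] z] k]] [h' [[[x' y'] z'] k']] [-> -> -> -> ->].
Qed.

Lemma slots5_swap23 A V a b c e f :
  slots5 A V a c b e f = slots5 A (fun a b c e f => V a c b e f) a b c e f.
Proof. by rewrite !slots5E; apply: eq_bigr => j _; rewrite pull4_swap12. Qed.

Lemma slots5_swap34 A V a b c e f :
  slots5 A V a b e c f = slots5 A (fun a b c e f => V a b e c f) a b c e f.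
Proof. by rewrite !slots5E; apply: eq_bigr => j _; rewrite pull4_swap23. Qed.

Lemma slots5_swap45 A V a b c e f :
  slots5 A V a b c f e = slots5 A (fun a b c e f => V a b c f e) a b c e f.
Proof. by rewrite !slots5E; apply: eq_bigr => j _; rewrite pull4_swap34. Qed.

Lemma slots5_alt5 A V a b c e f :
  alt5 (fun a => slots5 A V a) a b c e f = slots5 A (alt5 V) a b c e f.
Proof.
rewrite {1}/alt5 (slots5_swap12 A V a b) (slots5_swap12 A V a c).
rewrite (slots5_swap12 A V a e) (slots5_swap12 A V a f).
rewrite (slots5_swap23 A _ a b c) (slots5_swap23 A _ a b e) (slots5_swap23 A _ a b f).
rewrite (slots5_swap34 A _ a b c e) (slots5_swap34 A _ a b c f) (slots5_swap45 A _ a b c e f).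
rewrite /slots5 -sumrB -big_split -sumrB -big_split; apply: eq_bigr => x _ /=.
rewrite /alt5; ring.
Qed.

Lemma pull4_sum A (c : I -> R) (V : I -> tensor4 R) a b e f :
  pull4 A (fun a b e f => \sum_j c j * V j a b e f) a b e f =
  \sum_j c j * pull4 A (V j) a b e f.
Proof.
rewrite pull4_slots /slots4; under [RHS]eq_bigr do rewrite pull4_slots /slots4 mulr_sumr.
rewrite exchange_big; apply: eq_bigr => x _; rewrite mulr_sumr.
by apply: eq_bigr => j _; ring.
Qed.

Lemma slots5_eq0 A V : A \in unitmx ->
  (forall a b c e f, slots5 A V a b c e f = 0) -> forall a b c e f, V a b c e f = 0.
Proof.
move=> uA h a b c e f.
have hj k : \sum_j A k j * V j b c e f = 0.
  have : pull4 (invmx A) (fun b c e f => \sum_j A k j * pull4 A (V j) b c e f) b c e f = 0.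
    rewrite pull4_slots /slots4 big1// => x _.
    by rewrite -slots5E h mulr0.
  rewrite pull4_sum => h0; rewrite -[RHS]h0; apply: eq_bigr => j _.
  by rewrite pull4_comp mulVmx// pull4_1.
transitivity (\sum_k invmx A a k * \sum_j A k j * V j b c e f); last first.
  by rewrite big1// => k _; rewrite hj mulr0.
have hA : invmx A *m A = 1%:M by rewrite mulVmx.
rewrite -[LHS](sum_delta (fun j => V j b c e f)).
transitivity (\sum_j (\sum_k invmx A a k * A k j) * V j b c e f).
  by apply: eq_bigr => j _; have /matrixP/(_ a j) := hA; rewrite !mxE => ->.
under eq_bigr do rewrite mulr_suml.
rewrite exchange_big; apply: eq_bigr => k _; rewrite mulr_sumr.
by apply: eq_bigr => j _; rewrite mulrA.
Qed.

Lemma pull4_eq A r r' : A \in unitmx -> pull4 A r = pull4 A r' -> r = r'.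
Proof.
by move=> uA /(congr1 (pull4 (invmx A))); rewrite !pull4_comp mulVmx// !pull4_1.
Qed.

(** Absence of torsion: the Christoffel terms cancel in pairs in an exterior derivative. *)
Lemma alt4_symmetric (G : I -> 'M[R]_7) t a b c e :
  (forall a b e, G a b e = G b a e) -> (forall a b c, t b a c = - t a b c) ->
  (forall a b c, t a c b = - t a b c) -> alt4 (fun a => act3 (G a) t) a b c e = 0.
Proof.
move=> hG h12 h23; rewrite /alt4 /act3 -sumrB -big_split -sumrB big1// => f _ /=.
rewrite (hG b a) (hG c a) (hG c b) (hG e a) (hG e b) (hG e c).
rewrite (h12 b f e) (h23 b f c) (h12 b f c) (h23 a f c); ring.
Qed.

Lemma alt5_symmetric (G : I -> 'M[R]_7) r a b c e f :
  (forall a b e, G a b e = G b a e) -> (forall a b c e, r b a c e = - r a b c e) ->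
  (forall a b c e, r a c b e = - r a b c e) -> (forall a b c e, r a b e c = - r a b c e) ->
  alt5 (fun a => act4 (G a) r) a b c e f = 0.
Proof.
move=> hG h12 h23 h34; rewrite /alt5 /act4 -sumrB -big_split -sumrB -big_split big1// => g _ /=.
rewrite (hG b a) (hG c a) (hG c b) (hG e a) (hG e b) (hG e c).
rewrite (hG f a) (hG f b) (hG f c) (hG f e).
rewrite (h12 b g) (h23 b g) (h12 b g) (h34 b c g) (h23 b g) (h12 b g).
rewrite (h23 a g c f) (h34 a c g e) (h23 a g c e) (h34 a b g e); ring.
Qed.

End SlotAction.

(** * The spin connection in an adapted frame *)

Section PartialDerivatives.
Variable R : realType.
Local Notation E := 'rV[R]_7.
Local Notation I := 'I_7.
Implicit Types (a b c d e : I) (y z : E) (U : set E).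

Lemma partial_sum U (J : finType) (F : J -> E -> R^o) a y : U y ->
  (forall i, smooth_on U (F i)) ->
  partial a (fun z => \sum_i F i z : R^o) y = \sum_i partial a (F i) y.
Proof.
move=> Uy hF.
have eqs (G : J -> R) : \sum_i G i = \sum_(i < #|J|) G (enum_val i).
  by rewrite (reindex _ (onW_bij _ (enum_val_bij _))).
under eq_fun do rewrite eqs; rewrite eqs /partial.
rewrite (_ : (fun z => _) = \sum_(i < #|J|) F (enum_val i)); last first.
  by apply/funext => z; rewrite fct_sumE.
by rewrite derive_sum// => i; apply: smooth_derivable (hF _) Uy.
Qed.

Lemma partial_mul U (f g : E -> R^o) a y : U y -> smooth_on U f -> smooth_on U g ->
  partial a (fun z => f z * g z : R^o) y = partial a f y * g y + f y * partial a g y.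
Proof.
move=> Uy hf hg; rewrite /partial (@deriveM R E f g).
- by rewrite addrC; congr (_ + _); rewrite mulrC.
- exact: smooth_derivable hf Uy.
- exact: smooth_derivable hg Uy.
Qed.

Lemma partial_mulr U (f : E -> R^o) (c : R) a y : U y -> smooth_on U f ->
  partial a (fun z => f z * c : R^o) y = partial a f y * c.
Proof.
move=> Uy hf; rewrite (partial_mul a Uy hf (smooth_cst U (c : R^o))).
by rewrite [X in _ + _ * X](_ : _ = 0) ?mulr0 ?addr0// /partial derive_cst.
Qed.

Lemma partial_mulmx U m n p (f : E -> 'M[R]_(m, n)) (g : E -> 'M[R]_(n, p)) a y :
  open U -> U y -> smooth_on U f -> smooth_on U g ->
  partial a (fun z => f z *m g z) y = partial a f y *m g y + f y *m partial a g y.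
Proof.
move=> oU Uy hf hg; apply/matrixP => i j.
rewrite partial_mx; last exact: smooth_differentiable (smooth_mulmx oU hf hg) Uy.
have -> : (fun z => (f z *m g z) i j : R^o) = fun z => \sum_k f z i k * g z k j : R^o.
  by apply/funext => z; rewrite mxE.
rewrite (partial_sum _ Uy) => [|k]; last by apply: smooth_mul => //; apply: smooth_entry.
rewrite !mxE -big_split; apply: eq_bigr => k _ /=.
rewrite (partial_mul _ Uy); try exact: smooth_entry.
by rewrite !partial_mx//; [apply: smooth_differentiable hg Uy | apply: smooth_differentiable hf Uy].
Qed.

Lemma partial_trmx U m n (f : E -> 'M[R]_(m, n)) a y :
  open U -> U y -> smooth_on U f -> partial a (fun z => (f z)^T) y = (partial a f y)^T.
Proof.
move=> oU Uy hf; apply/matrixP => i j.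
rewrite partial_mx; last exact: smooth_differentiable (smooth_tr oU hf) Uy.
under eq_fun do rewrite mxE; rewrite mxE partial_mx//; exact: smooth_differentiable hf Uy.
Qed.

Lemma metric_of_sym (t : tensor3 R) b c : metric_of t b c = metric_of t c b.
Proof.
have /matrixP/(_ b c) : (metric_of t)^T = metric_of t by rewrite trmx_mul trmxK.
by rewrite mxE.
Qed.

Lemma smooth_pull3 (U : set E) (T : E -> 'M[R]_7) (t : tensor3 R) b c d : open U ->
  smooth_on U T -> smooth_on U (fun z => pull3 (T z) t b c d : R^o).
Proof.
move=> oU sT; under eq_fun do rewrite pull3_slots; apply: smooth_sum => // x.
apply: smooth_mul => //; last exact: smooth_cst.
by do !(apply: smooth_mul => //; try exact: smooth_entry).
Qed.

Lemma smooth_pull4 (U : set E) (T : E -> 'M[R]_7) (r : tensor4 R) b c d e : open U ->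
  smooth_on U T -> smooth_on U (fun z => pull4 (T z) r b c d e : R^o).
Proof.
move=> oU sT; under eq_fun do rewrite pull4_slots; apply: smooth_sum => // x.
apply: smooth_mul => //; last exact: smooth_cst.
by do !(apply: smooth_mul => //; try exact: smooth_entry).
Qed.

Lemma partial_pull3 (U : set E) (T : E -> 'M[R]_7) (t : tensor3 R) a b c d y :
  open U -> smooth_on U T -> U y ->
  partial a (fun z => pull3 (T z) t b c d : R^o) y =
  slots3 (partial a T y) (T y) (T y) t b c d + slots3 (T y) (partial a T y) (T y) t b c d
  + slots3 (T y) (T y) (partial a T y) t b c d.
Proof.
move=> oU sT Uy; have sE i j : smooth_on U (fun z => T z i j : R^o) by apply: smooth_entry.
have dT := smooth_differentiable sT Uy.
under eq_fun do rewrite pull3_slots /slots3.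
rewrite (partial_sum _ Uy) => [|x]; last first.
  apply: smooth_mul => //; last exact: smooth_cst.
  by apply: smooth_mul => //; apply: smooth_mul.
rewrite /slots3 -!big_split; apply: eq_bigr => x _ /=.
have s2 i j k l : smooth_on U (fun z => T z i j * T z k l : R^o) by apply: smooth_mul.
rewrite (partial_mulr _ _ Uy); last by apply: smooth_mul.
rewrite (partial_mul _ Uy)//; rewrite (partial_mul _ Uy)//; rewrite -!partial_mx//.
move: (partial a T y) => X; ring.
Qed.

Lemma partial_pull4 (U : set E) (T : E -> 'M[R]_7) (r : tensor4 R) a b c d e y :
  open U -> smooth_on U T -> U y ->
  partial a (fun z => pull4 (T z) r b c d e : R^o) y =
  slots4 (partial a T y) (T y) (T y) (T y) r b c d e
  + slots4 (T y) (partial a T y) (T y) (T y) r b c d e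
  + slots4 (T y) (T y) (partial a T y) (T y) r b c d e
  + slots4 (T y) (T y) (T y) (partial a T y) r b c d e.
Proof.
move=> oU sT Uy; have sE i j : smooth_on U (fun z => T z i j : R^o) by apply: smooth_entry.
have dT := smooth_differentiable sT Uy.
have s2 i j k l : smooth_on U (fun z => T z i j * T z k l : R^o) by apply: smooth_mul.
have s3 i j k l m n : smooth_on U (fun z => T z i j * T z k l * T z m n : R^o).
  by apply: smooth_mul.
under eq_fun do rewrite pull4_slots /slots4.
rewrite (partial_sum _ Uy) => [|x]; last first.
  by apply: smooth_mul => //; [apply: smooth_mul | apply: smooth_cst].
rewrite /slots4 -!big_split; apply: eq_bigr => x _ /=.
rewrite (partial_mulr _ _ Uy); last by apply: smooth_mul.
rewrite (partial_mul _ Uy)//; rewrite (partial_mul _ Uy)//; rewrite (partial_mul _ Uy)//.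
rewrite -!partial_mx//.
move: (partial a T y) => X; ring.
Qed.

Lemma derive_alt4 (f1 f2 f3 f4 : E -> R^o) y v : derivable f1 y v -> derivable f2 y v ->
  derivable f3 y v -> derivable f4 y v ->
  'D_v (f1 - f2 + f3 - f4) y = 'D_v f1 y - 'D_v f2 y + 'D_v f3 y - 'D_v f4 y.
Proof.
move=> d1 d2 d3 d4; have d12 := derivableB d1 d2.
by rewrite (deriveB (derivableD d12 d3) d4) (deriveD d12 d3) (deriveB d1 d2).
Qed.

(** The identity d d = 0, from the symmetry of second derivatives. *)
Lemma alt5_ext_deriv (U : set E) (sg : E -> tensor3 R) y : open U -> U y ->
  (forall a b c, smooth_on U (fun z => sg z a b c : R^o)) ->
  forall a b c d e,
  alt5 (fun a b c d e => partial a (fun z => ext_deriv sg z b c d e : R^o) y) a b c d e = 0.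
Proof.
move=> oU Uy ss.
pose H a b c d e : R := partial a (partial b (fun z => sg z c d e : R^o)) y.
have hH a b c d e : H a b c d e = H b a c d e.
  exact: partial_comm oU (ss c d e 2%N) Uy.
have sp b c d e : smooth_on U (partial b (fun z => sg z c d e : R^o)).
  exact: smooth_partial.
have hE a b c d e : partial a (fun z => ext_deriv sg z b c d e : R^o) y =
    H a b c d e - H a c b d e + H a d b c e - H a e b c d.
  pose f b c d e : E -> R^o := partial b (fun z => sg z c d e : R^o).
  have dr b' c' d' e' : derivable (f b' c' d' e') y (delta_mx 0 a).
    exact: smooth_derivable (sp b' c' d' e') Uy.
  rewrite -[LHS]/('D_(delta_mx 0 a) (f b c d e - f c b d e + f d b c e - f e b c d) y).
  exact: derive_alt4.
move=> a b c d e; rewrite /alt5 !hE; clearbody H.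
rewrite (hH b a) (hH c a) (hH c b) (hH d a) (hH d b) (hH d c).
rewrite (hH e a) (hH e b) (hH e c) (hH e d); ring.
Qed.

End PartialDerivatives.

(** * Action of so(7) on spinors written as a scalar and a vector *)

Section SpinConnection.
Variable R : realType.
Local Notation E := 'rV[R]_7.
Local Notation I := 'I_7.
Local Notation s0 := (@sigma0 R).
Local Notation ev i := (delta_mx 0 i : 'rV[R]_7).
Implicit Types (a b c j k l m q : I) (v t : 'rV[R]_7) (w : 'M[R]_7).

(** The Clifford element of a matrix in so(7), without the usual factor 1/4. Operators act on the
    right, hence the reversed order of the two factors. *)
Definition spin_form w : 'M[R]_(1 + 7) :=
  \sum_k \sum_l w k l *: (clifford (ev l) *m clifford (ev k)).

Lemma clifford_row v : clifford v = \sum_i v 0 i *: clifford (ev i).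
Proof.
by rewrite {1}[v]row_sum_delta linear_sum; apply: eq_bigr => i _; rewrite linearZ.
Qed.

Lemma clifford_ev_comm k l : clifford (ev k) *m clifford (ev l) =
  (- (2%:R * (k == l)%:R))%:M - clifford (ev l) *m clifford (ev k).
Proof.
apply/eqP; rewrite -subr_eq opprK clifford_anticommute; apply/eqP; congr (- (_ * _))%:M.
rewrite mxE -[RHS](sum_delta (fun i => (i == l)%:R)).
by apply: eq_bigr => i _; rewrite !mxE /= eq_sym.
Qed.

Lemma spin_form_commutator w v : w = - w^T ->
  clifford v *m spin_form w - spin_form w *m clifford v = 4%:R *: clifford (v *m w).
Proof.
move=> hw; have wE k l : w k l = - w l k by move/matrixP/(_ k l): hw; rewrite !mxE.
have ev_case m : clifford (ev m) *m spin_form w - spin_form w *m clifford (ev m) =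
    4%:R *: \sum_l w m l *: clifford (ev l).
  transitivity (\sum_k \sum_l w k l *: (- (2%:R * (m == l)%:R) *: clifford (ev k)
      + (2%:R * (m == k)%:R) *: clifford (ev l))).
    rewrite /spin_form mulmx_sumr mulmx_suml -sumrB; apply: eq_bigr => k _.
    rewrite mulmx_sumr mulmx_suml -sumrB; apply: eq_bigr => l _.
    rewrite -scalemxAr -scalemxAl -scalerBr; congr (_ *: _).
    rewrite mulmxA (clifford_ev_comm m l) mulmxBl mul_scalar_mx -!mulmxA.
    rewrite (clifford_ev_comm m k) mulmxBr mul_mx_scalar opprB.
    rewrite [X in _ + X - _]addrC addrA addrK; congr (_ + _).
    by rewrite -scaleNr opprK.
  transitivity (\sum_k ((- 2%:R * w k m) *: clifford (ev k)) +
     \sum_l ((2%:R * w m l) *: clifford (ev l))).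
    transitivity (\sum_k \sum_l (m == l)%:R *: ((- 2%:R * w k l) *: clifford (ev k))
      + \sum_k \sum_l (m == k)%:R *: ((2%:R * w k l) *: clifford (ev l))).
      rewrite -big_split; apply: eq_bigr => k _; rewrite -big_split; apply: eq_bigr => l _ /=.
      by rewrite scalerDr !scalerA; congr (_ *: _ + _ *: _); ring.
    congr (_ + _).
      apply: eq_bigr => k _; rewrite (bigD1 m)//= eqxx scale1r big1 ?addr0// => l /negbTE.
      by rewrite eq_sym => ->; rewrite scale0r.
    rewrite (bigD1 m)//= eqxx [X in _ + X]big1 ?addr0 => [|k /negbTE]; last first.
      by rewrite eq_sym => hk; rewrite big1// => l _; rewrite hk scale0r.
    by apply: eq_bigr => l _; rewrite scale1r.
  rewrite -big_split scaler_sumr; apply: eq_bigr => k _ /=.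
  by rewrite -scalerDl scalerA (wE k m); congr (_ *: _); ring.
rewrite [in LHS](clifford_row v) mulmx_suml mulmx_sumr -sumrB.
transitivity (\sum_m v 0 m *: (4%:R *: \sum_l w m l *: clifford (ev l))).
  by apply: eq_bigr => m _; rewrite -scalemxAl -scalemxAr -scalerBr ev_case.
rewrite [in RHS](clifford_row (v *m w)) scaler_sumr.
under eq_bigr do rewrite scaler_sumr scaler_sumr.
rewrite exchange_big; apply: eq_bigr => l _ /=.
rewrite mxE scaler_suml scaler_sumr; apply: eq_bigr => m _; rewrite !scalerA.
by congr (_ *: _); ring.
Qed.

Lemma sigma0_cyclic a b c : s0 a b c = s0 b c a.
Proof. by_components. Qed.

Lemma spinor_scale (x h : R) v : x *: spinor h v = spinor (x * h) (x *: v).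
Proof. by rewrite /spinor scale_row_mx scale_scalar_mx. Qed.

Lemma spinor_add (h h' : R) v v' : spinor h v + spinor h' v' = spinor (h + h') (v + v').
Proof. by rewrite /spinor add_row_mx -raddfD. Qed.

Lemma spinor_inj (h h' : R) v v' : spinor h v = spinor h' v' -> h = h' /\ v = v'.
Proof.
by move=> /eq_row_mx[/matrixP/(_ 0 0) h1 ->]; move: h1; rewrite !mxE.
Qed.

(** On the invariant spinor a product of two Clifford factors gives an inner product and a cross
    product. Skewness of [w] removes the former, and the latter assembles to [dual7 w]. *)
Lemma spin_form_base w t : w = - w^T -> (forall q, dual7 w q = 2%:R * t 0 q) ->
  spinor 1 0 *m spin_form w = 2%:R *: spinor 0 t.
Proof.
move=> hw ht; have wE k l : w k l = - w l k by move/matrixP/(_ k l): hw; rewrite !mxE.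
rewrite /spin_form mulmx_sumr.
have E k l : spinor 1 0 *m (w k l *: (clifford (ev l) *m clifford (ev k))) =
    spinor (- (w k l * (k == l)%:R)) (\row_m (w k l * s0 k l m)).
  rewrite -scalemxAr mulmxA !spinor_clifford !mul0mx scale1r addr0 spinor_scale.
  congr spinor.
    rewrite mulrN; congr (- (_ * _)); rewrite mxE -[RHS](sum_delta (fun i => (i == l)%:R)).
    by apply: eq_bigr => i _; rewrite !mxE /= mulrC eq_sym.
  rewrite [X in - X]mxE oppr0 scale0r add0r; apply/rowP => m.
  rewrite !mxE; congr (_ * _).
  transitivity (\sum_j (j == l)%:R * crossm (ev k) j m).
    by apply: eq_bigr => j _; rewrite mxE.
  rewrite sum_delta' mxE -[RHS](sum_delta' (fun i => s0 i l m)).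
  by apply: eq_bigr => i _; rewrite mxE.
transitivity (\sum_k \sum_l spinor (- (w k l * (k == l)%:R)) (\row_m (w k l * s0 k l m))).
  by apply: eq_bigr => k _; rewrite mulmx_sumr; apply: eq_bigr => l _.
have sumE (J : finType) (h : J -> R) (v : J -> 'rV[R]_7) :
    \sum_i spinor (h i) (v i) = spinor (\sum_i h i) (\sum_i v i).
  apply: (big_ind3 (fun x y z => x = spinor y z)) => //.
    by rewrite /spinor raddf0 row_mx0.
  by move=> x1 y1 z1 x2 y2 z2 -> ->; rewrite spinor_add.
under eq_bigr do rewrite sumE.
rewrite sumE spinor_scale mulr0; congr spinor.
  rewrite big1// => k _; rewrite big1// => l _.
  have [->|] := eqVneq k l; last by rewrite mulr0 oppr0.
  have := wE l l => h; rewrite mulr1; lra.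
apply/rowP => q; rewrite [RHS]mxE -ht /dual7 summxE; apply: eq_bigr => k _.
rewrite summxE; apply: eq_bigr => l _; rewrite mxE mulrC; congr (_ * _).
by rewrite [RHS]sigma0_cyclic.
Qed.

(** By [spinorE] the spinor comes from the invariant one; the commutator moves the spin form past
    [clifford v] and leaves the term [v *m w]. *)
Lemma spin_form_action w t h v : w = - w^T -> (forall q, dual7 w q = 2%:R * t 0 q) ->
  4^-1 *: (spinor h v *m spin_form w) =
  spinor (- 2^-1 * (t *m v^T) 0 0) (2^-1 *: (h *: t + t *m crossm v) + v *m w).
Proof.
move=> hw ht; have := spin_form_commutator v hw.
move=> /eqP; rewrite subr_eq => /eqP hc.
rewrite spinorE mulmxDl -scalemxAl -mulmxA hc mulmxDr mulmxA.
rewrite (spin_form_base hw ht) -scalemxAr -!scalemxAl !spinor_clifford !mul0mx.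
rewrite !spinor_scale !spinor_add spinor_scale; congr spinor.
  by rewrite [X in _ + (_ * - X + _)]mxE; field.
rewrite scale0r add0r scale1r addr0; apply/rowP => i.
rewrite !mxE; set x := \sum_j t 0 j * _; set z := \sum_j v 0 j * _; by field.
Qed.

End SpinConnection.

(** * Connection form and Killing equation in a smooth adapted frame *)

Section LocalGeometry.
Variable R : realType.
Local Notation E := 'rV[R]_7.
Local Notation I := 'I_7.
Local Notation s0 := (@sigma0 R).
Local Notation p0 := (@psi0 R).
Implicit Types (a b c d e j k l m n q : I) (y z : E).

Lemma psi0_swap23 a b c d : p0 a c b d = - p0 a b c d.
Proof. by_components. Qed.

Lemma psi0_swap34 a b c d : p0 a b d c = - p0 a b c d.
Proof. by_components. Qed.

Lemma pull3_sigma0_swap12 (A : 'M[R]_7) a b c : pull3 A s0 b a c = - pull3 A s0 a b c.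
Proof.
rewrite !pull3_slots /slots3 -sumrN (reindex_inj (h := fun x : I * I * I =>
  (x.1.2, x.1.1, x.2))); last by move=> [[x y] z] [[x' y'] z'] [-> -> ->].
by apply: eq_bigr => x _ /=; rewrite (sigma0_swap12 R x.1.1); ring.
Qed.

Lemma pull3_sigma0_swap23 (A : 'M[R]_7) a b c : pull3 A s0 a c b = - pull3 A s0 a b c.
Proof.
rewrite !pull3_slots /slots3 -sumrN (reindex_inj (h := fun x : I * I * I =>
  (x.1.1, x.2, x.1.2))); last by move=> [[x y] z] [[x' y'] z'] [-> -> ->].
by apply: eq_bigr => x _ /=; rewrite (sigma0_swap23 R x.1.1); ring.
Qed.

Lemma pull4_opp (A : 'M[R]_7) (r r' : tensor4 R) a b c d :
  (forall a b c d, r' a b c d = - r a b c d) -> pull4 A r' a b c d = - pull4 A r a b c d.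
Proof.
move=> h; rewrite !pull4_slots /slots4 -sumrN; apply: eq_bigr => x _.
by rewrite h mulrN.
Qed.

Lemma alt4B (A B C : I -> tensor3 R) :
  (forall a b c d, A a b c d = B a b c d - C a b c d) ->
  forall a b c d, alt4 A a b c d = alt4 B a b c d - alt4 C a b c d.
Proof. by move=> h a b c d; rewrite /alt4 !h; ring. Qed.

Lemma alt5B (x : R) (A B C : I -> tensor4 R) :
  (forall a b c d e, A a b c d e = x * (B a b c d e - C a b c d e)) ->
  forall a b c d e, alt5 A a b c d e = x * (alt5 B a b c d e - alt5 C a b c d e).
Proof. by move=> h a b c d e; rewrite /alt5 !h; ring. Qed.

Variables (G T F : E -> 'M[R]_7) (U : set E) (sg : E -> tensor3 R).
Hypothesis (oU : open U) (sF : smooth_on U F) (sT : smooth_on U T).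
Hypothesis frame_coframe : forall z, U z -> F z *m T z = 1%:M.
Hypothesis metric_coframe : forall z, U z -> G z = T z *m (T z)^T.
Hypothesis metric_sym : forall z b c, G z b c = G z c b.
Hypothesis sgE : forall z, U z -> sg z = pull3 (T z) s0.
Hypothesis sg_np : forall z, U z -> forall a b c d,
  ext_deriv sg z a b c d = 4%:R * pull4 (T z) p0 a b c d.

Lemma coframe_frame z : U z -> T z *m F z = 1%:M.
Proof. by move=> Uz; apply/mulmx1C/frame_coframe. Qed.

Lemma smooth_metric : smooth_on U G.
Proof.
apply: (smooth_ext oU (fun z Uz => esym (metric_coframe Uz))).
exact: smooth_mulmx oU sT (smooth_tr oU sT).
Qed.

Definition Gamma a y : 'M[R]_7 := \matrix_(b, c) christoffel G c a b y.

(** Row [k] lists the components, in the frame itself, of the covariant derivative of [e_k] along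
    [d_a]. *)
Definition connection_form a y : 'M[R]_7 :=
  (partial a F y + F y *m Gamma a y) *m T y.

Lemma metric_sym_fun b c : (fun z => G z b c : R^o) = (fun z => G z c b : R^o).
Proof. by apply/funext => z; apply: metric_sym. Qed.

Lemma christoffel_sym c a b y : christoffel G c a b y = christoffel G c b a y.
Proof.
rewrite /christoffel; congr (2^-1 * _); apply: eq_bigr => d _.
by rewrite (metric_sym_fun a b) [X in _ * (X - _)]addrC.
Qed.

Lemma Gamma_sym a b c y : Gamma a y b c = Gamma b y a c.
Proof. by rewrite !mxE christoffel_sym. Qed.

Variable y : E.
Hypothesis Uy : U y.

Lemma metric_unit : G y \in unitmx.
Proof.
rewrite metric_coframe// unitmx_mul unitmx_tr andbb.
by case: (mulmx1_unit (frame_coframe Uy)).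
Qed.

Lemma partial_metric a b c :
  partial a (fun z => G z b c : R^o) y = partial a G y b c.
Proof. by rewrite partial_mx//; apply: smooth_differentiable smooth_metric Uy. Qed.

Lemma partial_metric_sym a b c : partial a G y b c = partial a G y c b.
Proof.
by rewrite -!partial_metric metric_sym_fun.
Qed.

Lemma Gamma_metric a b e : (Gamma a y *m G y) b e = 2^-1 *
  (partial a G y b e + partial b G y a e - partial e G y a b).
Proof.
pose v d : R := partial a G y b d + partial b G y a d - partial d G y a b.
rewrite mxE; transitivity (2^-1 * \sum_d v d * (invmx (G y) *m G y) d e); last first.
  rewrite mulVmx ?metric_unit//; congr (_ * _).
  rewrite -[RHS](sum_delta' v e).
  by apply: eq_bigr => d _; rewrite mxE mulrC.
transitivity (\sum_c \sum_d 2^-1 * (v d * (invmx (G y) d c * G y c e))).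
  apply: eq_bigr => c _; rewrite mxE /christoffel -mulrA mulr_suml mulr_sumr.
  apply: eq_bigr => d _; rewrite !partial_metric -/(v d); congr (_ * _).
  rewrite [RHS]mulrCA mulrA; congr (_ * _ * _).
  have Gt : (G y)^T = G y by apply/matrixP => i j; rewrite mxE metric_sym.
  by have /matrixP/(_ d c) := trmx_inv (G y); rewrite Gt mxE.
rewrite exchange_big mulr_sumr; apply: eq_bigr => d _ /=.
by rewrite mxE !mulr_sumr.
Qed.

Lemma metric_compat a : partial a G y = Gamma a y *m G y + (Gamma a y *m G y)^T.
Proof.
apply/matrixP => b e; rewrite [RHS]mxE [X in _ + X]mxE !Gamma_metric.
have [D hD] : exists D : I -> 'M[R]_7, forall a, partial a G y = D a.
  by exists (fun a => partial a G y).
by have := partial_metric_sym a e b; rewrite !hD => ->; field.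
Qed.

(** Obtained by differentiating [F T = 1]; this is the form of the derivative that [slots3_leibniz]
    and [slots4_leibniz] take. *)
Lemma partial_coframe a :
  partial a T y = Gamma a y *m T y - T y *m connection_form a y.
Proof.
have : partial a (fun z => F z *m T z) y = 0.
  by rewrite (partial_ext a oU frame_coframe Uy) /partial derive_cst.
rewrite (partial_mulmx a oU Uy sF sT) => h.
have {}h : partial a T y = - (T y *m (partial a F y *m T y)).
  apply/eqP; rewrite -addr_eq0 addrC -[partial a T y]mul1mx -(coframe_frame Uy) -mulmxA.
  by rewrite -mulmxDr h mulmx0.
rewrite h /connection_form mulmxDl mulmxDr opprD addrCA.
by rewrite -(mulmxA (F y)) [X in _ + (_ - X)]mulmxA (coframe_frame Uy) mul1mx subrr addr0.
Qed.

(** Differentiate [G = T T^T] and compare with metric compatibility: all Christoffel terms cancel,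
    leaving [T (w + w^T) T^T = 0] with [T] invertible. *)
Lemma connection_form_skew a : connection_form a y = - (connection_form a y)^T.
Proof.
set w := connection_form a y; have := metric_compat a.
have -> : partial a G y = partial a (fun z => T z *m (T z)^T) y.
  exact: partial_ext oU metric_coframe Uy.
rewrite (partial_mulmx a oU Uy sT (smooth_tr oU sT)).
rewrite (partial_trmx a oU Uy sT) partial_coframe -/w metric_coframe//.
set t := T y; set g := Gamma a y => h.
have {}h : t *m (w + w^T) *m t^T = 0.
  have aux (V : zmodType) (x1 x2 x3 x4 : V) : x1 - x2 + (x3 - x4) = x1 + x3 -> x2 + x4 = 0.
    by rewrite addrACA -opprD => /eqP; rewrite -{2}[x1 + x3]subr0 => /eqP /addrI /oppr_inj.
  rewrite mulmxDr mulmxDl; apply: (aux _ (g *m t *m t^T) _ (t *m t^T *m g^T)).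
  by move: h; rewrite linearB /= !trmx_mul trmxK mulmxBl mulmxBr !mulmxA.
have {}h : w + w^T = 0.
  have := congr1 (fun X => F y *m X *m (F y)^T) h.
  rewrite !mulmxA frame_coframe// mul1mx -!mulmxA -trmx_mul frame_coframe//.
  by rewrite trmx1 mulmx1 mul0mx mulmx0.
by apply/eqP; rewrite -addr_eq0 h.
Qed.

Lemma nabla_frameE a k : nabla_frame G F a k y = row k (partial a F y + F y *m Gamma a y).
Proof.
apply/rowP => c; rewrite !mxE partial_mx; last exact: smooth_differentiable sF Uy.
by congr (_ + _); apply: eq_bigr => b _; rewrite mxE mulrC.
Qed.

Lemma inner_nabla_frame a k l :
  inner (G y) (nabla_frame G F a k y) (row l (F y)) = connection_form a y k l.
Proof.
have hl : row l (F y) *m T y = delta_mx 0 l by rewrite -row_mul frame_coframe// row1.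
rewrite /inner nabla_frameE metric_coframe// mulmxA -mulmxA -trmx_mul hl -row_mul mxE.
rewrite -[RHS](sum_delta' (fun j => connection_form a y k j)).
by apply: eq_bigr => j _; rewrite !mxE eqxx /= mulrC.
Qed.

Local Notation w a := (connection_form a y).
Local Notation Gam a := (Gamma a y).

(** The connection form along the frame vector [e_j] instead of [d_a], so that all indices refer to
    the frame and the torsion algebra applies. *)
Definition frame_form j : 'M[R]_7 := \sum_a F y j a *: w a.

Lemma w_skew a k l : w a k l = - w a l k.
Proof.
have /matrixP/(_ k l) := connection_form_skew a.
by rewrite [X in _ = X -> _]mxE [X in _ = - X -> _]mxE.
Qed.

Lemma frame_form_skew j k l : frame_form j k l = - frame_form j l k.
Proof.
rewrite /frame_form !summxE -sumrN; apply: eq_bigr => a _.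
by rewrite [LHS]mxE [X in - X]mxE w_skew mulrN.
Qed.

Lemma coframe_frame_sum a c : \sum_j T y a j * F y j c = (a == c)%:R.
Proof.
have /matrixP/(_ a c) : T y *m F y = 1%:M by apply/mulmx1C/frame_coframe.
by rewrite !mxE.
Qed.

Lemma connection_frame a k l : w a k l = \sum_j T y a j * frame_form j k l.
Proof.
transitivity (\sum_c (\sum_j T y a j * F y j c) * w c k l).
  rewrite -[LHS](sum_delta (fun c => w c k l)).
  by apply: eq_bigr => c _; rewrite coframe_frame_sum.
under eq_bigr do rewrite mulr_suml; rewrite exchange_big; apply: eq_bigr => j _.
rewrite /frame_form summxE mulr_sumr; apply: eq_bigr => c _.
by rewrite [X in _ = _ * X]mxE mulrA.
Qed.

Lemma partial_sg a b c d : partial a (fun z => sg z b c d : R^o) y =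
  act3 (Gam a) (sg y) b c d - pull3 (T y) (act3 (w a) s0) b c d.
Proof.
rewrite sgE// -(slots3_leibniz _ _ _ _ (partial_coframe a)) -(partial_pull3 s0 a b c d oU sT Uy).
by apply: (partial_ext a oU _ Uy) => z Uz; rewrite sgE.
Qed.

Lemma act3_connection a k l m :
  act3 (w a) s0 k l m = \sum_j T y a j * act3 (frame_form j) s0 k l m.
Proof.
rewrite /act3; under [RHS]eq_bigr do rewrite mulr_sumr.
rewrite exchange_big; apply: eq_bigr => b _; rewrite !connection_frame !mulr_suml -!big_split.
by apply: eq_bigr => j _ /=; ring.
Qed.

Lemma act4_connection a k l m n :
  act4 (w a) p0 k l m n = \sum_j T y a j * act4 (frame_form j) p0 k l m n.
Proof.
rewrite /act4; under [RHS]eq_bigr do rewrite mulr_sumr.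
rewrite exchange_big; apply: eq_bigr => b _; rewrite !connection_frame !mulr_suml -!big_split.
by apply: eq_bigr => j _ /=; ring.
Qed.

Lemma coframe_unit : T y \in unitmx.
Proof. by case: (mulmx1_unit (frame_coframe Uy)). Qed.

(** The nearly parallel equation in frame components. The derivative of sigma is a Christoffel term,
    which alternation kills, minus the action of the connection form. *)
Lemma frame_alt4 j k l m :
  alt4 (fun j => act3 (frame_form j) s0) j k l m = - (4%:R * p0 j k l m).
Proof.
have : pull4 (T y) (fun a b c d => - alt4 (fun j => act3 (frame_form j) s0) a b c d) =
       pull4 (T y) (fun a b c d => 4%:R * p0 a b c d).
  apply/funext => a; apply/funext => b; apply/funext => c; apply/funext => d.
  have -> : pull4 (T y) (fun a b c d => 4%:R * p0 a b c d) a b c d =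
      4%:R * pull4 (T y) p0 a b c d.
    by rewrite !pull4_slots /slots4 mulr_sumr; apply: eq_bigr => x _; ring.
  rewrite -sg_np// -[RHS]/(alt4 (fun a b c d => partial a (fun z => sg z b c d : R^o) y) a b c d).
  rewrite (@pull4_opp (T y) (alt4 (fun j => act3 (frame_form j) s0)))// -pull4_alt4.
  have -> : alt4 (fun a b c d => partial a (fun z => sg z b c d : R^o) y) a b c d =
     alt4 (fun a => act3 (Gam a) (sg y)) a b c d
     - alt4 (fun a => pull3 (T y) (act3 (w a) s0)) a b c d.
    apply: (alt4B (B := fun a => act3 (Gam a) (sg y))
      (C := fun a => pull3 (T y) (act3 (w a) s0))) => *; exact: partial_sg.
  rewrite alt4_symmetric ?sub0r; last 3 first.
  - by move=> *; apply: Gamma_sym.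
  - by move=> *; rewrite sgE// pull3_sigma0_swap12.
  - by move=> *; rewrite sgE// pull3_sigma0_swap23.
  congr (- _); have E a' b' c' d' : pull4 (T y) (fun j => act3 (frame_form j) s0) a' b' c' d' =
      pull3 (T y) (act3 (w a') s0) b' c' d'.
    rewrite pull3_slots /slots3; under [RHS]eq_bigr do rewrite act3_connection mulr_sumr.
    rewrite exchange_big; rewrite /pull4; apply: eq_bigr => j' _; rewrite pair3_big.
    by apply: eq_bigr => x _; ring.
  by rewrite /alt4 !E.
move/(pull4_eq coframe_unit) => /(congr1 (fun f => f j k l m)) <-.
by rewrite opprK.
Qed.

(** The same computation for the dual 4-form: it is closed because 4 times it is exact. *)
Lemma frame_alt5 j k l m n :
  alt5 (fun j => act4 (frame_form j) p0) j k l m n = 0.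
Proof.
move: j k l m n; apply: (slots5_eq0 coframe_unit) => a b c d e.
pose q z := pull4 (T z) p0.
have ss a' b' c' : smooth_on U (fun z => sg z a' b' c' : R^o).
  apply: (smooth_ext oU _ (smooth_pull3 s0 a' b' c' oU sT)) => z Uz.
  by rewrite sgE.
have h5 := alt5_ext_deriv oU Uy ss a b c d e.
have pE a' b' c' d' e' : partial a' (fun z => ext_deriv sg z b' c' d' e' : R^o) y =
    4%:R * (act4 (Gam a') (q y) b' c' d' e' - pull4 (T y) (act4 (w a') p0) b' c' d' e').
  rewrite -(slots4_leibniz _ _ _ _ _ (partial_coframe a')) -(partial_pull4 p0 a' b' c' d' e' oU sT Uy).
  rewrite mulrC -(partial_mulr _ a' Uy); last exact: smooth_pull4.
  apply: (partial_ext a' oU _ Uy) => z Uz; rewrite sg_np//.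
  by rewrite mulrC.
have {}h5 : alt5 (fun a => act4 (Gam a) (q y)) a b c d e -
    alt5 (fun a => pull4 (T y) (act4 (w a) p0)) a b c d e = 0.
  apply: (mulfI (x := 4%:R)); first by rewrite pnatr_eq0.
  by rewrite mulr0 -[RHS]h5 -(alt5B (A := fun a b c d e =>
    partial a (fun z => ext_deriv sg z b c d e : R^o) y)).
move: h5; rewrite alt5_symmetric ?sub0r; last 4 first.
- by move=> *; apply: Gamma_sym.
- by move=> *; rewrite /q pull4_swap12; apply: pull4_opp => *; apply: psi0_swap.
- by move=> *; rewrite /q pull4_swap23; apply: pull4_opp => *; apply: psi0_swap23.
- by move=> *; rewrite /q pull4_swap34; apply: pull4_opp => *; apply: psi0_swap34.
move/eqP; rewrite oppr_eq0 => /eqP h; rewrite -slots5_alt5 -[RHS]h.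
have E a' b' c' d' e' : slots5 (T y) (fun j => act4 (frame_form j) p0) a' b' c' d' e' =
    pull4 (T y) (act4 (w a') p0) b' c' d' e'.
  rewrite slots5E -pull4_sum; congr (pull4 _ _ _ _ _ _).
  apply/funext => k; apply/funext => l; apply/funext => m; apply/funext => n.
  by rewrite act4_connection.
by rewrite /alt5 !E.
Qed.

Lemma connection_dual7 a q : dual7 (w a) q = 2%:R * T y a q.
Proof.
have h := torsion_determined (w := frame_form) frame_form_skew frame_alt4 frame_alt5.
transitivity (\sum_j T y a j * dual7 (frame_form j) q).
  rewrite /dual7; under [RHS]eq_bigr do rewrite mulr_sumr.
  rewrite [RHS]exchange_big; apply: eq_bigr => b _.
  under [RHS]eq_bigr do rewrite mulr_sumr.
  rewrite [RHS]exchange_big; apply: eq_bigr => c _.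
  rewrite connection_frame mulr_sumr; apply: eq_bigr => j _; ring.
under eq_bigr do rewrite h.
rewrite -[T y a q](sum_delta' (fun j => T y a j)) mulr_sumr.
by apply: eq_bigr => j _; ring.
Qed.

Local Notation t a := (row a (T y)).

Lemma w_tr a : w a = - (w a)^T.
Proof. exact: connection_form_skew. Qed.

Lemma w_dual a q : dual7 (w a) q = 2%:R * t a 0 q.
Proof.
rewrite [X in _ = _ * X]mxE.
exact: connection_dual7.
Qed.

Lemma nabla_spinorE (ph : E -> 'rV[R]_(1 + 7)) a :
  nabla_spinor G F (ph : E -> 'rV[R]_8) a y =
  partial a ph y + 4^-1 *: (ph y *m spin_form (w a)).
Proof.
rewrite /nabla_spinor; congr (_ + _ *: _); rewrite /spin_form mulmx_sumr.
apply: eq_bigr => k _; rewrite mulmx_sumr; apply: eq_bigr => l _.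
rewrite inner_nabla_frame -scalemxAr.
by rewrite mulmxA.
Qed.

Variables (h : E -> R^o) (f : E -> E).
Hypothesis (sh : smooth_on U h) (sf : smooth_on U f).
Let v z := f z *m (F z)^T.

Lemma smooth_v : smooth_on U v.
Proof. exact: smooth_mulmx oU sf (smooth_tr oU sF). Qed.

Lemma smooth_spinor (g : E -> R^o) (u : E -> E) : smooth_on U g -> smooth_on U u ->
  smooth_on U (fun z => spinor (g z) (u z)).
Proof.
move=> sg' su; apply: smooth_mx => // i j; rewrite /spinor.
under eq_fun do rewrite mxE; case: (fintype.split j) => k.
  by under eq_fun do rewrite mxE !ord1 eqxx mulr1n.
exact: smooth_entry.
Qed.

Lemma partial_spinor (g : E -> R^o) (u : E -> E) a : smooth_on U g -> smooth_on U u ->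
  partial a (fun z => spinor (g z) (u z)) y = spinor (partial a g y) (partial a u y).
Proof.
move=> sg' su; apply/matrixP => i j.
rewrite partial_mx; last exact: smooth_differentiable (smooth_spinor sg' su) Uy.
rewrite /spinor; under eq_fun do rewrite mxE; rewrite [RHS]mxE; case: (fintype.split j) => k.
  under eq_fun do rewrite mxE; rewrite [RHS]mxE !ord1 eqxx mulr1n.
  by under eq_fun do rewrite mulr1n.
by rewrite !ord1 partial_mx//; apply: smooth_differentiable su Uy.
Qed.

Lemma nabla_formE a b : nabla_form G f a b y =
  (partial a f y - f y *m (Gam a)^T) 0 b.
Proof.
rewrite !mxE /nabla_form partial_mx; last exact: smooth_differentiable sf Uy.
by congr (_ - _); apply: eq_bigr => c _; rewrite !mxE mulrC.
Qed.

Lemma coframe_frame_tr : (F y)^T *m (T y)^T = 1%:M.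
Proof. by rewrite -trmx_mul (mulmx1C (frame_coframe Uy)) trmx1. Qed.

Lemma partial_v a : partial a v y + v y *m w a = (partial a f y - f y *m (Gam a)^T) *m (F y)^T.
Proof.
rewrite /v (partial_mulmx a oU Uy sf (smooth_tr oU sF)) (partial_trmx a oU Uy sF).
rewrite w_tr /connection_form mulmxN trmx_mul.
rewrite -(mulmxA (f y)) (mulmxA (F y)^T) coframe_frame_tr mul1mx.
by rewrite linearD /= trmx_mul mulmxDr mulmxBl -(mulmxA (f y)) opprD addrA addrK.
Qed.

(** The connection contributes [(h t + t x v) / 2] up to the term [v w], and Clifford multiplication
    with constant 1/2 gives [(h t + v x t) / 2], in the sense of [crossm]. The [h] terms cancel and
    the cross products, being skew, add up. The inner products in the scalar parts agree, which
    leaves dh = 0. *)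
Lemma killing_equation a :
  nabla_spinor G F (fun z => spinor (h z) (v z) : 'rV[R]_8) a y
    = 2^-1 *: (spinor (h y) (v y) *m clifford (t a)) <->
  partial a h y = 0 /\
  (partial a f y - f y *m (Gam a)^T) *m (F y)^T = v y *m crossm (t a).
Proof.
rewrite (nabla_spinorE (fun z => spinor (h z) (v z))) (partial_spinor _ sh smooth_v).
rewrite (spin_form_action _ _ (w_tr a) (w_dual a)) spinor_clifford spinor_scale spinor_add.
have ip : (t a *m (v y)^T) 0 0 = (v y *m (t a)^T) 0 0.
  by rewrite !mxE; apply: eq_bigr => i _; rewrite !mxE mulrC.
have half u : 2^-1 *: u + 2^-1 *: u = u :> 'rV[R]_7.
  by rewrite -scalerDl (_ : 2^-1 + 2^-1 = 1) ?scale1r//; field.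
rewrite -partial_v ip mulNr mulrN; split.
  move=> /spinor_inj[h1 h2]; split; first by move/eqP: h1; rewrite -subr_eq0 opprK subrK => /eqP.
  move/eqP: h2; rewrite addrCA !scalerDr -addrA => /eqP /addrI.
  by rewrite (mul_crossmC (t a)) scalerN => /eqP; rewrite addrC subr_eq half => /eqP.
move=> [-> h2]; congr spinor; first by rewrite add0r.
rewrite addrCA h2 !scalerDr -addrA; congr (_ + _).
by rewrite (mul_crossmC (t a)) scalerN -{2}(half (v y *m crossm (t a))) addKr.
Qed.

Lemma sharp_contract a b :
  \sum_(c < 7) (f y *m invmx (G y)) 0 c * sg y c a b =
  - (v y *m crossm (t a) *m (T y)^T) 0 b.
Proof.
have -> : invmx (G y) = (F y)^T *m F y.
  by rewrite metric_coframe// (coframe_metric_inv (frame_coframe Uy)).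
rewrite mulmxA -/(v y) sgE//.
transitivity (\sum_c (v y *m F y) 0 c * (\sum_(x : I * I * I)
   T y c x.1.1 * T y a x.1.2 * T y b x.2 * s0 x.1.1 x.1.2 x.2)).
  by apply: eq_bigr => c _; rewrite pull3_slots.
transitivity (\sum_(x : I * I * I) v y 0 x.1.1 * T y a x.1.2 * T y b x.2 * s0 x.1.1 x.1.2 x.2).
  under eq_bigr do rewrite mulr_sumr.
  rewrite exchange_big; apply: eq_bigr => x _.
  have -> : v y 0 x.1.1 = \sum_c (v y *m F y) 0 c * T y c x.1.1.
    have /rowP/(_ x.1.1) : v y *m F y *m T y = v y by rewrite -mulmxA frame_coframe// mulmx1.
    by rewrite mxE => <-.
  by rewrite !mulr_suml; apply: eq_bigr => c _; ring.
rewrite -(pair3_big (fun j i k => v y 0 j * T y a i * T y b k * s0 j i k)).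
rewrite mxE -sumrN.
transitivity (\sum_k \sum_j \sum_i v y 0 j * T y a i * T y b k * s0 j i k).
  rewrite [RHS]exchange_big; apply: eq_bigr => j _; rewrite exchange_big.
  by apply: eq_bigr => i _.
apply: eq_bigr => k _; rewrite mul_crossmE mulr_suml -sumrN; apply: eq_bigr => j _.
rewrite mulr_suml -sumrN; apply: eq_bigr => i _.
by rewrite !mxE (sigma0_swap12 R i j); ring.
Qed.

Lemma killing_iff : (forall a,
  nabla_spinor G F (fun z => spinor (h z) (v z) : 'rV[R]_8) a y
    = 2^-1 *: (spinor (h y) (v y) *m clifford (t a))) <->
  (forall a, partial a h y = 0) /\
  (forall a b, nabla_form G f a b y =
     - (4^-1 * 4%:R) * \sum_(c < 7) (f y *m invmx (G y)) 0 c * sg y c a b).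
Proof.
(* The factor [tau0 / 4] for [tau0 = 4]. *)
have c1 : 4^-1 * 4%:R = 1 :> R by rewrite mulVf// pnatr_eq0.
have key a : (partial a f y - f y *m (Gam a)^T) *m (F y)^T = v y *m crossm (t a) <->
    forall b, nabla_form G f a b y =
     - (4^-1 * 4%:R) * \sum_(c < 7) (f y *m invmx (G y)) 0 c * sg y c a b.
  split=> [e b|e].
    rewrite sharp_contract c1 mulN1r opprK -e -mulmxA coframe_frame_tr mulmx1.
    exact: nabla_formE.
  have {}e : partial a f y - f y *m (Gam a)^T = v y *m crossm (t a) *m (T y)^T.
    by apply/rowP => b; rewrite -nabla_formE e sharp_contract c1 mulN1r opprK.
  by rewrite e -(mulmxA (v y *m crossm (t a))) -trmx_mul frame_coframe// trmx1 mulmx1.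
split=> [e|[e1 e2] a].
  by split=> a; have /killing_equation[e1 e2] := e a; [exact: e1 | exact/key].
by apply/killing_equation; split => //; apply/key.
Qed.

End LocalGeometry.

(** * Smooth adapted frames *)

Section FrameAlgebra.
Variable R : realType.
Local Notation E := 'rV[R]_7.
Local Notation I := 'I_7.
Local Notation s0 := (@sigma0 R).
Local Notation o n := (@Ordinal 7 n isT).
Local Notation e i := (delta_mx 0 i : 'rV[R]_7).
Implicit Types (t : tensor3 R) (u v x y z w : E) (F : 'M[R]_7) (a b c : I).

Lemma mx11_1 (B : 'M[R]_1) : B 0 0 = 1 -> B = 1%:M.
Proof. by move=> h; rewrite [B]mx11_scalar h. Qed.

Lemma mx11_0 (B : 'M[R]_1) : B 0 0 = 0 -> B = 0.
Proof. by move=> h; rewrite [B]mx11_scalar h raddf0. Qed.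

Definition ip t u v : R := (u *m metric_of t *m v^T) 0 0.

(** Written with the tensor and its metric only, so that its smoothness does not presuppose a smooth
    frame. *)
Definition cross t u v : E :=
  (\row_l \sum_i \sum_j u 0 i * v 0 j * t i j l) *m invmx (metric_of t).

Lemma ip_frame t F u v : adapted_frame t F ->
  ip t u v = ((u *m invmx F) *m (v *m invmx F)^T) 0 0.
Proof. by move=> hF; rewrite /ip (metric_ofE hF) trmx_mul !mulmxA. Qed.

Lemma cross_frame t F u v : adapted_frame t F ->
  cross t u v = (v *m invmx F) *m crossm (u *m invmx F) *m F.
Proof.
move=> hF; rewrite /cross (metric_inv hF) mulmxA; congr (_ *m F).
apply/rowP => m; rewrite mul_crossmE.
transitivity (triple t u v (row m F)).
  rewrite /triple mxE; under eq_bigr do rewrite mxE mulr_suml.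
  rewrite exchange_big; apply: eq_bigr => i _ /=.
  under eq_bigr do rewrite mulr_suml; rewrite exchange_big; apply: eq_bigr => j _ /=.
  by apply: eq_bigr => l _; rewrite !mxE; ring.
rewrite {1}(adapted_coframe hF) triple_pull3.
have -> : row m F *m invmx F = e m.
  by rewrite -row_mul mulmxV ?row1//; apply: adapted_unit hF.
rewrite /triple [RHS]exchange_big; apply: eq_bigr => i _ /=; apply: eq_bigr => j _.
rewrite -(sum_delta' (fun k => _ * _ * s0 i j k) m) [LHS](_ : _ = \sum_k (k == m)%:R *
  ((v *m invmx F) 0 j * (u *m invmx F) 0 i * s0 i j k)) //.
by apply: eq_bigr => k _; rewrite [X in _ * X * _]mxE /=; ring.
Qed.

Lemma crossm_axes a b : e b *m crossm (e a) = \row_m s0 a b m.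
Proof.
apply/rowP => m; rewrite mul_crossmE [RHS]mxE.
transitivity (\sum_j (j == b)%:R * (\sum_i (i == a)%:R * s0 i j m)).
  apply: eq_bigr => j _; rewrite mulr_sumr; apply: eq_bigr => i _.
  by rewrite !mxE /= mulrA.
by rewrite !sum_delta'.
Qed.

Lemma adapted_cross t F a b c : adapted_frame t F -> s0 a b c = 1 ->
  cross t (row a F) (row b F) = row c F.
Proof.
move=> hF h; have uF := adapted_unit hF.
have rE k : row k F *m invmx F = e k by rewrite -row_mul mulmxV// row1.
rewrite (cross_frame _ _ hF) !rE crossm_axes rowE; congr (_ *m F).
apply/rowP => m; rewrite !mxE (sigma0_third (c := c)) ?h ?oner_eq0//.
by rewrite mul1r.
Qed.

Lemma ip_sym t u v : ip t u v = ip t v u.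
Proof.
rewrite /ip; have tr11 (B : 'M[R]_1) : B 0 0 = B^T 0 0 by rewrite mxE.
by rewrite tr11 !trmx_mul trmxK mulmxA trmxK.
Qed.

Lemma ip_subl t u v w : ip t (u - v) w = ip t u w - ip t v w.
Proof. by rewrite /ip !mulmxBl !mxE. Qed.

Lemma ip_scalel t (k : R) u v : ip t (k *: u) v = k * ip t u v.
Proof. by rewrite /ip -!scalemxAl mxE. Qed.

Definition normalize t u : E := (ip t u u `^ (- 2^-1)) *: u.

Lemma normalize_unit t u : 0 < ip t u u -> ip t (normalize t u) (normalize t u) = 1.
Proof.
move=> h; rewrite /normalize ip_scalel ip_sym ip_scalel mulrA -powRD; last first.
  by apply/implyP => _; rewrite gt_eqF.
have -> : - 2^-1 + - 2^-1 = -1 :> R by field.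
by rewrite powR_inv1 ?ltW// mulVf// gt_eqF.
Qed.

Lemma normalize_orth t u v : ip t u v = 0 -> ip t (normalize t u) v = 0.
Proof. by move=> h; rewrite ip_scalel h mulr0. Qed.

Lemma crossm_norm x y : x *m x^T = 1%:M -> y *m y^T = 1%:M -> x *m y^T = 0 ->
  (y *m crossm x) *m (y *m crossm x)^T = 1%:M.
Proof.
move=> xx yy xy; rewrite trmx_mul crossm_tr mulNmx mulmxN mulmxA -(mulmxA y).
have := crossm_anticommute x x; rewrite -!mulr2n -[_ *+ 2](scaler_nat 2) => h.
have {}h : crossm x *m crossm x = x^T *m x - 1%:M.
  apply: (scalerI (a := 2%:R)); first by rewrite pnatr_eq0.
  by rewrite h scalerBr xx mxE eqxx mulr1 scalemx1 -scaler_nat.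
by rewrite h mulmxBr mulmxBl mulmx1 yy mulmxA -(mulmxA (y *m x^T)) xy mulmx0 sub0r opprK.
Qed.

Lemma cross_self x y : x *m (y *m crossm x)^T = 0.
Proof.
rewrite trmx_mul crossm_tr mulNmx mulmxN mulmxA mul_crossmC.
have : x *m crossm x = 0.
  apply: (@scalerI _ _ 2%:R); first by rewrite pnatr_eq0.
  by rewrite scaler_nat mulr2n {1}mul_crossmC addNr scaler0.
by move=> ->; rewrite mulNmx mul0mx oppr0 oppr0.
Qed.

Lemma tripleE x y z : triple s0 x y z = ((y *m crossm x) *m z^T) 0 0.
Proof.
rewrite mxE; under [RHS]eq_bigr do rewrite mul_crossmE mulr_suml.
rewrite [RHS]exchange_big /triple [LHS]exchange_big; apply: eq_bigr => j _ /=.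
under [RHS]eq_bigr do rewrite mulr_suml.
rewrite [RHS]exchange_big; apply: eq_bigr => i _ /=.
by apply: eq_bigr => k _; rewrite !mxE; ring.
Qed.

(** The vectors stand at the places 0, 1 and 3; the lines {0,1,2}, {0,3,4}, {1,3,5}, {2,3,6}, on
    which [sigma0] is 1, dictate the rest. *)
Definition frame_rows t u v w : 'M[R]_7 := \matrix_(i < 7) nth 0
  [:: u; v; cross t u v; w; cross t u w; cross t v w; cross t (cross t u v) w] i.

(** In the frame [F] the three vectors form a basic triple, which some [q] in G_2 takes to the axes.
    So [invmx q *m F] is adapted and contains them, and cross products determine its other rows. *)
Lemma frame_rows_adapted t F u v w : adapted_frame t F ->
  ip t u u = 1 -> ip t v v = 1 -> ip t w w = 1 -> ip t u v = 0 -> ip t u w = 0 ->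
  ip t v w = 0 -> ip t (cross t u v) w = 0 -> adapted_frame t (frame_rows t u v w).
Proof.
move=> hF; rewrite !(ip_frame _ _ hF) => uu vv ww uv uw vw cw.
have uF := adapted_unit hF.
have tr0 : triple s0 (u *m invmx F) (v *m invmx F) (w *m invmx F) = 0.
  by move: cw; rewrite (cross_frame _ _ hF) mulmxK// tripleE.
have [q sq [h0 h1 h3]] := basic_triple (mx11_1 uu) (mx11_1 vv) (mx11_1 ww) (mx11_0 uv)
  (mx11_0 uw) (mx11_0 vw) tr0.
have hq := square_product_G2 sq; have uq : q \in unitmx by case: hq.
have hF' : adapted_frame t (invmx q *m F).
  have [_ hi] := G2_inv hq; split; first by rewrite unitmx_mul unitmx_inv uq.
  by rewrite -pull3_comp; case: hF => _ ->.
have rowE' (x : E) k : x *m invmx F *m q = e k -> row k (invmx q *m F) = x.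
  by rewrite row_mul rowE => <-; rewrite mulmxK// mulmxKV.
have r0 := rowE' _ _ h0; have r1 := rowE' _ _ h1; have r3 := rowE' _ _ h3.
have sg a b c : zsigma a b c = BinInt.Z.of_nat 1 -> s0 a b c = 1.
  by move=> h; rewrite reified_sigma0 h.
have r2 := adapted_cross hF' (sg (o 0) (o 1) (o 2) erefl).
have r4 := adapted_cross hF' (sg (o 0) (o 3) (o 4) erefl).
have r5 := adapted_cross hF' (sg (o 1) (o 3) (o 5) erefl).
have r6 := adapted_cross hF' (sg (o 2) (o 3) (o 6) erefl).
rewrite (_ : frame_rows t u v w = invmx q *m F)//.
apply/row_matrixP => i; rewrite rowK.
rewrite -r2 r0 r1 in r6; rewrite r0 r1 in r2; rewrite r0 r3 in r4.
rewrite r1 r3 in r5; rewrite r3 in r6.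
case: i => i hi; do 7 (case: i hi => [|i] hi /=; first by
  rewrite (bool_irrelevance hi isT) ?r0 ?r1 -?r2 ?r3 -?r4 -?r5 -?r6).
by [].
Qed.

End FrameAlgebra.

(** * Gram-Schmidt process for adapted frames *)

Section FrameExistence.
Variable R : realType.
Local Notation E := 'rV[R]_7.
Local Notation I := 'I_7.
Local Notation o n := (@Ordinal 7 n isT).
Implicit Types (a b c : I) (z : E).
Variables (sg : E -> tensor3 R) (W : set E).
Hypothesis oW : open W.
Hypothesis sg_smooth : forall a b c, smooth_on W (fun z => sg z a b c : R^o).
Hypothesis star_smooth : forall a b c d, smooth_on W (fun z => star_of (sg z) a b c d : R^o).
Hypothesis frame_ex : forall z, W z -> exists F, adapted_frame (sg z) F.

(* [sg /\ *sg] is a multiple of the volume form: it makes the determinant of a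
   coframe a smooth function before any smooth coframe is available. *)
Definition det_coframe z : R := eps34 (sg z) (star_of (sg z)) / 1008%:R.

Lemma det_coframeE z F : adapted_frame (sg z) F -> det_coframe z = \det (invmx F).
Proof.
move=> hF; rewrite /det_coframe (star_ofE hF) {1}(adapted_coframe hF) eps34_pull.
have n0 : (1008%:R : R) != 0 by rewrite pnatr_eq0.
by rewrite eps34_sigma0 (mulfK n0).
Qed.

Lemma det_coframe_neq0 z : W z -> det_coframe z != 0.
Proof.
case/frame_ex => F hF; rewrite (det_coframeE hF) det_inv invr_eq0 -unitfE -unitmxE.
exact: adapted_unit hF.
Qed.

Lemma smooth_det_coframe : smooth_on W (det_coframe : E -> R^o).
Proof.
apply: smooth_mul => //; last exact: smooth_cst.
do 3 (apply: smooth_sum => // ?); apply: smooth_mul => //.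
do 4 (apply: smooth_sum => // ?); apply: smooth_mul => //; exact: smooth_cst.
Qed.

(** Expresses the metric by rational operations on smooth functions, although [metric_of] involves a
    choice at every point. *)
Lemma metric_bryant z : W z ->
  metric_of (sg z) = (- 144%:R * det_coframe z)^-1 *: bryant_form (sg z).
Proof.
move=> Wz; have [F hF] := frame_ex Wz; have d0 := det_coframe_neq0 Wz.
rewrite {2}(adapted_coframe hF) bryant_pull bryant_sigma0 mul_mx_scalar -scalemxAl.
rewrite !scalerA (metric_ofE hF) -(det_coframeE hF) -mulrA (mulrC _ (- _)) mulVf ?scale1r//.
by rewrite mulf_neq0// oppr_eq0 pnatr_eq0.
Qed.

Lemma smooth_metric_of : smooth_on W (fun z => metric_of (sg z)).
Proof.
apply: (smooth_ext oW (fun z Wz => esym (metric_bryant Wz))).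
apply: smooth_mx => // i j.
under eq_fun do rewrite mxE [X in _ * X]mxE.
apply: smooth_mul => //.
  apply: smooth_inv => //.
    by move=> z Wz; rewrite mulf_neq0 ?det_coframe_neq0// oppr_eq0 pnatr_eq0.
  by apply: smooth_mul smooth_det_coframe => //; apply: smooth_cst.
rewrite /eps223; do 2 (apply: smooth_sum => // ?); apply: smooth_mul => //.
do 2 (apply: smooth_sum => // ?); apply: smooth_mul => //.
by do 3 (apply: smooth_sum => // ?); apply: smooth_mul => //; apply: smooth_cst.
Qed.

Lemma metric_of_unit z : W z -> metric_of (sg z) \in unitmx.
Proof.
case/frame_ex => F hF.
by rewrite (metric_ofE hF) unitmx_mul unitmx_tr !unitmx_inv (adapted_unit hF).
Qed.

Lemma smooth_inv_metric : smooth_on W (fun z => invmx (metric_of (sg z))).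
Proof. exact: smooth_invmx oW metric_of_unit smooth_metric_of. Qed.

Section Fields.
Variable U : set E.
Hypothesis (oU : open U) (UW : U `<=` W).
Variables u v : E -> E.
Hypothesis (su : smooth_on U u) (sv : smooth_on U v).

Lemma smooth_ip : smooth_on U (fun z => ip (sg z) (u z) (v z) : R^o).
Proof.
apply: smooth_entry => //; apply: smooth_mulmx => //; last exact: smooth_tr.
by apply: smooth_mulmx => //; apply: smooth_sub UW _; apply: smooth_metric_of.
Qed.

Lemma smooth_cross : smooth_on U (fun z => cross (sg z) (u z) (v z)).
Proof.
apply: smooth_mulmx => //; last by apply: smooth_sub UW _; apply: smooth_inv_metric.
apply: smooth_mx => // i l; under eq_fun do rewrite mxE.
do 2 (apply: smooth_sum => // ?); apply: smooth_mul => //.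
  by apply: smooth_mul => //; apply: smooth_entry.
by apply: smooth_sub UW _.
Qed.

Lemma smooth_scale (k : E -> R^o) : smooth_on U k -> smooth_on U (fun z => k z *: u z).
Proof.
move=> sk; apply: smooth_mx => // i j; under eq_fun do rewrite mxE.
by apply: smooth_mul => //; apply: smooth_entry.
Qed.

Lemma smooth_normalize : (forall z, U z -> 0 < ip (sg z) (u z) (u z)) ->
  smooth_on U (fun z => ip (sg z) (u z) (u z) : R^o) ->
  smooth_on U (fun z => normalize (sg z) (u z)).
Proof. by move=> h sip; apply: smooth_scale; apply: smooth_powR. Qed.

End Fields.

Lemma smooth_subv (U : set E) (u v : E -> E) : open U -> smooth_on U u -> smooth_on U v ->
  smooth_on U (fun z => u z - v z).
Proof.
move=> oU su sv; apply: smooth_mx => // i j; under eq_fun do rewrite !mxE.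
by apply: smooth_sub_fun => //; apply: smooth_entry.
Qed.

Lemma open_positive (U : set E) (k : E -> R^o) : open U -> smooth_on U k ->
  open [set z | U z /\ 0 < k z].
Proof.
move=> oU sk; rewrite openE => z [Uz kz]; rewrite /interior.
have ck := smooth_continuous sk Uz.
have h1 : \forall x \near z, U x by apply: open_nbhs_nbhs.
have h2 : \forall x \near z, 0 < k x by apply: (cvgr_gt _ ck).
exact: filterI h1 h2.
Qed.

Lemma orthogonalize3 t (x u v c : E) :
  ip t u u = 1 -> ip t v v = 1 -> ip t c c = 1 -> ip t u v = 0 -> ip t u c = 0 ->
  ip t v c = 0 ->
  let w := x - ip t x u *: u - ip t x v *: v - ip t x c *: c in
  [/\ ip t w u = 0, ip t w v = 0 & ip t w c = 0].
Proof.
move=> uu vv cc uv uc vc w; rewrite /w !ip_subl !ip_scalel uu vv cc uv uc vc.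
rewrite (ip_sym t v u) (ip_sym t c u) (ip_sym t c v) uv uc vc.
by rewrite !mulr0 !subr0 !mulr1 !subrr.
Qed.

(** Constant vectors that form a basic triple at [y] are orthonormalized at nearby points, the third
    one also against the cross product of the first two. The domain shrinks three times, to where
    the vector about to be normalized has positive length. *)
Lemma local_frame_exists y : W y -> exists U F,
  [/\ U y, open U, U `<=` W, smooth_on U F & forall z, U z -> adapted_frame (sg z) (F z)].
Proof.
move=> Wy; have [F0 hF0] := frame_ex Wy; have uF0 := adapted_unit hF0.
pose e0 := row (o 0) F0; pose e1 := row (o 1) F0; pose e3 := row (o 3) F0.
pose N1 z := ip (sg z) e0 e0; pose u z := normalize (sg z) e0.
pose v0 z := e1 - ip (sg z) e1 (u z) *: u z.
pose N2 z := ip (sg z) (v0 z) (v0 z); pose v z := normalize (sg z) (v0 z).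
pose c z := cross (sg z) (u z) (v z).
pose w0 z := e3 - ip (sg z) e3 (u z) *: u z - ip (sg z) e3 (v z) *: v z
  - ip (sg z) e3 (c z) *: c z.
pose N3 z := ip (sg z) (w0 z) (w0 z); pose w z := normalize (sg z) (w0 z).
have sc (V : set E) (x : E) : smooth_on V (fun=> x) by apply: smooth_cst.
pose U1 := [set z | W z /\ 0 < N1 z].
have sN1 : smooth_on W (N1 : E -> R^o) by apply: smooth_ip.
have oU1 : open U1 by apply: open_positive.
have UW1 : U1 `<=` W by move=> z [].
have su : smooth_on U1 u.
  apply: smooth_normalize => // [z []//|]; exact: smooth_sub UW1 sN1.
have sv0 : smooth_on U1 v0.
  by apply: smooth_subv => //; apply: smooth_scale => //; apply: smooth_ip.
have sN2 : smooth_on U1 (N2 : E -> R^o) by apply: smooth_ip.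
pose U2 := [set z | U1 z /\ 0 < N2 z].
have oU2 : open U2 by apply: open_positive.
have U21 : U2 `<=` U1 by move=> z [].
have UW2 : U2 `<=` W by move=> z /U21/UW1.
have su2 : smooth_on U2 u := smooth_sub U21 su.
have sv : smooth_on U2 v.
  apply: smooth_normalize => // [|z []//|]; [exact: smooth_sub U21 sv0 | exact: smooth_sub U21 sN2].
have scr : smooth_on U2 c by apply: smooth_cross.
have sw0 : smooth_on U2 w0.
  do 3 (apply: smooth_subv => //; last by apply: smooth_scale => //; apply: smooth_ip).
have sN3 : smooth_on U2 (N3 : E -> R^o) by apply: smooth_ip.
pose U3 := [set z | U2 z /\ 0 < N3 z].
have oU3 : open U3 by apply: open_positive.
have U32 : U3 `<=` U2 by move=> z [].
have UW3 : U3 `<=` W by move=> z /U32/UW2.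
have su3 : smooth_on U3 u := smooth_sub U32 su2.
have sv3 : smooth_on U3 v := smooth_sub U32 sv.
have sc3 : smooth_on U3 c := smooth_sub U32 scr.
have sw : smooth_on U3 w.
  apply: smooth_normalize => // [|z []//|]; [exact: smooth_sub U32 sw0 | exact: smooth_sub U32 sN3].
have ip_self t x y' : ip t (x - ip t x y' *: y') y' = ip t x y' - ip t x y' * ip t y' y'.
  by rewrite ip_subl ip_scalel.
have adapted z : U3 z -> adapted_frame (sg z) (frame_rows (sg z) (u z) (v z) (w z)).
  move=> Uz; have Wz := UW3 z Uz; have [F hF] := frame_ex Wz.
  move: Uz => [[[_ n1] n2] n3].
  have uu : ip (sg z) (u z) (u z) = 1 by apply: normalize_unit.
  have vv : ip (sg z) (v z) (v z) = 1 by apply: normalize_unit.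
  have ww : ip (sg z) (w z) (w z) = 1 by apply: normalize_unit.
  have vu : ip (sg z) (v z) (u z) = 0.
    by apply: normalize_orth; rewrite ip_self uu mulr1 subrr.
  have uv : ip (sg z) (u z) (v z) = 0 by rewrite ip_sym.
  have uF := adapted_unit hF.
  have cc : ip (sg z) (c z) (c z) = 1.
    rewrite /c (ip_frame _ _ hF) (cross_frame _ _ hF) mulmxK//.
    rewrite crossm_norm ?mxE ?eqxx//; first by apply: mx11_1; rewrite -(ip_frame _ _ hF).
      by apply: mx11_1; rewrite -(ip_frame _ _ hF).
    by apply: mx11_0; rewrite -(ip_frame _ _ hF).
  have uc : ip (sg z) (u z) (c z) = 0.
    by rewrite /c (ip_frame _ _ hF) (cross_frame _ _ hF) mulmxK// cross_self mxE.
  have vc : ip (sg z) (v z) (c z) = 0.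
    rewrite /c (ip_frame _ _ hF) (cross_frame _ _ hF) mulmxK// mul_crossmC linearN /= mulmxN.
    by rewrite cross_self oppr0 mxE.
  have [wu wv wc] := orthogonalize3 e3 uu vv cc uv uc vc.
  have {}wu := normalize_orth wu; have {}wv := normalize_orth wv.
  have {}wc := normalize_orth wc.
  by apply: (frame_rows_adapted hF) => //; rewrite ip_sym.
exists U3, (fun z => frame_rows (sg z) (u z) (v z) (w z)); split => //; last first.
  apply: smooth_mx => // i j; rewrite /frame_rows.
  under eq_fun do rewrite mxE.
  case: i => i hi; do 7 (case: i hi => [|i] hi /=; first by
    apply: smooth_entry => //; do ?apply: smooth_cross).
  by [].
(* At [y] the process changes nothing, so the three lengths are 1 there and [y] stays in the
   domain. *)
have rE k : row k F0 *m invmx F0 = delta_mx 0 k by rewrite -row_mul mulmxV// row1.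
have ipE k l : ip (sg y) (row k F0) (row l F0) = (k == l)%:R.
  rewrite (ip_frame _ _ hF0) !rE mxE -[RHS](sum_delta (fun i => (i == l)%:R) k).
  by apply: eq_bigr => i _; rewrite !mxE /= eq_sym.
have nE k : normalize (sg y) (row k F0) = row k F0.
  by rewrite /normalize ipE eqxx powR1 scale1r.
have uy : u y = e0 by apply: nE.
have v0y : v0 y = e1 by rewrite /v0 uy ipE scale0r subr0.
have vy : v y = e1 by rewrite /v v0y nE.
have cy : c y = row (o 2) F0.
  by rewrite /c uy vy (adapted_cross (c := o 2) hF0)// reified_sigma0.
have w0y : w0 y = e3 by rewrite /w0 uy vy cy !ipE !scale0r !subr0.
split; last by rewrite /N3 w0y ipE ltr01.
split; last by rewrite /N2 v0y ipE ltr01.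
by split => //; rewrite /N1 ipE ltr01.
Qed.

End FrameExistence.

(** * Killing spinors on the manifold *)

Section Dimension.
Variables (R : realType) (V W : lmodType R).
(** [Phi c f] is the spinor with scalar part [c] and 1-form [f]. [Z] is a set closed under linear
    combinations around [D] on which parts can be compared; closure of [D] itself is recovered from
    a basis. *)
Variables (K : set V) (D Z : set W) (Phi : R -> W -> V).
Hypothesis Phi_linear : forall k c f c' f',
  Phi (k * c + c') (k *: f + f') = k *: Phi c f + Phi c' f'.
Hypothesis Z_linear : forall k f f', Z f -> Z f' -> Z (k *: f + f').
Hypothesis DZ : D `<=` Z.
Hypothesis Phi_inj : forall c f, Z f -> Phi c f = 0 -> c = 0 /\ f = 0.
Hypothesis Phi_range : forall p, K p <-> exists c f, D f /\ p = Phi c f.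

Lemma Phi0 : Phi 0 0 = 0.
Proof.
have := Phi_linear 1 0 0 0 0; rewrite mulr0 addr0 scaler0 addr0 scale1r => /eqP.
by rewrite -subr_eq0 opprD addrA subrr sub0r oppr_eq0 => /eqP.
Qed.

Lemma Phi_sum (J : finType) (x c : J -> R) (f : J -> W) :
  Phi (\sum_i x i * c i) (\sum_i x i *: f i) = \sum_i x i *: Phi (c i) (f i).
Proof.
apply: (big_ind3 (fun a b p => Phi a b = p)); first exact: Phi0.
- move=> a1 b1 p1 a2 b2 p2 <- <-; have := Phi_linear 1 a1 b1 a2 b2.
  by rewrite mul1r !scale1r.
- move=> i _; have := Phi_linear (x i) (c i) (f i) 0 0.
  by rewrite !addr0 Phi0 addr0.
Qed.

Lemma Phi_inj2 c f c' f' : Z f -> Z f' -> Phi c f = Phi c' f' -> c = c' /\ f = f'.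
Proof.
move=> Zf Zf' h; have := Phi_linear (-1) c' f' c f; rewrite h [X in _ = X + _]scaleN1r addNr.
move=> /Phi_inj[]; first exact: Z_linear.
rewrite mulN1r scaleN1r => /eqP h1 /eqP h2; move: h1 h2.
by rewrite addrC subr_eq0 addrC subr_eq0 => /eqP -> /eqP ->.
Qed.

Definition comb (U : lmodType R) n (b : 'I_n -> U) (c : 'rV[R]_n) : U :=
  \sum_(i < n) c 0 i *: b i.

Lemma has_dimension_mem (U : lmodType R) (A : set U) n (b : 'I_n -> U) i :
  range (comb b) = A -> A (b i).
Proof.
move=> <-; exists (delta_mx 0 i) => //; rewrite /comb (bigD1 i)//= mxE !eqxx scale1r.
by rewrite big1 ?addr0// => j /negbTE h; rewrite mxE h scale0r.
Qed.

Lemma has_dimension_zero (U : lmodType R) (A : set U) n : has_dimension A n -> A 0.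
Proof.
by case=> b [_ <-]; exists 0 => //; rewrite big1// => i _; rewrite mxE scale0r.
Qed.

Lemma has_dimension_extend n : has_dimension D n -> has_dimension K n.+1.
Proof.
move=> hD; have D0 := has_dimension_zero hD; case: hD => b [b_inj b_range].
pose cf (i : 'I_n.+1) : R := if unlift ord0 i is Some _ then 0 else 1.
pose ff (i : 'I_n.+1) : W := if unlift ord0 i is Some j then b j else 0.
pose x' (x : 'rV[R]_n.+1) : 'rV[R]_n := \row_j x 0 (lift ord0 j).
have E (x : 'rV[R]_n.+1) : \sum_i x 0 i *: Phi (cf i) (ff i) = Phi (x 0 ord0) (comb b (x' x)).
  rewrite -Phi_sum big_ord_recl [X in Phi _ X]big_ord_recl /cf /ff unlift_none.
  rewrite mulr1 scaler0 add0r big1 ?addr0; last by move=> j _; rewrite liftK mulr0.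
  by congr Phi; apply: eq_bigr => j _; rewrite liftK mxE.
have Db x : D (comb b x) by rewrite -b_range; exists x.
exists (fun i => Phi (cf i) (ff i)); split.
  move=> x y; rewrite !E => /Phi_inj2[]; [exact: DZ | exact: DZ |] => h0 /b_inj h1.
  apply/rowP => i; case: (unliftP ord0 i) => [j ->|-> //].
  by have /rowP/(_ j) := h1; rewrite !mxE.
rewrite predeqE => p; split=> [[x _ <-]|/Phi_range[c [f [Df ->]]]].
  by rewrite E; apply/Phi_range; exists (x 0 ord0), (comb b (x' x)).
move: Df; rewrite -b_range => -[x _ <-].
exists (\row_i if unlift ord0 i is Some j then x 0 j else c) => //.
rewrite E mxE unlift_none; congr Phi; apply: eq_bigr => j _.
by rewrite !mxE liftK.
Qed.

(** As [Phi 1 0] lies in [K], some basis vector [b i0] has a nonzero constant part. Subtracting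
    multiples of it clears the constants of the others, and their form parts [g] are a basis of
    [D]. *)
Lemma has_dimension_restrict n : has_dimension K n.+1 -> has_dimension D n.
Proof.
move=> hK; have K0 := has_dimension_zero hK; case: hK => b [b_inj b_range].
have D0 : D 0.
  have /Phi_range[c [f [Df h]]] := K0.
  by have [_ <-] := Phi_inj (DZ Df) (esym h).
have Kb i : K (b i) := has_dimension_mem i b_range.
have /choice[cf hcf] i : exists cf : R * W, D cf.2 /\ b i = Phi cf.1 cf.2.
  by have /Phi_range[c [f h]] := Kb i; exists (c, f).
pose c i := (cf i).1; pose f i := (cf i).2.
have Df i : D (f i) by case: (hcf i).
have bE i : b i = Phi (c i) (f i) by case: (hcf i).
have combE x : comb b x = Phi (\sum_i x 0 i * c i) (\sum_i x 0 i *: f i).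
  by rewrite Phi_sum; apply: eq_bigr => i _; rewrite bE.
have Kcomb x : K (comb b x) by rewrite -b_range; exists x.
have Z0 : Z 0 := DZ D0.
have Zsum (J : finType) (x : J -> R) (g : J -> W) :
    (forall i, Z (g i)) -> Z (\sum_i x i *: g i).
  move=> hg; apply: big_ind => // [g1 g2 z1 z2|i _].
    by rewrite -[g1]scale1r; apply: Z_linear.
  by rewrite -[_ *: _]addr0; apply: Z_linear.
have Dof g : Z g -> K (Phi 0 g) -> D g.
  move=> Zg /Phi_range[c' [f' [Df' h]]].
  by have [_ ->] := Phi_inj2 Zg (DZ Df') h.
have [i0 ci0] : exists i0, c i0 != 0.
  apply: contrapT => hn; have c0 i : c i = 0.
    by apply/eqP/negPn/negP => h; apply: hn; exists i.
  have K1 : K (Phi 1 0) by apply/Phi_range; exists 1, 0.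
  move: K1; rewrite -b_range => -[x _] /=.
  rewrite -/(comb b x) combE => /Phi_inj2[]//.
    by apply: Zsum => i; apply: DZ.
  rewrite big1 => [/eqP|i _]; last by rewrite c0 mulr0.
  by rewrite eq_sym oner_eq0.
pose r j := c (lift i0 j) / c i0.
pose g j := f (lift i0 j) - r j *: f i0.
(* The coefficient at [i0] is the one that makes the constant part of the combination vanish. *)
pose ext (y : 'rV[R]_n) : 'rV[R]_n.+1 :=
  \row_i if unlift i0 i is Some j then y 0 j else - \sum_j y 0 j * r j.
have sum_split (U : lmodType R) (F : 'I_n.+1 -> U) :
    \sum_i F i = F i0 + \sum_j F (lift i0 j).
  by rewrite (bigD1_ord i0).
have extE y : comb b (ext y) = Phi 0 (comb g y).
  rewrite combE; congr Phi.
    rewrite (sum_split R^o (fun i => ext y 0 i * c i)) mxE unlift_none.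
    rewrite mulNr mulr_suml -sumrN -big_split big1//= => j _.
    by rewrite mxE liftK /r mulrA mulfVK// addNr.
  rewrite sum_split mxE unlift_none scaleNr scaler_suml -sumrN -big_split.
  by apply: eq_bigr => j _ /=; rewrite mxE liftK /g scalerBr scalerA addrC.
have Zg j : Z (g j).
  by rewrite /g addrC -scaleNr; apply: Z_linear; apply: DZ.
have Dg y : D (comb g y) by apply: Dof; [apply: Zsum | rewrite -extE].
exists g; split.
  move=> x y /(congr1 (Phi 0)); rewrite -/(comb g x) -/(comb g y) -!extE => /b_inj h.
  by apply/rowP => j; have /rowP/(_ (lift i0 j)) := h; rewrite !mxE liftK.
rewrite predeqE => p; split=> [[x _ <-]|Dp]; first exact: Dg.
have : K (Phi 0 p) by apply/Phi_range; exists 0, p.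
rewrite -b_range => -[x _]; rewrite -/(comb b x) combE => /Phi_inj2[].
- by apply: Zsum => i; apply: DZ.
- exact: DZ.
rewrite (sum_split R^o (fun i => x 0 i * c i)) sum_split => h1 h2.
exists (\row_j x 0 (lift i0 j)) => //; rewrite -h2.
transitivity (\sum_j x 0 (lift i0 j) *: f (lift i0 j) - (\sum_j x 0 (lift i0 j) * r j) *: f i0).
  rewrite scaler_suml -sumrB; apply: eq_bigr => j _.
  by rewrite mxE /g scalerBr scalerA.
rewrite addrC; congr (_ + _); rewrite -scaleNr; congr (_ *: _).
apply: (mulIf ci0); move/eqP: h1; rewrite addr_eq0 => /eqP ->.
rewrite mulNr; congr (- _); rewrite mulr_suml; apply: eq_bigr => j _.
by rewrite /r -mulrA mulfVK.
Qed.

End Dimension.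

(** * Decomposition of global spinor fields and the type *)

Section Global.
Variables (R : realType) (M : topologicalType) (A : manifold7 R M).
Local Notation E := 'rV[R]_7.
Local Notation ix := (mindex A).
Local Notation s0 := (@sigma0 R).
Variables (s : ix -> E -> tensor3 R) (rho : 'M[R]_7 -> 'M[R]_8).
Hypothesis s_G2 : G2_structure s.
Hypothesis s_np : nearly_parallel s 4.
Hypothesis rho_lift : spin_lift rho.
Implicit Types (i j : ix) (y z : E) (g : 'M[R]_7) (f : ix -> E -> E).

Lemma open_cimg i : open (cimg i). Proof. exact: cimg_open. Qed.

Lemma frame_at i y : cimg i y -> exists F, adapted_frame (s i y) F.
Proof.
case: s_G2 => _ _ h /h [B [uB ->]]; exists (invmx B); split; first by rewrite unitmx_inv.
by rewrite pull3_comp mulVmx// pull3_1.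
Qed.

Lemma np_eq i y : cimg i y -> forall a b c d,
  ext_deriv (s i) y a b c d = 4%:R * star_of (s i y) a b c d.
Proof. by move=> h a b c d; case: s_np => _ /(_ _ _ h a b c d). Qed.

Lemma s_smooth i a b c : smooth_on (cimg i) (fun y => s i y a b c : R^o).
Proof. by case: s_G2. Qed.

(** The dual form is d sigma / 4, and sigma is smooth. *)
Lemma star_smooth i a b c d :
  smooth_on (cimg i) (fun y => star_of (s i y) a b c d : R^o).
Proof.
have oi := @open_cimg i.
have h : smooth_on (cimg i) (fun y => ext_deriv (s i) y a b c d * 4%:R^-1 : R^o).
  apply: smooth_mul => //; last exact: smooth_cst.
  apply: smooth_sub_fun => //; last by apply: smooth_partial; apply: s_smooth.
  apply: smooth_add => //; last by apply: smooth_partial; apply: s_smooth.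
  by apply: smooth_sub_fun => //; apply: smooth_partial; apply: s_smooth.
apply: (smooth_ext oi _ h) => y hy.
by rewrite np_eq// mulrC mulKf// pnatr_eq0.
Qed.

Lemma local_frame i y : cimg i y -> exists U (F : E -> 'M[R]_7), U y /\ local_adapted s i U F.
Proof.
move=> hy; have [U [F [Uy oU UW sF aF]]] := local_frame_exists (@open_cimg i)
  (@s_smooth i) (@star_smooth i) (@frame_at i) hy.
by exists U, F.
Qed.

Lemma local_killing_iff i U F (h : E -> R^o) (f : E -> E) y :
  local_adapted s i U F -> smooth_on U h -> smooth_on U f -> U y ->
  (forall a, nabla_spinor (G2_metric s i) F (fun z => spinor (h z) (f z *m (F z)^T) : 'rV[R]_8) a y
    = 2^-1 *: (spinor (h y) (f y *m (F y)^T) *m clifford (row a (invmx (F y))))) <->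
  (forall a, partial a h y = 0) /\
  (forall a b, nabla_form (G2_metric s i) f a b y =
     - (4^-1 * 4%:R) * \sum_(c < 7) (f y *m invmx (G2_metric s i y)) 0 c * s i y c a b).
Proof.
move=> [oU UW sF aF] sh sf Uy.
have uF z : U z -> F z \in unitmx by move=> /aF [].
apply: (killing_iff (T := fun z => invmx (F z)) (sg := s i) oU sF) => //.
- exact: smooth_invmx.
- by move=> z Uz; rewrite mulmxV// uF.
- by move=> z Uz; apply/metric_ofE/aF.
- by move=> z b c; apply: metric_of_sym.
- by move=> z Uz; apply/adapted_coframe/aF.
- by move=> z Uz a b c d; rewrite np_eq; [rewrite (star_ofE (aF z Uz))|apply: UW].
Qed.

Lemma movl_cimg i j y : movl i j y -> cimg i y /\ cimg j (mtrans i j y).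
Proof.
move=> [x [xi xj] <-]; split; first by exists x.
by exists x => //; rewrite /mtrans /transition /= cmapK.
Qed.

Lemma adapted_transport i j y F : movl i j y -> adapted_frame (s i y) F ->
  adapted_frame (s j (mtrans i j y)) (F *m mjac i j y).
Proof.
case: s_G2 => _ ht _ hy [uF hF]; have hp : pull3 (F *m mjac i j y) (s j (mtrans i j y)) = s0.
  by rewrite -pull3_comp -ht.
by split => //; apply: pull3_unit hp.
Qed.

Lemma adapted_G2_mul (t : tensor3 R) (F : 'M[R]_7) g : adapted_frame t F -> G2 g ->
  adapted_frame t (g *m F).
Proof.
by move=> [uF hF] [ug hg]; split; rewrite ?unitmx_mul ?ug// -pull3_comp hF.
Qed.

Definition spinor_of (c : R) f : ix -> E -> 'M[R]_7 -> 'rV[R]_8 := fun i y F =>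
  if `[< cimg i y /\ adapted_frame (s i y) F >] then spinor c (f i y *m F^T) else 0.

Lemma spinor_ofE c f i y F : cimg i y -> adapted_frame (s i y) F ->
  spinor_of c f i y F = spinor c (f i y *m F^T).
Proof. by move=> h1 h2; rewrite /spinor_of asboolT. Qed.

Lemma spinor00 : spinor 0 0 = 0 :> 'rV[R]_(1 + 7).
Proof. by rewrite -[RHS](scale0r (spinor 0 0)) spinor_scale mul0r scaler0. Qed.

Lemma spinor_G2_spin (h : R) (w : E) g :
  spinor h w *m G2_spin g = spinor h (w *m g).
Proof. by rewrite /spinor mul_row_block !mulmx0 mulmx1 addr0 add0r. Qed.

Lemma spinor_of_field c f : one_form f -> spinor_field s rho (spinor_of c f).
Proof.
move=> [f0 ft fs]; split.
- by move=> i y F h; rewrite /spinor_of asboolF.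
- move=> i j y F hy hF; have [hi hj] := movl_cimg hy.
  rewrite !spinor_ofE//; last exact: adapted_transport.
  by rewrite (ft i j y hy) trmx_mul mulmxA.
- move=> i y F g hy hF hg; rewrite !spinor_ofE//; last exact: adapted_G2_mul.
  rewrite (spin_lift_G2 rho_lift hg).
  rewrite (spinor_G2_spin c (f i y *m (g *m F)^T) g) trmx_mul -!mulmxA.
  by rewrite (mulmx1C (G2_orthogonal hg)) mulmx1.
- move=> i U F [oU UW sF aF].
  apply: (smooth_ext oU (f := fun z => spinor c (f i z *m (F z)^T))).
    by move=> z Uz; rewrite spinor_ofE//; [apply: UW | apply: aF].
  apply: smooth_spinor => //; first exact: smooth_cst.
  apply: smooth_mulmx => //; last exact: smooth_tr.
  exact: smooth_sub UW (fs i).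
Qed.

Lemma nabla_spinor_ext (G : E -> 'M[R]_7) U F (p q : E -> 'rV[R]_8) a y : open U ->
  (forall z, U z -> p z = q z) -> U y -> nabla_spinor G F p a y = nabla_spinor G F q a y.
Proof.
by move=> oU pq Uy; rewrite /nabla_spinor (partial_ext a oU pq Uy) (pq _ Uy).
Qed.

Lemma spinor_of_killing c f : D1 s 4 f -> killing s rho 2^-1 (spinor_of c f).
Proof.
move=> [hf D1f]; split; first exact: spinor_of_field.
move=> i U F hU y Uy; case: (hU) => oU UW sF aF.
have sf : smooth_on U (f i) by case: hf => _ _ fs; apply: smooth_sub UW (fs i).
have [_ h] := local_killing_iff hU (smooth_cst U (c : R^o)) sf Uy.
have e z : U z -> spinor_of c f i z (F z) = spinor c (f i z *m (F z)^T).
  by move=> Uz; apply: spinor_ofE; [apply: UW | apply: aF].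
move=> a; rewrite (nabla_spinor_ext _ _ _ oU e Uy) e//; apply: h; split.
  by move=> b; rewrite /partial derive_cst.
by move=> b d; apply: D1f; apply: UW.
Qed.

(** An arbitrary choice without continuity in the point. By [spinor_decomp] the parts of a spinor
    field do not depend on it. *)
Definition some_frame i y : 'M[R]_7 := xget 1%:M (adapted_frame (s i y)).

Lemma some_frameP i y : cimg i y -> adapted_frame (s i y) (some_frame i y).
Proof. by move=> /frame_at [F hF]; apply: (xgetI 1%:M hF). Qed.

Definition scalar_part (ph : ix -> E -> 'M[R]_7 -> 'rV[R]_8) i y : R :=
  ph i y (some_frame i y) 0 0.

Definition form_part (ph : ix -> E -> 'M[R]_7 -> 'rV[R]_8) : ix -> E -> E := fun i y =>
  if `[< cimg i y >] then
    rsubmx (ph i y (some_frame i y) : 'rV[R]_(1 + 7)) *m (invmx (some_frame i y))^T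
  else 0.

(** The two frames differ by some [g] in G_2; [G2_spin g] fixes the scalar and rotates the vector
    exactly as the change of frame rotates the components of a 1-form. *)
Lemma spinor_decomp ph i y F : spinor_field s rho ph -> cimg i y ->
  adapted_frame (s i y) F ->
  ph i y F = spinor (scalar_part ph i y) (form_part ph i y *m F^T).
Proof.
move=> [_ _ h3 _] hy hF; have hF' := some_frameP hy.
have hg := adapted_G2 hF' hF; set g := F *m invmx (some_frame i y) in hg.
have uF' := adapted_unit hF'.
have Fg : g *m some_frame i y = F by rewrite /g mulmxKV.
have := h3 _ _ _ _ hy hF' hg; rewrite Fg (spin_lift_G2 rho_lift hg).
rewrite [ph i y F]spinor_split => hE.
have {}hE : ph i y (some_frame i y) =
  spinor (ph i y F 0 0) (rsubmx (ph i y F : 'rV[R]_(1 + 7)) *m g).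
  by rewrite hE spinor_G2_spin.
rewrite /scalar_part /form_part asboolT// hE spinor_scalar spinor_vector.
have gT : (invmx (some_frame i y))^T *m F^T = g^T by rewrite -trmx_mul.
by clearbody g; congr spinor; rewrite -!mulmxA gT (G2_orthogonal hg) mulmx1.
Qed.

Lemma parts_unique ph i y F c w : spinor_field s rho ph -> cimg i y ->
  adapted_frame (s i y) F -> ph i y F = spinor c (w *m F^T) ->
  scalar_part ph i y = c /\ form_part ph i y = w.
Proof.
move=> hph hy hF; rewrite (spinor_decomp hph hy hF) => /spinor_inj[-> h]; split => //.
have uF : F^T \in unitmx by rewrite unitmx_tr (adapted_unit hF).
by rewrite -[LHS](mulmxK uF) h mulmxK.
Qed.

Lemma parts_transport ph i j y : spinor_field s rho ph -> movl i j y ->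
  scalar_part ph i y = scalar_part ph j (mtrans i j y) /\
  form_part ph i y = form_part ph j (mtrans i j y) *m (mjac i j y)^T.
Proof.
move=> hph hy; have [hi hj] := movl_cimg hy; have [F hF] := frame_at hi.
apply: (parts_unique hph hi hF); case: (hph) => _ /(_ _ _ _ _ hy hF) -> _ _.
by rewrite (spinor_decomp hph hj (adapted_transport hy hF)) trmx_mul mulmxA.
Qed.

Lemma smooth_parts ph i : spinor_field s rho ph ->
  smooth_on (cimg i) (scalar_part ph i : E -> R^o) /\ smooth_on (cimg i) (form_part ph i).
Proof.
move=> hph; split; apply: smooth_local => y /local_frame[U [F [Uy hU]]];
  exists U => //; (case: (hph) => _ _ _ /(_ _ _ _ hU) sph); case: (hU) => oU UW sF aF.
  apply: (smooth_ext (f := fun z => ph i z (F z) 0 0 : R^o) oU) => [z Uz|]; last exact: smooth_entry.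
  have hz : cimg i z by apply: UW.
  by rewrite (spinor_decomp hph hz (aF z Uz)) spinor_scalar.
apply: (smooth_ext (f := fun z => rsubmx (ph i z (F z) : 'rV[R]_(1 + 7)) *m (invmx (F z))^T) oU).
  move=> z Uz; have hz : cimg i z by apply: UW.
  rewrite (spinor_decomp hph hz (aF z Uz)) spinor_vector -mulmxA -trmx_mul mulVmx ?trmx1 ?mulmx1//.
  exact: adapted_unit (aF z Uz).
apply: smooth_mulmx => //.
  by apply: smooth_mx => // k l; under eq_fun do rewrite mxE; apply: smooth_entry.
apply: smooth_tr => //; apply: smooth_invmx => // z Uz; exact: adapted_unit (aF z Uz).
Qed.

Lemma form_part_one_form ph : spinor_field s rho ph -> one_form (form_part ph).
Proof.
move=> hph; split=> [i y hy|i j y|i]; first by rewrite /form_part asboolF.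
  by case/(parts_transport hph).
by have [] := smooth_parts i hph.
Qed.

Lemma killing_parts ph : killing s rho 2^-1 ph -> D1 s 4 (form_part ph) /\
  forall i y a, cimg i y -> partial a (scalar_part ph i : E -> R^o) y = 0.
Proof.
move=> [hph K].
have key i y : cimg i y ->
    (forall a, partial a (scalar_part ph i : E -> R^o) y = 0) /\
    (forall a b, nabla_form (G2_metric s i) (form_part ph i) a b y =
     - (4^-1 * 4%:R) * \sum_(c < 7)
       (form_part ph i y *m invmx (G2_metric s i y)) 0 c * s i y c a b).
  move=> /local_frame[U [F [Uy hU]]]; case: (hU) => oU UW sF aF.
  have [ss sf] := smooth_parts i hph.
  apply/(local_killing_iff hU (smooth_sub UW ss) (smooth_sub UW sf) Uy) => a.
  have e z : U z -> ph i z (F z) = spinor (scalar_part ph i z) (form_part ph i z *m (F z)^T).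
    by move=> Uz; apply: spinor_decomp => //; [apply: UW | apply: aF].
  by rewrite -(nabla_spinor_ext _ _ _ oU e Uy) -e//; apply: (K _ _ _ hU _ Uy).
split=> [|i y a hy]; last by have [h _] := key i y hy.
split=> [|i y hy]; first exact: form_part_one_form.
by have [_ h] := key i y hy.
Qed.

Lemma cmap_cts i x : cdom (mchart i) x -> {for x, continuous (cmap (mchart i))}.
Proof.
move=> hx; have := cmap_continuous (c := mchart i).
rewrite continuous_open_subspace; last exact: cdom_open.
by apply; rewrite inE.
Qed.

Hypothesis M_connected : connected [set: M].
Hypothesis M_inhabited : exists x : M, True.

Lemma chart_constant (h : ix -> E -> R) :
  (forall i j y, movl i j y -> h i y = h j (mtrans i j y)) ->
  (forall i, smooth_on (cimg i) (h i : E -> R^o)) ->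
  (forall i y a, cimg i y -> partial a (h i : E -> R^o) y = 0) ->
  exists c, forall i y, cimg i y -> h i y = c.
Proof.
move=> ht hs hp; have [x0 _] := M_inhabited; have [i0 hi0] := m_cover A x0.
pose B (P : set R) := [set x | exists i, cdom (mchart i) x /\ P (h i (cmap (mchart i) x))].
have oB P : open (B P).
  rewrite openE => x [i [hx Px]]; rewrite /interior.
  have iy : cimg i (cmap (mchart i) x) by exists x.
  have lc : \forall z \near cmap (mchart i) x, h i z = h i (cmap (mchart i) x).
    apply: (locally_constant (@open_cimg i) iy) => [z|z a]; last exact: hp.
    exact: smooth_differentiable (hs i).
  have n1 : \forall x' \near x, h i (cmap (mchart i) x') = h i (cmap (mchart i) x).
    exact: (cmap_cts hx) lc.
  have n2 : \forall x' \near x, cdom (mchart i) x'.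
    by apply: open_nbhs_nbhs; split=> //; exact: cdom_open.
  apply: filterS2 n1 n2 => x' e hx'; exists i; split=> //.
  by rewrite e.
pose c := h i0 (cmap (mchart i0) x0).
have BC : B [set c] = ~` B (~` [set c]).
  rewrite predeqE => x; split=> [[i [hx e]] [j [jx]]|nB]; last first.
    have [i hx] := m_cover A x; exists i; split=> //.
    by apply: contrapT => e; apply: nB; exists i.
  apply; rewrite /= -e (ht i j); last by exists x.
  by rewrite /mtrans /transition /= cmapK.
have BT : B [set c] = setT.
  apply: M_connected; first by exists x0, i0.
    by exists (B [set c]); rewrite ?setTI.
  by exists (B [set c]); rewrite ?setTI// {1}BC closedC.
exists c => i y [x hx <-].
have : B [set c] x by rewrite BT.
move=> [j [jx <-]]; rewrite (ht i j); last by exists x.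
by rewrite /mtrans /transition /= cmapK.
Qed.

Lemma killing_range ph : killing s rho 2^-1 ph <->
  exists c f, D1 s 4 f /\ ph = spinor_of c f.
Proof.
split=> [hK|[c [f [Df ->]]]]; last exact: spinor_of_killing.
have [hD hp] := killing_parts hK; case: (hK) => hph _.
have [|i|c hc] := chart_constant _ _ hp.
- by move=> i j y /(parts_transport hph)[].
- by have [] := smooth_parts i hph.
exists c, (form_part ph); split=> //.
apply/funext => i; apply/funext => y; apply/funext => F.
have [[hy hF]|nh] := pselect (cimg i y /\ adapted_frame (s i y) F).
  by rewrite spinor_ofE// (spinor_decomp hph hy hF) hc.
by rewrite /spinor_of asboolF//; case: hph => ->.
Qed.

Lemma spinor_of_linear (k c : R) f (c' : R) f' :
  spinor_of (k * c + c') (k *: f + f') = k *: spinor_of c f + spinor_of c' f'.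
Proof.
apply/funext => i; apply/funext => y; apply/funext => F; rewrite !fctE /spinor_of.
case: asboolP => _; last by rewrite scaler0 addr0.
by rewrite spinor_scale spinor_add mulmxDl -scalemxAl.
Qed.

Lemma point_exists : exists i y, cimg (A := A) i y.
Proof.
have [x _] := M_inhabited; have [i hi] := m_cover A x.
by exists i, (cmap (mchart i) x), x.
Qed.

Lemma spinor_of_inj c f : (forall i y, ~ cimg i y -> f i y = 0) ->
  spinor_of c f = 0 -> c = 0 /\ f = 0.
Proof.
move=> f0 h.
have key i y : cimg i y -> c = 0 /\ f i y = 0.
  move=> hy; have [F hF] := frame_at hy.
  have : spinor c (f i y *m F^T) = 0 by rewrite -spinor_ofE// h.
  rewrite -spinor00 -(mul0mx _ F^T).
  move=> /spinor_inj[-> e]; split=> //.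
  have uF : F^T \in unitmx by rewrite unitmx_tr (adapted_unit hF).
  by rewrite -[LHS](mulmxK uF) e !mul0mx.
have [i0 [y0 /key[c0 _]]] := point_exists; split=> //.
apply/funext => i; apply/funext => y.
by have [/key[]|/f0] := pselect (cimg i y).
Qed.

Lemma killing_dimension n :
  has_dimension (killing s rho 2^-1) n.+1 <-> has_dimension (D1 s 4) n.
Proof.
pose Z := [set f : ix -> E -> E | forall i y, ~ cimg i y -> f i y = 0].
have Zl k f f' : Z f -> Z f' -> Z (k *: f + f').
  by move=> h h' i y hy; rewrite !fctE h// h'// scaler0 addr0.
have DZ : D1 s 4 `<=` Z by move=> f [[]].
split; [apply: has_dimension_restrict | apply: has_dimension_extend].
all: first [exact: spinor_of_linear | exact: Zl | exact: DZ | exact: spinor_of_inj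
  | exact: killing_range].
Qed.

(** G_2 moves each of [v / |v|] and its opposite to the first axis; an invariant [v] would make both
    equal to that axis. *)
Lemma G2_fixed_vector (v : E) : (forall g, G2 g -> v *m g = v) -> v = 0.
Proof.
move=> hv; have [//|n0] := eqVneq v 0.
pose r := (v *m v^T) 0 0.
have rE : r = \sum_j v 0 j ^+ 2.
  by rewrite /r mxE; apply: eq_bigr => j _; rewrite mxE expr2.
have r0 : 0 < r.
  rewrite lt_neqAle rE sumr_ge0 ?andbT => [|j _]; last exact: sqr_ge0.
  apply: contra_neq n0 => /esym/eqP; rewrite psumr_eq0 => [/allP h|j _]; last exact: sqr_ge0.
  apply/rowP => j; rewrite mxE; apply/eqP; rewrite -sqrf_eq0.
  by have /h := mem_index_enum j.
pose u := (Num.sqrt r)^-1 *: v.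
have uu : u *m u^T = 1%:M.
  apply/matrixP => a b; rewrite !ord1 /u linearZ /= -scalemxAl -scalemxAr scalerA.
  rewrite mxE -/r mxE eqxx -invfM -expr2 sqr_sqrtr ?ltW// mulVf//.
  exact: lt0r_neq0.
have nu : (- u) *m (- u)^T = 1%:M by rewrite linearN /= mulNmx mulmxN opprK.
have uf g : G2 g -> u *m g = u by move=> hg; rewrite /u -scalemxAl hv.
have [q /square_product_G2 hq eq] := unit_to_axis0 uu.
have [q' /square_product_G2 hq' eq'] := unit_to_axis0 nu.
move: eq eq'; rewrite mulNmx !uf// => -> /rowP/(_ ord0); rewrite !mxE /= => h.
by exfalso; lra.
Qed.

Lemma spinor_of0E c i y F : cimg i y -> adapted_frame (s i y) F ->
  spinor_of c 0 i y F = spinor c 0.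
Proof. by move=> hy hF; rewrite spinor_ofE//; congr spinor; apply: mul0mx. Qed.

Lemma D1_zero : D1 s 4 0.
Proof.
split.
  split=> // [i j y _|i]; last exact: smooth_cst.
  by apply/esym; apply: mul0mx.
move=> i y _ a b; rewrite /nabla_form.
have -> : partial a (fun z : E => (0 : ix -> E -> E) i z 0 b : R^o) y = 0.
  rewrite (_ : (fun z : E => _) = fun=> 0); first by rewrite /partial derive_cst.
  by apply/funext => z; rewrite mxE.
rewrite !big1 ?subr0 ?mulr0// => c _; last by rewrite mxE mulr0.
by rewrite (_ : (0 : ix -> E -> E) i y = 0)// mul0mx mxE mul0r.
Qed.

(** Equivariance makes the constant value [chi] invariant under [G2_spin], so it has no vector
    part. *)
Lemma determined_spinor_of ph : determined_spinor s rho ph ->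
  exists2 c : R, c != 0 & ph = spinor_of c 0.
Proof.
move=> [hph [chi chi0 hchi]]; have [i0 [y0 hy0]] := point_exists.
have [F0 hF0] := frame_at hy0; set v := rsubmx (chi : 'rV[R]_(1 + 7)).
have chiE : chi = spinor (chi 0 0) v by exact: spinor_split.
have v0 : v = 0.
  apply: G2_fixed_vector => g hg; case: (hph) => _ _ /(_ _ _ _ _ hy0 hF0 hg) + _.
  rewrite !hchi//; last exact: adapted_G2_mul.
  by rewrite (spin_lift_G2 rho_lift hg) {1 2}chiE spinor_G2_spin => /spinor_inj[_ <-].
exists (chi 0 0).
  apply: contra_neq chi0 => c0; rewrite chiE v0 c0.
  exact: spinor00.
apply/funext => i; apply/funext => y; apply/funext => F.
have [[hy hF]|nh] := pselect (cimg i y /\ adapted_frame (s i y) F).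
  by rewrite spinor_of0E// hchi// {1}chiE v0.
by rewrite /spinor_of asboolF//; case: hph => ->.
Qed.

Lemma spinor_of_determined (c : R) : c != 0 -> determined_spinor s rho (spinor_of c 0).
Proof.
move=> c0; split.
  by apply: spinor_of_field; case: D1_zero.
exists (spinor c 0).
  by apply: contra_neq c0; rewrite -spinor00 => /spinor_inj[].
by move=> i y F hy hF; rewrite spinor_of0E.
Qed.

Lemma of_type_dimension k : of_type s rho k.+1 <-> has_dimension (D1 s 4) k.
Proof.
split=> [[lam [_ [ph hdet hK] hdim]]|hD].
  have [c c0 phE] := determined_spinor_of hdet.
  suff lamE : lam = 2^-1 by apply/killing_dimension; rewrite -lamE.
  have [i [y hy]] := point_exists; have [U [F [Uy hU]]] := local_frame hy.
  case: (hU) => oU UW sF aF; have hF := aF y Uy.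
  have [_ /(_ _ _ _ hU _ Uy) e1] := hK.
  (* The determined spinor satisfies the Killing equation with both constants. Their difference,
     times [c], annihilates the rows of an invertible coframe and is therefore 0. *)
  have [_ /(_ _ _ _ hU _ Uy) e2] : killing s rho 2^-1 ph.
    by rewrite phE; apply: spinor_of_killing D1_zero.
  have uT : invmx (F y) \in unitmx by rewrite unitmx_inv (adapted_unit hF).
  have h a : (lam - 2^-1) * c *: row a (invmx (F y)) = 0.
    have := e1 a; rewrite e2 phE spinor_of0E// spinor_clifford !spinor_scale !mul0mx addr0.
    move=> /spinor_inj[_]; rewrite mulrBl scalerBl !scalerA => ->.
    by rewrite subrr.
  have : ((lam - 2^-1) * c) *: invmx (F y) = 0.
    by apply/row_matrixP => a; rewrite linearZ /= h linear0.
  move/eqP; rewrite scaler_eq0 mulf_eq0 (negbTE c0) orbF subr_eq0 => /orP[/eqP//|/eqP T0].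
  by move: uT; rewrite T0 unitmxE det0 unitr0.
exists 2^-1; split.
- by rewrite invr_eq0 pnatr_eq0.
- exists (spinor_of 1 0); first by apply: spinor_of_determined; exact: oner_neq0.
  by apply: spinor_of_killing; exact: has_dimension_zero hD.
- exact/killing_dimension.
Qed.

End Global.

Theorem theorem4p2 (R : realType) (M : topologicalType) (A : manifold7 R M)
    (s : mindex A -> 'rV[R]_7 -> tensor3 R) (rho : 'M[R]_7 -> 'M[R]_8)
    (M_compact : compact [set: M]) (M_connected : connected [set: M])
    (s_G2 : G2_structure s) (s_nearly_parallel : nearly_parallel s 4)
    (s_not_constant : ~ constant_curvature s) (rho_lift : spin_lift rho) :
  [/\ of_type s rho 1 <-> has_dimension (D1 s 4) 0,
      of_type s rho 2 <-> has_dimension (D1 s 4) 1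
    & of_type s rho 3 <-> has_dimension (D1 s 4) 2].
Proof.
(* On an empty manifold the condition of constant curvature would hold vacuously. *)
have M_inhabited : exists x : M, True.
  apply: contrapT => empty; apply: s_not_constant; exists 0 => i y [x _ _].
  by case: empty; exists x.
by split; apply: of_type_dimension.
Qed.
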